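(* Let $X$ be a Hilbert space with inner product $\langle\cdot,\cdot\rangle$, $A:D(A)\subset X\to X$ a self-adjoint nonpositive closed operator generating an analytic semigroup $(S(t))_{t\ge0}$ on $X$, and $X_\zeta=D((-A)^\zeta)$ for $\zeta\ge0$. Let $T>0$, $\eta\in(1/2,1)$, $x_1,\dots,x_m\in C^\eta([0,T])$, let $\alpha\in(0,1)$ with $\eta+\alpha>1$, let $\sigma_1,\dots,\sigma_m:X\to X$ satisfy the assumptions on $\sigma$ listed in the context with this $\alpha$, and suppose that the standing assumptions listed in the context hold. Let $\varphi\in X_\varepsilon$ for some $\varepsilon\in[0,1)$, let $\psi\in X_\zeta$ for some $\zeta\in[\alpha,1)$, let $y$ be the mild solution to $$dy(t)=Ay(t)\,dt+\sum_{i=1}^m\sigma_i(y(t))\,dx_i(t),\quad t\in(0,T],\qquad y(0)=\psi,$$ and let $K:=\{z\in X:\langle z,\varphi\rangle\le0\}$ be invariant for $y$. Then: (i) If $\psi\in\partial K$ and $\eta\le\zeta+\varepsilon\le1$, then $$\limsup_{t\to0^+}t^{-\beta}\sum_{i=1}^m\langle\varphi,\sigma_i(\psi)\rangle(x_i(t)-x_i(0))\le0$$ for $\beta\in[\eta,\zeta+\varepsilon)$, and $$\sup_{\lambda>0}\limsup_{t\to0^+}t^{-\beta}\Big(-\int_0^t\frac{(\lambda+\langle\varphi,y(s)\rangle)_+}{\lambda}\langle(-A)^\varepsilon\varphi,(-A)^{1-\varepsilon}y(s)\rangle\,ds+\sum_{i=1}^m\langle\varphi,\sigma_i(\psi)\rangle(x_i(t)-x_i(0))\Big)\le0$$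 for $\beta\in[\zeta+\varepsilon,1]$. (ii) If $y(t_0)\in\partial K$ for some $t_0\in[0,T)$ and $\zeta+\varepsilon>1$, then $$\limsup_{t\to t_0^+}|t-t_0|^{-\beta}\sum_{i=1}^m\langle\varphi,\sigma_i(y(t_0))\rangle(x_i(t)-x_i(t_0))\le0$$ if $\beta\in[\eta,1)$, and $$\limsup_{t\to t_0^+}|t-t_0|^{-1}\sum_{i=1}^m\langle\varphi,\sigma_i(y(t_0))\rangle(x_i(t)-x_i(t_0))-\langle(-A)^\varepsilon\varphi,(-A)^{1-\varepsilon}y(t_0)\rangle\le0$$ if $\beta=1$.
   Context: Notation. $|\cdot|_\zeta$ is the (graph) norm of $X_\zeta=D((-A)^\zeta)$, so $X_0=X$, $X_1=D(A)$; $r_+=\max\{r,0\}$; $[a,b]^2_<=\{(s,t)\in\mathbb R^2:a\le s<t\le b\}$; $C^\eta([0,T])$ is the space of real $\eta$-Hölder continuous functions. Invariance. A closed convex set $K\subset X$ is invariant for the mild solution $y$ to the equation $dy(t)=Ay(t)\,dt+\sum_{i=1}^m\sigma_i(y(t))\,dx_i(t)$, $t\in(0,T]$, $y(0)=\psi$, if for every initial datum $\psi\in X_\alpha\cap K$ the corresponding mild solution satisfies $y(t)\in K$ for every $t\in[0,T]$. Semigroup estimates. For every $T>0$: (a) for all $\zeta,\alpha\in[0,2)$ with $\zeta\le\alpha$ there is $M_{\zeta,\alpha,T}>0$ with $\|S(t)\|_{\mathscr L(X_\zeta,X_\alpha)}\le M_{\zeta,\alpha,T}\,t^{-\alpha+\zeta}$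 for $t\in(0,T]$; (b) for all $\mu,\nu\in[0,1]$ with $\mu>\nu$ there is $C_{\mu,\nu,T}>0$ with $\|S(t)-I\|_{\mathscr L(X_\mu,X_\nu)}\le C_{\mu,\nu,T}\,t^{\mu-\nu}$ for $t\in(0,T]$. Function spaces. For $f\in C([a,b];X)$ put $(\hat\delta_1 f)(s,t)=f(t)-S(t-s)f(s)$. For $\alpha,\beta\in[0,2)$, $\hat C_\beta([a,b];X_\alpha)$ is the set of $f\in C([a,b];X_\alpha)$ such that $\hat\delta_1f\in C([a,b]^2_<;X_\alpha)$ and $\sup_{(s,t)\in[a,b]^2_<}|(\hat\delta_1f)(s,t)|_\alpha/|t-s|^\beta<\infty$. Young integrals. Let $x\in C^\eta([a,b])$, $(s,t)\in[a,b]^2_<$, and let $\Pi=\{s=t_0<\dots<t_n=t\}$ denote partitions of mesh $|\Pi|$. If $f$ is $\rho$-Hölder continuous on $[a,b]$ (with values in $\mathbb R$ or in $X$) with $\rho\in(1-\eta,1)$, then $\int_s^tf(u)\,dx(u):=\lim_{|\Pi|\to0}\sum_{i}f(t_i)(x(t_{i+1})-x(t_i))$. If $f\in\hat C_k([a,b];X_\beta)$ with $\beta\in[0,2)$, $\eta+k>1$, then $\int_s^tS(t-r)f(r)\,dx(r):=\lim_{|\Pi|\to0}\sum_{i}S(t-t_i)f(t_i)(x(t_{i+1})-x(t_i))$. Both limits are known to exist; the integrals are $0$ if $s=t$. Assumptions on $\sigma$ (required of each $\sigma=\sigma_i$ with the same $\alpha$). $\sigma:X\to X$ is Fréchet differentiable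 with bounded and locally Lipschitz continuous Fréchet derivative; the restriction of $\sigma$ to $X_\alpha$ maps $X_\alpha$ into itself, is locally Lipschitz continuous on $X_\alpha$, and there is $L_\sigma^\alpha>0$ with $|\sigma(z)|_\alpha\le L_\sigma^\alpha(1+|z|_\alpha)$ for $z\in X_\alpha$. Here ''locally Lipschitz'' means Lipschitz on every bounded set. Mild solution. A mild solution is a function $y:[0,T]\to X$ such that $\sigma_i(y)\in\hat C_\alpha([0,T];X)$ for $i=1,\dots,m$ and $y(t)=S(t)\psi+\sum_{i=1}^m\int_0^tS(t-r)\sigma_i(y(r))\,dx_i(r)$ for every $t\in[0,T]$. Standing assumptions (the paper supposes that its preceding results hold in this setting). For every $\psi\in X_\alpha$ there is a unique mild solution $y\in\hat C_\alpha([0,T];X_\alpha)$; it belongs to $\hat C_{\eta+\alpha-\gamma}([a,T];X_\gamma)$ for every $a\in(0,T)$, $\gamma\in[\eta+\alpha-1,\eta+\alpha)$; for every $\mu\in[0,\eta+\alpha-1)$ and $\epsilon>0$ there is $c>0$ with $|y(t)|_{1+\mu}\le c\,t^{\eta+\alpha-2-\mu-\epsilon}$ for $t\in(0,T]$; and $y(t)=\psi+\int_0^tAy(u)\,du+\sum_{i=1}^m\int_0^t\sigma_i(y(u))\,dx_i(u)$ for $t\in[0,T]$. Moreover the chain rule holds: if $F\in C^1([0,T]\times X)$ is real-valued and $F_x$ is $\alpha$-Hölder continuous in $t$, locally uniformly in $x$, and locally $\gamma$-Hölder continuous in $x$, uniformly in $t$, with $\gamma\in(0,1)$, $\eta+\alpha\gamma>1$,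 then for $(s,t)\in[0,T]^2_<$ one has $F(t,y(t))-F(s,y(s))=\int_s^tF_t(u,y(u))\,du+\int_s^t\langle F_x(u,y(u)),Ay(u)\rangle\,du+\sum_{i=1}^m\int_s^t\langle F_x(u,y(u)),\sigma_i(y(u))\rangle\,dx_i(u)$.
   Formalization: In (ii) the formal theorem also assumes ψ ∈ K; without it the claim fails (X=R, A=0, σ=1, φ=1, ψ=1, x ≤ x(0) decreasing by 1 up to t_0, then increasing with slope 1: K is invariant and y(t_0) ∈ ∂K, but the β=1 expression equals 1). *)

(* Defs.v *)
From HB Require Import structures.
From mathcomp Require Import all_boot all_order all_algebra.
From mathcomp Require Import sesquilinear.
From mathcomp Require Import all_classical all_reals all_analysis.

Set Implicit Arguments.
Unset Strict Implicit.
Unset Printing Implicit Defensive.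

Import Order.TTheory GRing.Theory Num.Theory.
Import numFieldNormedType.Exports.

Local Open Scope classical_set_scope.
Local Open Scope ring_scope.

(** Unbounded operators.  The value of [A] outside [dom A] is irrelevant. *)

Record operator (X : Type) := Operator { dom : set X ; app :> X -> X }.

Definition linear_operator (R : realType) (X : normedModType R)
    (A : operator X) : Prop :=
  dom A 0 /\
  forall (a : R) u v, dom A u -> dom A v ->
    dom A (a *: u + v) /\ A (a *: u + v) = a *: A u + A v.

Definition closed_operator (R : realType) (X : normedModType R)
    (A : operator X) : Prop :=
  closed [set p : X * X | dom A p.1 /\ p.2 = A p.1].

(* The right-hand side of the equivalence says that [u] is in the domain of
   the adjoint of [A], with value [w]. *)
Definition self_adjoint (R : realType) (X : normedModType R)
    (ip : X -> X -> R) (A : operator X) : Prop :=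
  dense (dom A) /\
  forall u w, (dom A u /\ A u = w) <->
              (forall v, dom A v -> ip (A v) u = ip v w).

Definition nonpositive (R : realType) (X : normedModType R)
    (ip : X -> X -> R) (A : operator X) : Prop :=
  forall u, dom A u -> ip (A u) u <= 0.

(** Semigroups.  Only the values [S t] with [0 <= t] are meaningful. *)

Definition C0_semigroup (R : realType) (X : normedModType R)
    (S : R -> {linear X -> X}) : Prop :=
  [/\ forall t, 0 <= t -> continuous (S t),
      forall u, S 0 u = u,
      forall s t u, 0 <= s -> 0 <= t -> S (s + t) u = S s (S t u)
    & forall u, S t u @[t --> 0^'+] --> u].

Definition generates (R : realType) (X : normedModType R)
    (A : operator X) (S : R -> {linear X -> X}) : Prop :=
  forall u v, (dom A u /\ A u = v) <->
              (t^-1 *: (S t u - u) @[t --> 0^'+] --> v).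

Definition sector (R : realType) (c : R) : set (R * R) :=
  [set z | 0 < z.1 /\ `|z.2| < c * z.1].

(* As [X] is a real space, the holomorphic extension of [S] to a sector takes
   its values in the complex linear operators on X + iX.  Such an operator is
   determined by its restriction to X, of the form P + iQ with P and Q real
   linear; [P z] and [Q z] are these two parts at the point z.1 + i z.2. *)
Definition analytic_semigroup (R : realType) (X : normedModType R)
    (S : R -> {linear X -> X}) : Prop :=
  exists (c : R) (P Q : R * R -> {linear X -> X}),
  [/\ 0 < c,
      forall z, sector c z -> continuous (P z) /\ continuous (Q z),
      forall t u, 0 < t -> P (t, 0) u = S t u /\ Q (t, 0) u = 0,
      forall z w u, sector c z -> sector c w ->
        P (z + w) u = P z (P w u) - Q z (Q w u) /\
        Q (z + w) u = P z (Q w u) + Q z (P w u)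
    & (forall u,
         P z u @[z --> within (sector c) (nbhs ((0 : R), (0 : R)))] --> u /\
         Q z u @[z --> within (sector c) (nbhs ((0 : R), (0 : R)))] --> (0 : X))
      /\
      (forall u z, sector c z ->
         [/\ differentiable (fun w : R * R => P w u) z,
             differentiable (fun w : R * R => Q w u) z,
             'D_((1 : R), (0 : R)) (fun w : R * R => P w u) z =
               'D_((0 : R), (1 : R)) (fun w : R * R => Q w u) z
           & 'D_((0 : R), (1 : R)) (fun w : R * R => P w u) z =
               - 'D_((1 : R), (0 : R)) (fun w : R * R => Q w u) z])].

(** Bochner integral with respect to the Lebesgue measure: limit of the
    integrals of simple functions converging to [f] in the mean. *)

Definition bochner (R : realType) (X : normedModType R)
    (D : set R) (f : R -> X) (v : X) : Prop :=
  exists (k : nat -> nat) (B : nat -> nat -> set R) (c : nat -> nat -> X),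
  let g n u := \sum_(j < k n) (\1_(B n j) u *: c n j) in
  [/\ forall n j, measurable (B n j) /\
        (@lebesgue_measure R (B n j) < +oo)%E,
      forall n, measurable_fun D (fun u => `|f u - g n u|),
      (\int[@lebesgue_measure R]_(u in D) `|f u - g n u|%:E)%E
        @[n --> \oo] --> 0%E
    & \sum_(j < k n) (fine (@lebesgue_measure R (B n j `&` D)) *: c n j)
        @[n --> \oo] --> v].

(** Fractional powers of [- A], where [S] is the semigroup generated by [A].
    For 0 < theta < 1 and l >= 0 one has
      (int_0^oo t^(-theta-1) (1 - e^(-t)) dt) l^theta
        = int_0^oo t^(-theta-1) (1 - e^(-tl)) dt,
    the constant being - Gamma(-theta).  Balakrishnan's definition substitutes
    - A for l on D(A), which gives [balakrishnan], and (-A)^theta is the closure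
    of the operator thus obtained.  For zeta = n + theta with n natural and
    0 <= theta < 1, (-A)^zeta is the composite (-A)^theta (-A)^n. *)

Definition balakrishnan_cst (R : realType) (theta : R) : R :=
  \int[@lebesgue_measure R]_(t in `]0, +oo[)
    (t `^ (- theta - 1) * (1 - expR (- t))).

Definition balakrishnan (R : realType) (X : normedModType R)
    (A : operator X) (S : R -> {linear X -> X}) (theta : R) (u v : X) : Prop :=
  dom A u /\
  bochner `]0, +oo[ (fun t => t `^ (- theta - 1) *: (u - S t u))
    (balakrishnan_cst theta *: v).

Definition fracpow_graph (R : realType) (X : normedModType R)
    (A : operator X) (S : R -> {linear X -> X}) (theta : R) : set (X * X) :=
  if theta == 0 then [set p | p.2 = p.1]
  else closure [set p | balakrishnan A S theta p.1 p.2].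

Fixpoint natpow_graph (R : realType) (X : normedModType R)
    (A : operator X) (n : nat) (u v : X) : Prop :=
  if n is n'.+1 then dom A u /\ natpow_graph A n' (- A u) v else v = u.

Definition power_graph (R : realType) (X : normedModType R)
    (A : operator X) (S : R -> {linear X -> X}) (zeta : R) (u v : X) : Prop :=
  let n := Num.truncn zeta in
  exists w, natpow_graph A n u w /\ fracpow_graph A S (zeta - n%:R) (w, v).

(* [Xdom A S zeta] is X_zeta = D((-A)^zeta) and [npow A S zeta] is (-A)^zeta,
   with an irrelevant value outside X_zeta. *)
Definition Xdom (R : realType) (X : normedModType R)
    (A : operator X) (S : R -> {linear X -> X}) (zeta : R) : set X :=
  [set u | exists v, power_graph A S zeta u v].

Definition npow (R : realType) (X : normedModType R)
    (A : operator X) (S : R -> {linear X -> X}) (zeta : R) (u : X) : X :=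
  xget 0 [set v | power_graph A S zeta u v].

(* Graph norm, up to a factor: for zeta = 0 this is twice the norm of X. *)
Definition Xnorm (R : realType) (X : normedModType R)
    (A : operator X) (S : R -> {linear X -> X}) (zeta : R) (u : X) : R :=
  `|u| + `|npow A S zeta u|.

Definition semigroup_estimates (R : realType) (X : normedModType R)
    (A : operator X) (S : R -> {linear X -> X}) : Prop :=
  forall T : R, 0 < T ->
  (forall zeta alpha, 0 <= zeta -> zeta <= alpha -> alpha < 2 ->
     exists2 M, 0 < M &
       forall t u, 0 < t <= T -> Xdom A S zeta u ->
         Xdom A S alpha (S t u) /\
         Xnorm A S alpha (S t u) <= M * t `^ (- alpha + zeta) * Xnorm A S zeta u)
  /\
  (forall mu nu, 0 <= nu -> nu < mu -> mu <= 1 ->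
     exists2 C, 0 < C &
       forall t u, 0 < t <= T -> Xdom A S mu u ->
         Xdom A S nu (S t u - u) /\
         Xnorm A S nu (S t u - u) <= C * t `^ (mu - nu) * Xnorm A S mu u).

(** Function spaces. *)

Definition holder_on (R : realType) (T eta : R) (x : R -> R) : Prop :=
  exists C, forall s t, 0 <= s <= T -> 0 <= t <= T ->
    `|x s - x t| <= C * `|s - t| `^ eta.

Definition simplex2 (R : realType) (a b : R) : set (R * R) :=
  [set p | [/\ a <= p.1, p.1 < p.2 & p.2 <= b]].

Definition hat_delta (R : realType) (X : normedModType R)
    (S : R -> {linear X -> X}) (f : R -> X) (p : R * R) : X :=
  f p.2 - S (p.2 - p.1) (f p.1).

(* f in C(D; X_alpha), for a subset D of a topological space *)
Definition Xcontinuous (R : realType) (X : normedModType R)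
    (A : operator X) (S : R -> {linear X -> X}) (alpha : R)
    (U : topologicalType) (D : set U) (f : U -> X) : Prop :=
  forall p, D p -> Xdom A S alpha (f p) /\
    Xnorm A S alpha (f q - f p) @[q --> within D (nbhs p)] --> (0 : R).

(* f in \hat C_beta([a, b]; X_alpha) *)
Definition hatC (R : realType) (X : normedModType R)
    (A : operator X) (S : R -> {linear X -> X}) (beta a b alpha : R)
    (f : R -> X) : Prop :=
  [/\ Xcontinuous A S alpha (`[a, b] : set R) f,
      Xcontinuous A S alpha (simplex2 a b) (hat_delta S f)
    & exists C, forall p, simplex2 a b p ->
        Xnorm A S alpha (hat_delta S f p) <= C * (p.2 - p.1) `^ beta].

(** Young integrals.  A partition a = t_0 < ... < t_n = b is represented by
    the sequence [:: t_1; ...; t_n] ([itv_partition]). *)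

Definition partition_limit (R : realType) (V : normedModType R)
    (Xi : R -> R -> V) (a b : R) (v : V) : Prop :=
  forall e : R, 0 < e -> exists2 d : R, 0 < d &
    forall p : seq R, itv_partition a b p ->
      all (fun l => l < d) (pairmap (fun s t => t - s) a p) ->
      `|\sum_(z <- pairmap Xi a p) z - v| < e.

(* v = int_a^b f dx *)
Definition young (R : realType) (V : normedModType R)
    (x : R -> R) (f : R -> V) (a b : R) (v : V) : Prop :=
  partition_limit (fun s t => (x t - x s) *: f s) a b v.

(* v = int_a^b S(b - r) f(r) dx(r) *)
Definition young_conv (R : realType) (X : normedModType R)
    (S : R -> {linear X -> X}) (x : R -> R) (f : R -> X) (a b : R) (v : X)
    : Prop :=
  partition_limit (fun s t => (x t - x s) *: S (b - s) (f s)) a b v.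

Definition sigma_assumptions (R : realType) (X : normedModType R)
    (A : operator X) (S : R -> {linear X -> X}) (alpha : R)
    (sigma : X -> X) : Prop :=
  [/\ forall z, differentiable sigma z,
      exists C : R, forall z h, `|'d sigma z h| <= C * `|h|,
      forall r : R, exists L : R, forall z w h, `|z| <= r -> `|w| <= r ->
        `|'d sigma z h - 'd sigma w h| <= L * `|z - w| * `|h|,
      forall r : R, exists L : R, forall z w,
        Xdom A S alpha z -> Xdom A S alpha w ->
        Xnorm A S alpha z <= r -> Xnorm A S alpha w <= r ->
        Xnorm A S alpha (sigma z - sigma w) <= L * Xnorm A S alpha (z - w)
    & exists2 L : R, 0 < L & forall z, Xdom A S alpha z ->
        Xdom A S alpha (sigma z) /\
        Xnorm A S alpha (sigma z) <= L * (1 + Xnorm A S alpha z)].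

(** Mild solutions. *)

Definition mild_solution (R : realType) (X : normedModType R)
    (A : operator X) (S : R -> {linear X -> X}) (m : nat)
    (sigma : 'I_m -> X -> X) (x : 'I_m -> R -> R) (T alpha : R)
    (psi : X) (y : R -> X) : Prop :=
  (forall i, hatC A S alpha 0 T 0 (fun t => sigma i (y t))) /\
  (forall t, 0 <= t <= T -> exists I : 'I_m -> X,
     (forall i, young_conv S (x i) (fun r => sigma i (y r)) 0 t (I i)) /\
     y t = S t psi + \sum_(i < m) I i).

(* the mild solutions in \hat C_alpha([0, T]; X_alpha), the class in which
   existence and uniqueness are assumed *)
Definition solution (R : realType) (X : normedModType R)
    (A : operator X) (S : R -> {linear X -> X}) (m : nat)
    (sigma : 'I_m -> X -> X) (x : 'I_m -> R -> R) (T alpha : R)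
    (psi : X) (y : R -> X) : Prop :=
  mild_solution A S sigma x T alpha psi y /\ hatC A S alpha 0 T alpha y.

Definition well_posed (R : realType) (X : normedModType R)
    (A : operator X) (S : R -> {linear X -> X}) (m : nat)
    (sigma : 'I_m -> X -> X) (x : 'I_m -> R -> R) (T alpha : R) : Prop :=
  forall psi, Xdom A S alpha psi ->
    exists y, solution A S sigma x T alpha psi y /\
      forall y', solution A S sigma x T alpha psi y' ->
        forall t, 0 <= t <= T -> y' t = y t.

Definition space_regular (R : realType) (X : normedModType R)
    (A : operator X) (S : R -> {linear X -> X}) (T eta alpha : R)
    (y : R -> X) : Prop :=
  (forall a gamma, 0 < a < T -> eta + alpha - 1 <= gamma < eta + alpha ->
     hatC A S (eta + alpha - gamma) a T gamma y) /\
  (forall mu eps, 0 <= mu < eta + alpha - 1 -> 0 < eps ->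
     exists2 c : R, 0 < c & forall t, 0 < t <= T ->
       Xnorm A S (1 + mu) (y t) <= c * t `^ (eta + alpha - 2 - mu - eps)).

Definition integral_solution (R : realType) (X : normedModType R)
    (A : operator X) (m : nat) (sigma : 'I_m -> X -> X) (x : 'I_m -> R -> R)
    (T : R) (psi : X) (y : R -> X) : Prop :=
  forall t, 0 <= t <= T -> exists (J : X) (I : 'I_m -> X),
    [/\ bochner `]0, t] (fun u => A (y u)) J,
        forall i, young (x i) (fun u => sigma i (y u)) 0 t (I i)
      & y t = psi + J + \sum_(i < m) I i].

(** C^1([0, T] x X), with partial derivatives [Ft] and [Fx]; the latter is
    identified with a vector of X by means of the inner product. *)

Definition C1_on (R : realType) (X : normedModType R) (ip : X -> X -> R)
    (T : R) (F Ft : R -> X -> R) (Fx : R -> X -> X) : Prop :=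
  let D := [set p : R * X | 0 <= p.1 <= T] in
  [/\ forall t z, 0 <= t <= T ->
        (s - t)^-1 * (F s z - F t z)
          @[s --> within (`[0, T]%classic `\ t) (nbhs t)] --> Ft t z,
      forall t z, 0 <= t <= T ->
        differentiable (F t : X -> R^o) z /\
        forall h, 'd (F t : X -> R^o) z h = ip (Fx t z) h,
      {within D, continuous (fun p : R * X => F p.1 p.2)},
      {within D, continuous (fun p : R * X => Ft p.1 p.2)}
    & {within D, continuous (fun p : R * X => Fx p.1 p.2)}].

Definition chain_rule (R : realType) (X : normedModType R)
    (ip : X -> X -> R) (A : operator X) (m : nat)
    (sigma : 'I_m -> X -> X) (x : 'I_m -> R -> R) (T eta alpha : R)
    (y : R -> X) : Prop :=
  forall (F Ft : R -> X -> R) (Fx : R -> X -> X) (gamma : R),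
  C1_on ip T F Ft Fx ->
  0 < gamma < 1 -> 1 < eta + alpha * gamma ->
  (forall r : R, exists C, forall s t z,
     0 <= s <= T -> 0 <= t <= T -> `|z| <= r ->
     `|Fx s z - Fx t z| <= C * `|s - t| `^ alpha) ->
  (forall r : R, exists C, forall t z w,
     0 <= t <= T -> `|z| <= r -> `|w| <= r ->
     `|Fx t z - Fx t w| <= C * `|z - w| `^ gamma) ->
  forall s t, simplex2 0 T (s, t) ->
  exists I : 'I_m -> R,
    (forall i, young (V := R^o) (x i)
       (fun u => ip (Fx u (y u)) (sigma i (y u))) s t (I i)) /\
    F t (y t) - F s (y s) =
      (\int[@lebesgue_measure R]_(u in `[s, t]) Ft u (y u)) +
      (\int[@lebesgue_measure R]_(u in `[s, t]) ip (Fx u (y u)) (A (y u))) +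
      \sum_(i < m) I i.

Definition standing_assumptions (R : realType) (X : normedModType R)
    (ip : X -> X -> R) (A : operator X) (S : R -> {linear X -> X}) (m : nat)
    (sigma : 'I_m -> X -> X) (x : 'I_m -> R -> R) (T eta alpha : R) : Prop :=
  well_posed A S sigma x T alpha /\
  forall psi y, Xdom A S alpha psi -> solution A S sigma x T alpha psi y ->
    [/\ space_regular A S T eta alpha y,
        integral_solution A sigma x T psi y
      & chain_rule ip A sigma x T eta alpha y].

(** Invariance. *)

Definition invariant_set (R : realType) (X : normedModType R)
    (A : operator X) (S : R -> {linear X -> X}) (m : nat)
    (sigma : 'I_m -> X -> X) (x : 'I_m -> R -> R) (T alpha : R)
    (K : set X) : Prop :=
  forall psi y, Xdom A S alpha psi -> K psi ->
    solution A S sigma x T alpha psi y ->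
    forall t, 0 <= t <= T -> K (y t).

Definition boundary (U : topologicalType) (K : set U) : set U :=
  closure K `\` interior K.

Definition half_space (R : realType) (X : normedModType R)
    (ip : X -> X -> R) (phi : X) : set X := [set z | ip z phi <= 0].

(* Main.v *)
Require Import Defs.
From HB Require Import structures.
From mathcomp Require Import all_boot all_order all_algebra.
From mathcomp Require Import sesquilinear.
From mathcomp Require Import all_classical all_reals all_analysis.
From mathcomp Require Import measurable_realfun ring lra.

(** Let y(t0) lie on the boundary of the half-space and put
    N(t) = sum_i <phi, sigma_i(y(t0))> (x_i(t) - x_i(t0)).  Invariance gives
    <phi, y(t)> <= 0 = <phi, y(t0)>.  Between t0 and t the mild formula reads
    y(t) = S(t - t0) y(t0) + sum_i int_t0^t S(t - r) sigma_i(y(r)) dx_i(r), and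
    each Young integral equals the one-term Riemann sum at t0 up to
    O((t - t0)^(eta + alpha)), by dyadic refinement ([sewing]).  Hence
      N(t) <= <phi, y(t0) - S(t - t0) y(t0)> + O((t - t0)^(eta + alpha))
    ([noise_upper_bound]), with eta + alpha > 1.

    It remains to measure the increments <phi, u - S(h) u>.  If u is in X_zeta
    and zeta + eps <= 1, then the increments over [h / 2, h] are
    O(h^(zeta + eps)) by smoothing, and so is their sum over dyadic scales
    ([increment_power]); this is the first inequality of (i).  If
    zeta + eps > 1, then u is in X_(1 - eps) and the increment is
    h <(-A)^eps phi, (-A)^(1 - eps) u> + o(h) ([pairing_increment]), which
    yields both inequalities of (ii).

    For the second inequality of (i) the chain rule is applied to
    F(z) = max(lambda + <phi, z>, 0)^2 / (2 lambda).  On the half-space F is at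
    most lambda / 2, with equality at psi, so the sum of the drift integral and
    of the Young integrals is nonpositive.  The drift integral is minus the
    one in the statement ([drift_integral]).  The factor max(lambda + <phi, y>, 0) /
    lambda equals 1 at time 0, so the Young integrals differ from N(t) by
    O(t^(eta + alpha)) ([cutoff_noise_estimate]).

    Fractional powers enter through one identity ([npow_pairing]):
      <(-A)^eps phi, (-A)^(1 - eps) u> = <phi, - A u>  for u in D(A).
    As (-A)^eps is the closure of an operator given by Balakrishnan's integral,
    it suffices to treat the integrals themselves, tested against vectors
    ([weak_power]).  With a + b = 1 this amounts to
      int int t^(-a-1) s^(-b-1) <(I - S(t)) u, (I - S(s)) u> ds dt
        = C_a C_b <- A u, u>
    together with polarisation ([weak_power_mul]).  By symmetry of S the inner
    product is the second difference k(0) - k(t) - k(s) + k(t + s) of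
    k(t) = <S(t) u, u>, which is nonnegative, nonincreasing and convex.  For
    every such k, Tonelli's theorem and scaling show that the integral is a
    constant times - k'(0) ([iterated_integral_second_difference]), and the
    choice k(t) = exp(- t) identifies the constant with C_a C_b
    ([stieltjes_cstE]). *)

Set Implicit Arguments.
Unset Strict Implicit.
Unset Printing Implicit Defensive.

Import Order.TTheory GRing.Theory Num.Theory.
Import numFieldNormedType.Exports.

Local Open Scope classical_set_scope.
Local Open Scope ring_scope.

(** * Power weights and layer integrals *)

Section scaling.
Context {R : realType}.
Notation mu := (@lebesgue_measure R).
Local Open Scope ereal_scope.

(** The image of the Lebesgue measure under multiplication by c is identified
    through its values on half-open intervals. *)
Lemma ge0_integral_scale (c : R) (f : R -> \bar R) : (0 < c)%R ->
  measurable_fun [set: R] f -> (forall x, 0 <= f x) ->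
  \int[mu]_x f x = c%:E * \int[mu]_x f (c * x)%R.
Proof.
move=> c0 mf f0.
pose phi (x : measurableTypeR R) : measurableTypeR R := (c * x)%R.
have mphi : measurable_fun setT phi by exact: measurable_funM.
have [nu nuE] : exists nu : {measure set (measurableTypeR R) -> \bar R},
    forall E, nu E = mu (phi @^-1` E) by exists (pushforward mu phi).
have numu : forall E, measurable E -> mu E = mscale (NngNum (ltW c0)) nu E.
  apply: lebesgue_measure_unique => _ [[a b] /= _ <-].
  rewrite /mscale/= nuE.
  have -> : phi @^-1` [set` `]a, b]] = [set` `](a / c)%R, (b / c)%R]].
    apply/seteqP; split => x /=; rewrite !in_itv/=;
    by rewrite ltr_pdivrMr// ler_pdivlMr// [(x * c)%R]mulrC.
  rewrite !lebesgue_measure_itv/= !lte_fin ltr_pM2r ?invr_gt0//.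
  case: ifPn => ab; last by rewrite mule0.
  by rewrite -!EFinB -EFinM; congr EFin; field; rewrite gt_eqF.
transitivity (\int[mscale (NngNum (ltW c0)) nu]_x f x).
  by apply: eq_measure_integral => A mA _; exact: numu.
rewrite ge0_integral_mscale//=; congr (_ * _).
transitivity (\int[pushforward mu phi]_x f x).
  by apply: eq_measure_integral => A mA _; exact: nuE.
by rewrite ge0_integral_pushforward//= preimage_setT.
Unshelve. all: exact: mphi.
Qed.
End scaling.

Section power_weights.
Context {R : realType}.
Notation mu := (@lebesgue_measure R).

(** Powers are extended by zero to t <= 0, so that integrals over the half-line
    become integrals over R, where scaling and Tonelli's theorem apply. *)
Definition pospow (a t : R) : R := if 0 < t then t `^ a else 0.

Lemma pospowE (a t : R) : 0 < t -> pospow a t = t `^ a.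
Proof. by rewrite /pospow => ->. Qed.

Lemma pospow_le0 (a t : R) : t <= 0 -> pospow a t = 0.
Proof. by rewrite /pospow ltNge => ->. Qed.

Lemma pospow_ge0 (a t : R) : 0 <= pospow a t.
Proof. by rewrite /pospow; case: ifPn => // _; exact: powR_ge0. Qed.

Lemma measurable_pospow (a : R) : measurable_fun [set: R] (pospow a).
Proof.
by apply: measurable_fun_ifT => //; exact: measurable_fun_ltr.
Qed.

Lemma powR_cvgy0 (a : R) : 0 < a -> t `^ (- a) @[t --> +oo] --> (0 : R).
Proof.
move=> a0; apply/cvgrPdist_le => e e0; near=> t.
have t0 : 0 < t by near: t; exact: nbhs_pinfty_gt.
rewrite sub0r normrN ger0_norm ?powR_ge0//.
have et : (e^-1) `^ a^-1 <= t by near: t; exact: nbhs_pinfty_ge.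
have : ((e^-1) `^ a^-1) `^ a <= t `^ a.
  by apply: ge0_ler_powR; rewrite ?nnegrE ?powR_ge0 ?(ltW a0) ?(ltW t0).
rewrite -powRrM mulVf ?gt_eqF// powRr1 ?invr_ge0 ?(ltW e0)// => h.
by rewrite powRN -[leRHS]invrK lef_pV2// ?posrE ?invr_gt0// powR_gt0.
Unshelve. all: by end_near. Qed.

Lemma integral_powR_tail (a p : R) : 0 < a -> 0 < p ->
  (\int[mu]_(t in `[p, +oo[) (t `^ (- a - 1))%:E = (p `^ (- a) / a)%:E)%E.
Proof.
move=> a0 p0.
pose F (t : R) := - a^-1 * t `^ (- a).
have dF (t : R) : 0 < t -> is_derive t 1 F (t `^ (- a - 1)).
  move=> t0; have h := is_derive1_powR (- a) t0.
  have -> : F = (- a^-1) \*: (fun t : R => t `^ (- a)) by [].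
  apply: is_derive_eq; rewrite /GRing.scale/=.
  by field; rewrite gt_eqF.
have cF (t : R) : 0 < t -> {for t, continuous F}.
  move=> t0; apply: differentiable_continuous; apply/derivable1_diffP.
  by have := dF t t0; case.
rewrite (@ge0_continuous_FTC2y _ _ F p 0).
- by rewrite sub0e -EFinN /F mulNr opprK mulrC.
- by move=> t _; exact: powR_ge0.
- apply: continuous_in_subspaceT => t /set_mem/=; rewrite in_itv/= andbT => pt.
  apply: differentiable_continuous; apply/derivable1_diffP/derivable_powR.
  by rewrite in_itv/= andbT (lt_le_trans p0).
- rewrite (_ : 0 = - a^-1 * 0); last by rewrite mulr0.
  by apply: cvgM; [exact: cvg_cst | exact: powR_cvgy0].
- by move=> t pt; have := dF t (lt_trans p0 pt); case.
- by apply: cvg_at_right_filter; exact: cF.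
- move=> t; rewrite in_itv/= andbT => pt.
  by rewrite derive1E; have := dF t (lt_trans p0 pt); case.
Qed.

End power_weights.

Section layer_cake.
Context {R : realType}.
Notation mu := (@lebesgue_measure R).
Local Open Scope ereal_scope.

Lemma ge0_tonelliR (g : R -> R -> R) :
  measurable_fun [set: R * R] (fun z => g z.1 z.2) ->
  (forall x y, (0 <= g x y)%R) ->
  \int[mu]_x \int[mu]_y (g x y)%:E = \int[mu]_y \int[mu]_x (g x y)%:E.
Proof.
move=> mg g0.
apply: (@fubini_tonelli _ _ _ _ _ mu mu (fun z => (g z.1 z.2)%:E)).
  exact/measurable_EFinP.
by move=> z; rewrite lee_fin.
Qed.

Lemma measurable_inner_integral (g : R -> R -> R) :
  measurable_fun [set: R * R] (fun z => g z.1 z.2) ->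
  (forall x y, (0 <= g x y)%R) ->
  measurable_fun [set: R] (fun x => \int[mu]_y (g x y)%:E).
Proof.
move=> mg g0.
apply: (@measurable_fun_fubini_tonelli_F _ _ _ _ _ mu (fun z => (g z.1 z.2)%:E)).
  exact/measurable_EFinP.
by move=> z; rewrite lee_fin.
Qed.

(** With this cut-off int_0^t h becomes an integral over R of a function that is
    jointly measurable in (t, p). *)
Definition masked (h : R -> R) (t p : R) : R :=
  (if (0 < p) && (p <= t) then h p else 0)%R.

Lemma measurable_masked (h : R -> R) : measurable_fun [set: R] h ->
  measurable_fun [set: R * R] (fun z => masked h z.1 z.2).
Proof.
move=> mh; apply: measurable_fun_ifT => //.
- apply: measurable_and.
    by apply: measurable_fun_ltr => //; exact: measurable_snd.
  by apply: measurable_fun_ler; [exact: measurable_snd|exact: measurable_fst].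
- by apply: (measurableT_comp mh); exact: measurable_snd.
Qed.

Lemma measurable_masked1 (h : R -> R) (t : R) : measurable_fun [set: R] h ->
  measurable_fun [set: R] (masked h t).
Proof.
move=> mh; apply: measurable_fun_ifT => //.
by apply: measurable_and; [exact: measurable_fun_ltr | exact: measurable_fun_ler].
Qed.

(** Integrating first in t leaves int_p^oo t^(-a-1) dt = p^(-a) / a.  This is the
    integration by parts of t^(-a-1) against the primitive of h vanishing at 0. *)
Lemma integral_layer (a : R) (h : R -> R) : (0 < a)%R ->
  measurable_fun [set: R] h -> (forall p, (0 < p)%R -> (0 <= h p)%R) ->
  \int[mu]_t \int[mu]_p (pospow (- a - 1) t * masked h t p)%:E =
  \int[mu]_p (a^-1 * (pospow (- a) p * h p))%:E.
Proof.
move=> a0 mh h0.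
rewrite (ge0_tonelliR (g := fun t p => (pospow (- a - 1) t * masked h t p)%R)).
- apply: eq_integral => p _.
  have [p0|p0] := leP p 0%R.
    rewrite pospow_le0// mul0r mulr0; apply: integral0_eq => t _.
    by rewrite /masked ltNge p0/= mulr0.
  transitivity ((h p)%:E * \int[mu]_(t in `[p, +oo[) (t `^ (- a - 1))%:E).
    rewrite -ge0_integralZl_EFin//; last 3 first.
    - by move=> t _; rewrite lee_fin powR_ge0.
    - apply/measurable_EFinP; apply: measurable_funTS; exact: measurable_powR.
    - exact: h0.
    rewrite [RHS]integral_mkcond; apply: eq_integral => t _ /=.
    rewrite patchE /masked p0/= mem_setE in_itv/= andbT.
    case: ifPn => pt; last by rewrite mulr0.
    by rewrite pospowE ?(lt_le_trans p0)// EFinM muleC.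
  rewrite integral_powR_tail// pospowE// -EFinM; congr EFin; field.
  by rewrite gt_eqF.
- apply: measurable_funM; last exact: measurable_masked.
  by apply: (measurableT_comp (measurable_pospow _)); exact: measurable_fst.
- move=> t p; rewrite mulr_ge0 ?pospow_ge0//.
  by rewrite /masked; case: ifPn => // /andP[p0 _]; exact: h0.
Qed.

End layer_cake.

(** * Convex profiles and their second differences *)

Section convex_profile.
Context {R : realType}.
Notation mu := (@lebesgue_measure R).

(** The model is k t = <S(t) u, u> with derivatives <S(t) A u, u> and
    <S(t) A u, A u>.  Continuity is asked on all of R because such functions are
    extended to the left of 0 by composition with max(t, 0). *)
Definition convex_profile (k k1 k2 : R -> R) : Prop :=
  [/\ continuous k, continuous k1, continuous k2,
      forall t : R, 0 < t -> is_derive t (1 : R) k (k1 t) /\ is_derive t (1 : R) k1 (k2 t)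
    & forall t, 0 <= t -> [/\ 0 <= k t, k1 t <= 0 & 0 <= k2 t]].

Lemma continuous_measurableR (f : R -> R) : continuous f ->
  measurable_fun [set: R] f.
Proof.
move=> cf; apply: open_continuous_measurable_fun; first exact: openT.
by move=> x _; exact: cf.
Qed.

Lemma continuous_shiftl (q : R) (g : R -> R) :
  continuous g -> continuous (fun p => g (q + p)).
Proof.
by move=> cg s; apply: (continuous_comp _ (cg _)); apply: cvgD; [exact: cvg_cst | exact: cvg_id].
Qed.

Lemma is_derive_shiftl (q s d : R) (F : R -> R) :
  is_derive (q + s) (1 : R) F d -> is_derive s (1 : R) (fun p => F (q + p)) d.
Proof.
move=> h; have h2 : is_derive s (1 : R) (fun p : R => q + p) 1.
  rewrite (_ : (fun p => q + p) = (cst q : R -> R) + (id : R -> R))//.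
  by apply: is_derive_eq; rewrite add0r.
have := is_derive1_comp h h2.
by rewrite /comp /GRing.scale/= ?mulr1 ?mul1r.
Qed.

Lemma integral_masked_derive (f F : R -> R) (q t : R) : 0 <= q -> 0 < t ->
  continuous f -> continuous F ->
  (forall s : R, 0 < s -> is_derive s (1 : R) F (f s)) ->
  (\int[mu]_p (masked (fun p => f (q + p)%R) t p)%:E = (F (q + t) - F q)%:E)%E.
Proof.
move=> q0 t0 cf cF dF.
transitivity (\int[mu]_(p in `[0%R, t]) (f (q + p)%R)%:E)%E.
  rewrite -integral_itv_obnd_cbnd; last first.
    apply/measurable_EFinP; apply: measurable_funTS; apply: continuous_measurableR; exact: continuous_shiftl.
  rewrite [RHS]integral_mkcond; apply: eq_integral => p _ /=.
  by rewrite patchE /masked mem_setE in_itv/=; case: ifP.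
have dFq (s : R) : 0 < s -> is_derive s (1 : R) (fun p => F (q + p)) (f (q + s)).
  by move=> s0; apply: is_derive_shiftl; apply: dF; rewrite ltr_wpDl.
rewrite (@continuous_FTC2 _ _ (fun p => F (q + p)) 0 t)//.
- by rewrite addr0 EFinB.
- by apply: continuous_subspaceT; exact: continuous_shiftl.
- split.
  + by move=> s; rewrite in_itv/= => /andP[s0 _]; case: (dFq _ s0).
  + by apply: cvg_at_right_filter; exact: continuous_shiftl.
  + by apply: cvg_at_left_filter; exact: continuous_shiftl.
- move=> s; rewrite in_itv/= => /andP[s0 _].
  by rewrite derive1E; case: (dFq _ s0).
Qed.

Section calculus.
Variables k k1 k2 : R -> R.
Hypothesis kP : convex_profile k k1 k2.

Let ck : continuous k. Proof. by case: kP. Qed.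
Let ck1 : continuous k1. Proof. by case: kP. Qed.
Let ck2 : continuous k2. Proof. by case: kP. Qed.
Let dk (t : R) : 0 < t -> is_derive t (1 : R) k (k1 t).
Proof. by case: kP => _ _ _ + _ => /[apply] -[]. Qed.
Let dk1 (t : R) : 0 < t -> is_derive t (1 : R) k1 (k2 t).
Proof. by case: kP => _ _ _ + _ => /[apply] -[]. Qed.
Let k_ge0 t : 0 <= t -> 0 <= k t.
Proof. by case: kP => _ _ _ _ /[apply] -[]. Qed.
Let k1_le0 t : 0 <= t -> k1 t <= 0.
Proof. by case: kP => _ _ _ _ /[apply] -[]. Qed.
Let k2_ge0 t : 0 <= t -> 0 <= k2 t.
Proof. by case: kP => _ _ _ _ /[apply] -[]. Qed.

Lemma profile_slope_nondecreasing s t : 0 <= s -> 0 <= t -> k1 s <= k1 (t + s).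
Proof.
move=> s0; rewrite le_eqVlt => /predU1P[<-|t0]; first by rewrite add0r.
rewrite -subr_ge0 [t + s]addrC -lee_fin -(integral_masked_derive s0 t0 ck2 ck1 dk1).
apply: integral_ge0 => p _; rewrite lee_fin /masked; case: ifPn => // /andP[p0 _].
by rewrite k2_ge0// addr_ge0// ltW.
Qed.

Lemma profile_decay_le s : 0 <= s -> k 0 - k s <= - k1 0 * s.
Proof.
rewrite le_eqVlt => /predU1P[<-|s0]; first by rewrite subrr mulr0.
have [c] := @MVT _ k k1 0 s s0 (fun t h => dk (andP h).1) (continuous_subspaceT ck).
rewrite in_itv/= => /andP[c0 _] h; rewrite -opprB h subr0 mulNr lerN2 ler_pM2r//.
by have := profile_slope_nondecreasing (lexx 0) (ltW c0); rewrite addr0.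
Qed.

(** Convexity gives t k1(t) >= k(t) - k(0) >= - k(0), so the slope lies between
    - k(0) / t and 0. *)
Lemma profile_slope_cvg0 : k1 t @[t --> +oo] --> (0 : R).
Proof.
apply: (@squeeze_cvgr _ _ _ _ (fun t : R => - k 0 * t `^ (- 1)) (cst 0)); last exact: cvg_cst.
  near=> t; have t0 : 0 < t by near: t; exact: nbhs_pinfty_gt.
  rewrite k1_le0 ?(ltW t0)// andbT powR_inv1 ?(ltW t0)// ler_pdivrMr//.
  have [c] := @MVT _ k k1 0 t t0 (fun t h => dk (andP h).1) (continuous_subspaceT ck).
  rewrite in_itv/= => /andP[c0 ct] h.
  have : k1 c * t <= k1 t * t.
    have tc : 0 <= t - c by rewrite subr_ge0 ltW.
    by have := profile_slope_nondecreasing (ltW c0) tc; rewrite subrK ler_pM2r.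
  apply: le_trans; move: h; rewrite subr0 => <-.
  by have := k_ge0 (ltW t0); lra.
rewrite -[X in _ --> X](mulr0 (- k 0)); apply: cvgM; first exact: cvg_cst.
exact: powR_cvgy0.
Unshelve. all: by end_near. Qed.

Lemma integral_profile_curvature :
  (\int[mu]_r (if 0 < r then k2 r else 0)%:E = (- k1 0)%:E)%E.
Proof.
transitivity (\int[mu]_(r in `[0%R, +oo[) (k2 r)%:E)%E.
  rewrite -integral_itv_obnd_cbnd; last first.
    apply/measurable_EFinP; apply: measurable_funTS; exact: continuous_measurableR.
  rewrite [RHS]integral_mkcond; apply: eq_integral => r _ /=.
  by rewrite patchE mem_setE in_itv/= andbT; case: ifP.
rewrite (@ge0_continuous_FTC2y _ k2 k1 0 0).
- by rewrite sub0e EFinN.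
- exact: k2_ge0.
- exact: continuous_subspaceT.
- exact: profile_slope_cvg0.
- by move=> t t0; case: (dk1 t0).
- by apply: cvg_at_right_filter; exact: ck1.
- by move=> t; rewrite in_itv/= andbT => t0; rewrite derive1E; case: (dk1 t0).
Qed.

(** For k(t) = exp(- l t) this is (1 - exp(- l t)) (1 - exp(- l s)), a product of
    two integrands of Balakrishnan's formula. *)
Definition second_difference (k : R -> R) (t s : R) : R :=
  k 0 - k t - k s + k (t + s).

Let slope_increment_ge0 t q : 0 <= t -> 0 <= q -> 0 <= k1 (t + q) - k1 q.
Proof. by move=> t0 q0; rewrite subr_ge0 profile_slope_nondecreasing. Qed.

Let mshift (f : R -> R) (t : R) : continuous f -> measurable_fun [set: R] (fun p => f (t + p)).
Proof.
move=> cf; apply: (measurableT_comp (continuous_measurableR cf)).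
exact: measurable_funD.
Qed.

Let mshift2 (f : R -> R) : continuous f ->
  measurable_fun [set: R * R] (fun z => f (z.1 + z.2)).
Proof.
move=> cf; apply: (measurableT_comp (continuous_measurableR cf)).
by apply: measurable_funD; [exact: measurable_fst|exact: measurable_snd].
Qed.

(** Integration by parts in s: the second difference is the primitive of
    k1(t + s) - k1(s) that vanishes at s = 0. *)
Lemma integral_second_difference (b t : R) : 0 < b -> 0 < t ->
  (\int[mu]_s (pospow (- b - 1) s * second_difference k t s)%:E =
   \int[mu]_q (b^-1 * (pospow (- b) q * (k1 (t + q) - k1 q)))%:E)%E.
Proof.
move=> b0 t0.
have mg : measurable_fun [set: R] (fun q => k1 (t + q) - k1 q).
  by apply: measurable_funB; [exact: mshift | exact: continuous_measurableR].
have cg : continuous (fun q => k1 (t + q) - k1 q).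
  by move=> s; apply: cvgB; [exact: continuous_shiftl | exact: ck1].
have ckt : continuous (fun q => k (t + q) - k q).
  by move=> s; apply: cvgB; [exact: continuous_shiftl | exact: ck].
rewrite -(integral_layer b0 mg); last first.
  by move=> p p0; rewrite slope_increment_ge0// ltW.
apply: eq_integral => s _; have [s0|s0] := leP s 0.
  by rewrite pospow_le0// mul0r; apply/esym/integral0_eq => q _; rewrite mul0r.
under [RHS]eq_integral do rewrite EFinM.
rewrite ge0_integralZl_EFin ?pospow_ge0//; last 2 first.
- move=> q _; rewrite lee_fin /masked; case: ifPn => // /andP[q0 _].
  by rewrite slope_increment_ge0// ltW.
- apply/measurable_EFinP.
  exact: measurable_masked1.
have dG (q : R) : 0 < q ->
    is_derive q (1 : R) (fun q => k (t + q) - k q) (k1 (t + q) - k1 q).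
  move=> q0.
  have h : is_derive q (1 : R) (fun p => k (t + p)) (k1 (t + q)).
    by apply: is_derive_shiftl; apply: dk; rewrite addr_gt0.
  have h4 := dk q0.
  rewrite (_ : (fun q => _) = (fun p => k (t + p)) - k)//.
  exact: is_derive_eq.
have := integral_masked_derive (lexx 0) s0 cg ckt dG.
rewrite (_ : (fun p => _) = (fun q => k1 (t + q) - k1 q)); last first.
  by apply/funext => p; rewrite add0r.
move=> ->; rewrite -EFinM; congr (_ * _)%:E.
by rewrite /second_difference add0r addr0; ring.
Qed.

(** This is (a b)^-1 int_0^oo p^(-a) / (1 + p) dp, kept unevaluated: it is
    identified by the test case of an exponential in [stieltjes_cstE]. *)
Definition stieltjes_cst (a b : R) : \bar R :=
  (\int[mu]_p (a^-1 * b^-1 * (pospow (- a) p * (1 + p) `^ (- 1)))%:E)%E.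

(** Integrations by parts in s and in t reduce the double integral to
    (a b)^-1 int int q^(-b) p^(-a) k2(q + p) dp dq.  As a + b = 1, the
    substitution of q p for p cancels the powers of q, and then
    int k2((1 + p) q) dq = - k1(0) / (1 + p).  So k enters only through k1(0). *)
Lemma iterated_integral_second_difference (a b : R) :
  0 < a -> 0 < b -> a + b = 1 ->
  (\int[mu]_t ((pospow (- a - 1) t)%:E *
     \int[mu]_s (pospow (- b - 1) s * second_difference k t s)%:E) =
   stieltjes_cst a b * (- k1 0)%:E)%E.
Proof.
move=> a0 b0 ab.
have mpow1 c : measurable_fun [set: R * R] (fun z => pospow c z.1).
  by apply: (measurableT_comp (measurable_pospow _)); exact: measurable_fst.
have mpow2 c : measurable_fun [set: R * R] (fun z => pospow c z.2).
  by apply: (measurableT_comp (measurable_pospow _)); exact: measurable_snd.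
(* [g1], [g2] and [g3] are the integrands after integration by parts in s, after
   integration by parts in t, and after the substitution of q p for p. *)
pose g1 (t q : R) := b^-1 * (pospow (- a - 1) t * pospow (- b) q * (k1 (t + q) - k1 q)).
have g1_ge0 t q : 0 <= g1 t q.
  rewrite /g1; apply: mulr_ge0; first by rewrite invr_ge0 ltW.
  have [t0|t0] := leP t 0; first by rewrite pospow_le0// !mul0r.
  have [q0|q0] := leP q 0; first by rewrite [pospow _ q]pospow_le0// mulr0 mul0r.
  by rewrite !mulr_ge0 ?pospow_ge0// slope_increment_ge0// ltW.
transitivity (\int[mu]_t \int[mu]_q (g1 t q)%:E)%E.
  apply: eq_integral => t _; have [t0|t0] := leP t 0.
    rewrite pospow_le0// mul0e; apply/esym/integral0_eq => q _.
    by rewrite /g1 pospow_le0// !mul0r mulr0.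
  rewrite integral_second_difference// -ge0_integralZl_EFin ?pospow_ge0//.
  - by apply: eq_integral => q _; rewrite -EFinM /g1; congr EFin; ring.
  - move=> q _; rewrite lee_fin; have [q0|q0] := leP q 0.
      by rewrite pospow_le0// mul0r mulr0.
    by rewrite !mulr_ge0 ?pospow_ge0 ?slope_increment_ge0// ?invr_ge0 ltW.
  - apply/measurable_EFinP; apply: measurable_funM => //; apply: measurable_funM.
      exact: measurable_pospow.
    by apply: measurable_funB; [exact: mshift | exact: continuous_measurableR].
rewrite ge0_tonelliR//; last first.
  rewrite /g1; apply: measurable_funM => //; apply: measurable_funM.
    exact: measurable_funM.
  apply: measurable_funB; first exact: mshift2.
  by apply: (measurableT_comp (continuous_measurableR ck1)); exact: measurable_snd.
pose g2 (q p : R) := a^-1 * b^-1 * (pospow (- b) q * pospow (- a) p * (if 0 < p then k2 (q + p) else 0)).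
have g2_ge0 q p : 0 <= g2 q p.
  rewrite /g2; apply: mulr_ge0; first by rewrite mulr_ge0// invr_ge0 ltW.
  case: ifPn => p0; last by rewrite mulr0.
  have [q0|q0] := leP q 0; first by rewrite pospow_le0// !mul0r.
  by rewrite !mulr_ge0 ?pospow_ge0// k2_ge0// addr_ge0// ltW.
transitivity (\int[mu]_q \int[mu]_p (g2 q p)%:E)%E.
  apply: eq_integral => q _; have [q0|q0] := leP q 0.
    rewrite !integral0_eq// => p _; first by rewrite /g2 pospow_le0// !mul0r mulr0.
    by rewrite /g1 [pospow _ q]pospow_le0// mulr0 mul0r mulr0.
  transitivity ((b^-1 * pospow (- b) q)%:E *
      \int[mu]_t \int[mu]_p (pospow (- a - 1) t * masked (fun p => k2 (q + p)) t p)%:E)%E.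
    rewrite -ge0_integralZl_EFin//; last 3 first.
    - move=> t _; apply: integral_ge0 => p _; rewrite lee_fin mulr_ge0 ?pospow_ge0//.
      by rewrite /masked; case: ifPn => // /andP[p0 _]; rewrite k2_ge0// addr_ge0// ltW.
    - apply: (measurable_inner_integral (g := fun t p => pospow (- a - 1) t * masked (fun p => k2 (q + p)) t p)).
        apply: measurable_funM => //.
        by apply: measurable_masked; exact: mshift.
      move=> t p; rewrite mulr_ge0 ?pospow_ge0//.
      by rewrite /masked; case: ifPn => // /andP[p0 _]; rewrite k2_ge0// addr_ge0// ltW.
    - by rewrite mulr_ge0 ?pospow_ge0// invr_ge0 ltW.
    apply: eq_integral => t _; have [t0|t0] := leP t 0.
      rewrite /g1 pospow_le0// !mul0r mulr0 integral0_eq ?mule0// => p _.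
      by rewrite mul0r.
    under eq_integral do rewrite EFinM.
    rewrite ge0_integralZl_EFin ?pospow_ge0//; last 2 first.
    - move=> p _; rewrite lee_fin /masked; case: ifPn => // /andP[p0 _].
      by rewrite k2_ge0// addr_ge0// ltW.
    - apply/measurable_EFinP.
      by apply: measurable_masked1; exact: mshift.
    rewrite (integral_masked_derive (ltW q0) t0 ck2 ck1 dk1) -!EFinM /g1; congr EFin.
    by rewrite [q + t]addrC; ring.
  rewrite (integral_layer a0 (mshift q ck2)); last first.
    by move=> p p0; rewrite k2_ge0// addr_ge0// ltW.
  rewrite -ge0_integralZl_EFin//; last 3 first.
  - move=> p _; rewrite lee_fin; have [p0|p0] := leP p 0.
      by rewrite pospow_le0// mul0r mulr0.
    by rewrite !mulr_ge0 ?pospow_ge0 ?k2_ge0// ?invr_ge0 ?addr_ge0// ltW.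
  - apply/measurable_EFinP; apply: measurable_funM => //; apply: measurable_funM.
      exact: measurable_pospow.
    exact: mshift.
  - by rewrite mulr_ge0 ?pospow_ge0// invr_ge0 ltW.
  apply: eq_integral => p _; rewrite -EFinM /g2; congr EFin.
  case: ifPn => p0; first by ring.
  by rewrite [pospow _ p]pospow_le0 ?leNgt//; ring.
pose g3 (q p : R) := if (0 < q) && (0 < p) then a^-1 * b^-1 * (pospow (- a) p * k2 ((1 + p) * q)) else 0.
have g3_ge0 q p : 0 <= g3 q p.
  rewrite /g3; case: ifPn => // /andP[q0 p0].
  by rewrite !mulr_ge0 ?pospow_ge0 ?k2_ge0// ?mulr_ge0 ?addr_ge0// ?invr_ge0 ltW.
have mg3 : measurable_fun [set: R * R] (fun z => g3 z.1 z.2).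
  apply: measurable_fun_ifT => //.
    by apply: measurable_and; apply: measurable_fun_ltr.
  apply: measurable_funM => //; apply: measurable_funM => //.
  apply: (measurableT_comp (continuous_measurableR ck2)); apply: measurable_funM.
    by apply: measurable_funD => //; exact: measurable_snd.
  exact: measurable_fst.
transitivity (\int[mu]_q \int[mu]_p (g3 q p)%:E)%E.
  apply: eq_integral => q _; have [q0|q0] := leP q 0.
    rewrite !integral0_eq// => p _; first by rewrite /g3 ltNge q0.
    by rewrite /g2 pospow_le0// !mul0r mulr0.
  rewrite (ge0_integral_scale q0); last 2 first.
  - apply/measurable_EFinP; rewrite /g2; apply: measurable_funM => //.
    apply: measurable_funM; first by apply: measurable_funM => //; exact: measurable_pospow.
    by apply: measurable_fun_ifT => //; [exact: measurable_fun_ltr | exact: mshift].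
  - by move=> p; rewrite lee_fin.
  rewrite -ge0_integralZl_EFin ?(ltW q0)//; last 2 first.
  - by move=> p _; rewrite lee_fin.
  - apply/measurable_EFinP; rewrite /g2; apply: measurable_funM => //.
    have mq : measurable_fun [set: R] (fun x => q * x) by exact: measurable_funM.
    apply: measurable_funM.
      by apply: measurable_funM => //; apply: (measurableT_comp (measurable_pospow _)).
    apply: measurable_fun_ifT => //; first exact: measurable_fun_ltr.
    by apply: (measurableT_comp (mshift q ck2)).
  apply: eq_integral => p _; rewrite -EFinM /g2 /g3 q0/= pmulr_rgt0//; congr EFin.
  case: ifPn => p0; last by rewrite !mulr0.
  rewrite !pospowE ?mulr_gt0// powRM ?(ltW q0) ?(ltW p0)//.
  have -> : q + q * p = (1 + p) * q by ring.
  have qq : q * (q `^ (- b) * q `^ (- a)) = 1.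
    rewrite -powRD ?(gt_eqF q0) ?implybT//.
    have -> : - b - a = - 1 by rewrite -opprD addrC ab.
    by rewrite powR_inv1 ?(ltW q0)// mulfV// gt_eqF.
  rewrite -[RHS]mul1r -qq; ring.
rewrite ge0_tonelliR//.
rewrite /stieltjes_cst -ge0_integralZr//; last 3 first.
- apply/measurable_EFinP; apply: measurable_funM => //; apply: measurable_funM.
    exact: measurable_pospow.
  apply: (measurableT_comp (measurable_powR (- 1))).
  exact: measurable_funD.
- move=> p _; rewrite lee_fin; have [p0|p0] := leP p 0.
    by rewrite pospow_le0// mul0r mulr0.
  by rewrite !mulr_ge0 ?pospow_ge0 ?powR_ge0// ?invr_ge0 ltW.
- by rewrite lee_fin oppr_ge0 k1_le0.
apply: eq_integral => p _; have [p0|p0] := leP p 0.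
  rewrite pospow_le0// mul0r mulr0 mul0e integral0_eq// => q _.
  by rewrite /g3 [0 < p]ltNge p0 andbF.
have mk2 : measurable_fun [set: R] (fun r : R => if 0 < r then k2 r else 0).
  apply: measurable_fun_ifT => //; last exact: continuous_measurableR.
  exact: measurable_fun_ltr.
rewrite -(integral_profile_curvature).
have p1 : 0 < 1 + p by rewrite addr_gt0.
rewrite [X in (_ = _ * X)%E](ge0_integral_scale p1); last 2 first.
- exact/measurable_EFinP.
- by move=> r; rewrite lee_fin; case: ifPn => // r0; rewrite k2_ge0// ltW.
rewrite muleA -EFinM -ge0_integralZl_EFin//; last 3 first.
- by move=> r _; rewrite lee_fin; case: ifPn => // r0; rewrite k2_ge0// ltW.
- apply/measurable_EFinP; apply: (measurableT_comp mk2).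
  exact: measurable_funM.
- by rewrite !mulr_ge0 ?pospow_ge0 ?powR_ge0// ?invr_ge0 ltW.
apply: eq_integral => q _; rewrite -EFinM /g3 p0 andbT pmulr_rgt0//; congr EFin.
case: ifPn => q0; last by rewrite mulr0.
rewrite powR_inv1 ?(ltW p1)//.
by field; rewrite !gt_eqF.
Qed.

End calculus.
End convex_profile.

(** * The Balakrishnan constant *)

Section balakrishnan_constant.
Context {R : realType}.
Notation mu := (@lebesgue_measure R).

(** The intervals [1 / (n + 1), 1] avoid the singularity, and monotone convergence
    passes to their union. *)
Lemma integral_powR_near0 (a : R) : 0 < a < 1 ->
  (\int[mu]_(t in `]0%R, 1%R]) (t `^ (- a))%:E <= ((1 - a)^-1)%:E)%E.
Proof.
move=> /andP[a0 a1].
pose D (n : nat) : set R := `[n.+1%:R^-1, 1%R]%classic.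
have D0 n t : D n t -> 0 < t.
  by rewrite /D/= in_itv/= => /andP[+ _]; apply: lt_le_trans; rewrite invr_gt0 ltr0n.
have Dcup : `]0%R, 1%R]%classic = \bigcup_n D n.
  apply/seteqP; split => t /=.
    rewrite in_itv/= => /andP[t0 t1]; exists (Num.truncn t^-1) => //=.
    rewrite /D/= in_itv/= t1 andbT -[leRHS]invrK lef_pV2 ?posrE ?invr_gt0 ?ltr0n//.
    by rewrite ltW// truncnS_gt.
  move=> [n _ Dt]; rewrite in_itv/= (D0 n)//.
  by move: Dt; rewrite /D/= in_itv/= => /andP[].
pose F (t : R) := (1 - a)^-1 * t `^ (1 - a).
have dF (t : R) : 0 < t -> is_derive t 1 F (t `^ (- a)).
  move=> t0; have h := is_derive1_powR (1 - a) t0.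
  have -> : F = (1 - a)^-1 \*: (fun t : R => t `^ (1 - a)) by [].
  apply: is_derive_eq; rewrite /GRing.scale/= mulrA mulVf ?mul1r ?gt_eqF ?subr_gt0//.
  by congr (_ `^ _); ring.
have cF (t : R) : 0 < t -> {for t, continuous F}.
  move=> t0; apply: differentiable_continuous; apply/derivable1_diffP.
  by have := dF t t0; case.
have cf (t : R) : 0 < t -> {for t, continuous (fun t : R => t `^ (- a))}.
  move=> t0; apply: differentiable_continuous; apply/derivable1_diffP/derivable_powR.
  by rewrite in_itv/= andbT.
have FD n : (\int[mu]_(t in D n) (t `^ (- a))%:E <= ((1 - a)^-1)%:E)%E.
  have [->|n0] := eqVneq n 0%N.
    rewrite /D invr1 set_itv1 integral_set1 ?lee_fin ?invr_ge0 ?subr_ge0 ?ltW//.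
  have n1 : n.+1%:R^-1 < 1 :> R by rewrite invf_lt1 ?ltr0n// ltr1n ltnS lt0n.
  rewrite /D (@continuous_FTC2 _ _ F)//.
  - rewrite -EFinB lee_fin /F powR1 mulr1 gerBl mulr_ge0 ?powR_ge0//.
    by rewrite invr_ge0 subr_ge0 ltW.
  - by apply: continuous_in_subspaceT => t /set_mem/D0; exact: cf.
  - split.
    + move=> t; rewrite in_itv/= => /andP[nt _].
      by have t0 : 0 < t by [rewrite (lt_trans _ nt)// invr_gt0 ltr0n]; case: (dF t t0).
    + by apply: cvg_at_right_filter; apply: cF; rewrite invr_gt0 ltr0n.
    + by apply: cvg_at_left_filter; apply: cF.
  - move=> t; rewrite in_itv/= => /andP[nt _].
    have t0 : 0 < t by rewrite (lt_trans _ nt)// invr_gt0 ltr0n.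
    by rewrite derive1E; case: (dF t t0).
have nD : nondecreasing_seq D.
  move=> i j ij; rewrite subsetEset => t; rewrite /D/= !in_itv/= => /andP[ti ->].
  by rewrite andbT (le_trans _ ti)// lef_pV2 ?posrE ?ltr0n// ler_nat ltnS.
have mD i : measurable (D i) by exact: measurable_itv.
have mf i : measurable_fun (D i) (fun t : R => (t `^ (- a))%:E).
  by apply/measurable_EFinP; apply: measurable_funTS; exact: measurable_powR.
have f0 i (t : R) : D i t -> (0 <= (t `^ (- a))%:E)%E by rewrite lee_fin powR_ge0.
have := ge0_nondecreasing_set_cvg_integral (mu := mu) nD mD mf f0.
rewrite -Dcup => /cvg_lim <-//.
apply: lime_le; last exact: nearW.
apply: ereal_nondecreasing_is_cvgn.
exact: ge0_nondecreasing_set_nondecreasing_integral.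
Qed.

Lemma balakrishnan_integrand_ge0 (a t : R) : 0 <= pospow a t * (1 - expR (- t)).
Proof.
have [t0|t0] := leP t 0; first by rewrite pospow_le0// mul0r.
by rewrite mulr_ge0 ?pospow_ge0// subr_ge0 expR_le1 oppr_le0 ltW.
Qed.

Lemma measurable_balakrishnan_integrand (a : R) :
  measurable_fun [set: R] (fun t => pospow a t * (1 - expR (- t))).
Proof.
apply: measurable_funM; first exact: measurable_pospow.
apply: measurable_funB => //.
by apply: measurableT_comp => //; exact: measurable_expR.
Qed.

(** The integrand is at most t^(-a) on ]0, 1] and at most t^(-a-1) beyond 1. *)
Lemma integral_balakrishnan_lty (a : R) : 0 < a < 1 ->
  (\int[mu]_t (pospow (- a - 1) t * (1 - expR (- t)))%:E < +oo)%E.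
Proof.
move=> /[dup] /andP[a0 a1] a01.
have mitv (i : interval R) b : measurable_fun [set` i] (fun t : R => (t `^ b)%:E).
  by apply/measurable_EFinP; apply: measurable_funTS; exact: measurable_powR.
pose f1 := (fun t : R => (t `^ (- a))%:E) \_ `]0%R, 1%R].
pose f2 := (fun t : R => (t `^ (- a - 1))%:E) \_ `[1%R, +oo[.
apply: (@le_lt_trans _ _ (\int[mu]_t (f1 t + f2 t))%E).
  apply: ge0_le_integral => //.
  - by move=> t _; rewrite lee_fin balakrishnan_integrand_ge0.
  - by apply/measurable_EFinP; exact: measurable_balakrishnan_integrand.
  - by apply: emeasurable_funD; apply/(measurable_restrictT _ _).1 => //; exact: mitv.
  - move=> t _; rewrite /f1 /f2 !patchE !mem_setE !in_itv/= andbT.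
    have [t0|t0] := leP t 0.
      rewrite pospow_le0// mul0r; apply: adde_ge0 => //.
      by case: ifPn => // _; rewrite lee_fin powR_ge0.
    rewrite pospowE//; have [t1|t1] := leP t 1.
      apply: (@le_trans _ _ (t `^ (- a))%:E); last first.
        by rewrite leeDl//; case: ifPn => // _; rewrite lee_fin powR_ge0.
      rewrite lee_fin (_ : t `^ (- a) = t `^ (- a - 1) * t); last first.
        by rewrite -[X in _ * X]powRr1 ?(ltW t0)// -powRD ?subrK// (gt_eqF t0) implybT.
      rewrite ler_wpM2l ?powR_ge0//.
      by have := expR_ge1Dx (- t); lra.
    rewrite (ltW t1) add0e lee_fin ler_piMr ?powR_ge0// gerBl expR_ge0.
rewrite ge0_integralD//=; last 4 first.
- by move=> t _; rewrite /f1 patchE; case: ifPn => // _; rewrite lee_fin powR_ge0.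
- by apply/(measurable_restrictT _ _).1 => //; exact: mitv.
- by move=> t _; rewrite /f2 patchE; case: ifPn => // _; rewrite lee_fin powR_ge0.
- by apply/(measurable_restrictT _ _).1 => //; exact: mitv.
rewrite -!integral_mkcond integral_powR_tail// lte_add_pinfty ?ltry//.
by apply: le_lt_trans (integral_powR_near0 a01) _; rewrite ltry.
Qed.

Lemma integral_balakrishnan (a : R) : 0 < a < 1 ->
  (\int[mu]_t (pospow (- a - 1) t * (1 - expR (- t)))%:E = (balakrishnan_cst a)%:E)%E.
Proof.
move=> a01.
have E : (\int[mu]_t (pospow (- a - 1) t * (1 - expR (- t)))%:E =
  \int[mu]_(t in `]0%R, +oo[) (t `^ (- a - 1) * (1 - expR (- t)))%:E)%E.
  rewrite [RHS]integral_mkcond; apply: eq_integral => t _ /=.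
  rewrite patchE mem_setE in_itv/= andbT /pospow.
  by case: ifPn => // _; rewrite mul0r.
rewrite /balakrishnan_cst /Rintegral -E fineK// ge0_fin_numE.
  exact: integral_balakrishnan_lty.
by apply: integral_ge0 => t _; rewrite lee_fin balakrishnan_integrand_ge0.
Qed.

Lemma balakrishnan_cst_gt0 (a : R) : 0 < a < 1 -> 0 < balakrishnan_cst a.
Proof.
move=> /[dup] a01 /andP[a0 a1]; rewrite -lte_fin -integral_balakrishnan//.
pose c : R := 2 `^ (- a - 1) * (1 - expR (- 1)).
have c0 : 0 < c by rewrite mulr_gt0 ?powR_gt0// subr_gt0 expR_lt1 oppr_lt0.
apply: (@lt_le_trans _ _ (\int[mu]_(t in `[1%R, 2%R]) c%:E)%E).
  rewrite integral_cst//= lebesgue_measure_itv/= lte_fin ltr1n/= -EFinB -EFinM lte_fin.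
  by rewrite mulr_gt0//; lra.
rewrite integral_mkcond; apply: ge0_le_integral => //.
- by move=> t _; rewrite patchE; case: ifPn => // _; rewrite lee_fin ltW.
- by apply/(measurable_restrictT _ _).1.
- by apply/measurable_EFinP; exact: measurable_balakrishnan_integrand.
- move=> t _; rewrite patchE mem_setE in_itv/=; case: ifPn; last first.
    by rewrite lee_fin balakrishnan_integrand_ge0.
  move=> /andP[t1 t2]; have t0 : 0 < t by rewrite (lt_le_trans _ t1).
  rewrite lee_fin pospowE// /c ler_pM ?powR_ge0 ?subr_ge0 ?expR_le1 ?oppr_le0//.
    rewrite -opprD !powRN lef_pV2 ?posrE ?powR_gt0//.
    by apply: ge0_ler_powR; rewrite ?nnegrE ?addr_ge0 ?(ltW t0) ?(ltW a0).
  by rewrite lerB// ler_expR lerN2.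
Qed.

Lemma continuous_clamp : continuous (fun t : R => Num.max t 0).
Proof.
by move=> t; apply: (@continuous_max R R id (cst 0)); [exact: cvg_id | exact: cvg_cst].
Qed.

Lemma exponential_profile :
  let k (t : R) := expR (- Num.max t 0) in convex_profile k (fun t => - k t) k.
Proof.
move=> k.
have ck : continuous k.
  move=> t; apply: (@continuous_comp R R R (fun t => - Num.max t 0) expR t).
    by apply: cvgN; exact: continuous_clamp.
  exact: continuous_expR.
have dk (t : R) : 0 < t -> is_derive t (1 : R) k (- k t).
  move=> t0.
  have h : is_derive t (1 : R) (fun t => expR (- t)) (- k t).
    have h2 : is_derive t (1 : R) (fun p : R => - p) (-1).
      by apply: is_derive_eq.
    have := is_derive1_comp (is_derive_expR (- t)) h2.
    by rewrite /comp /GRing.scale/= mulrN1 /k max_l ?(ltW t0).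
  apply: near_eq_is_derive h.
  near=> s; rewrite /k max_l//.
  by apply: ltW; near: s; exact: lt_nbhsr.
split=> //.
- by move=> t; apply: cvgN; exact: ck.
- move=> t t0; split; first exact: dk.
  by have h := dk t t0; rewrite -[X in is_derive _ _ _ X]opprK; exact: is_deriveN.
- by move=> t t0; rewrite oppr_le0 expR_ge0.
Unshelve. all: by end_near. Qed.

(** For the profile exp(- t), with slope - 1 at 0, the iterated integral factors
    into the two Balakrishnan integrals. *)
Lemma stieltjes_cstE (a b : R) : 0 < a -> 0 < b -> a + b = 1 ->
  stieltjes_cst a b = (balakrishnan_cst a * balakrishnan_cst b)%:E.
Proof.
move=> a0 b0 ab.
have a01 : 0 < a < 1 by lra.
have b01 : 0 < b < 1 by lra.
have := iterated_integral_second_difference exponential_profile a0 b0 ab.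
rewrite maxxx oppr0 expR0 opprK mule1 => <-.
rewrite EFinM -(integral_balakrishnan a01) muleC -ge0_integralZl_EFin//; last 3 first.
- by move=> t _; rewrite lee_fin balakrishnan_integrand_ge0.
- by apply/measurable_EFinP; exact: measurable_balakrishnan_integrand.
- by rewrite ltW// balakrishnan_cst_gt0.
apply: eq_integral => t _; have [t0|t0] := leP t 0.
  by rewrite pospow_le0// mul0r mul0e mule0.
rewrite EFinM muleCA -(integral_balakrishnan b01); congr (_ * _)%E.
rewrite muleC -ge0_integralZl_EFin//; last 3 first.
- by move=> s _; rewrite lee_fin balakrishnan_integrand_ge0.
- by apply/measurable_EFinP; exact: measurable_balakrishnan_integrand.
- by rewrite subr_ge0 expR_le1 oppr_le0 ltW.
apply: eq_integral => s _; have [s0|s0] := leP s 0.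
  by rewrite pospow_le0// !mul0r mule0.
rewrite -EFinM mulrCA; congr (_ * _)%:E.
rewrite /second_difference maxxx oppr0 expR0 !max_l ?addr_ge0 ?(ltW t0) ?(ltW s0)//.
by rewrite opprD expRD; ring.
Qed.

End balakrishnan_constant.

(** * Inner products *)

Lemma cvg_dist_le (R : realType) (V : normedModType R) (T : Type)
    (F : set_system T) {FF : Filter F} (f : T -> V) (a : V) (h : T -> R) :
  (\forall x \near F, `|f x - a| <= h x) -> h x @[x --> F] --> (0 : R) ->
  f x @[x --> F] --> a.
Proof.
move=> fh h0; apply/cvgrPdist_lt => e e0.
have {}h0 : \forall x \near F, `|0 - h x| < e by move/cvgrPdist_lt: h0; apply.
near=> x; rewrite distrC; apply: (@le_lt_trans _ _ (h x)); first by near: x.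
have : `|0 - h x| < e by near: x.
by rewrite sub0r normrN; apply: le_lt_trans; exact: ler_norm.
Unshelve. all: by end_near. Qed.

Lemma cvg_dist0 (R : realType) (V : normedModType R) (T : Type)
    (F : set_system T) {FF : Filter F} (f : T -> V) (a : V) :
  f x @[x --> F] --> a -> `|f x - a| @[x --> F] --> (0 : R).
Proof.
move=> fa; rewrite -[X in _ --> X](@normr0 _ V); apply: cvg_norm.
by rewrite -(subrr a); apply: cvgB => //; exact: cvg_cst.
Qed.

Section inner_product.
Context {R : realType} {X : normedModType R} (ip : {dot X for @idfun R}).
Hypothesis ip_norm : forall u : X, ip u u = `|u| ^+ 2.

Lemma ipC u v : ip u v = ip v u.
Proof. by rewrite hermC expr0 mul1r. Qed.

Lemma ipDl u v w : ip (u + v) w = ip u w + ip v w.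
Proof. exact: linearDl. Qed.
Lemma ipBl u v w : ip (u - v) w = ip u w - ip v w.
Proof. exact: linearBl. Qed.
Lemma ipZl a u w : ip (a *: u) w = a * ip u w.
Proof. exact: linearZl_LR. Qed.
Lemma ip0l w : ip 0 w = 0.
Proof. exact: linear0l. Qed.
Lemma ipDr u v w : ip w (u + v) = ip w u + ip w v.
Proof. exact: linearDr. Qed.
Lemma ipBr u v w : ip w (u - v) = ip w u - ip w v.
Proof. exact: linearBr. Qed.
Lemma ipNr u w : ip w (- u) = - ip w u.
Proof. exact: linearNr. Qed.
Lemma ipZr a u w : ip w (a *: u) = a * ip w u.
Proof. by rewrite linearZr_LR. Qed.
Lemma ip0r w : ip w 0 = 0.
Proof. exact: linear0r. Qed.
Lemma ip_suml (I : Type) (r : seq I) (P : pred I) (F : I -> X) w :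
  ip (\sum_(i <- r | P i) F i) w = \sum_(i <- r | P i) ip (F i) w.
Proof. exact: (big_morph (fun u => ip u w) (fun u v => ipDl u v w) (ip0l w)). Qed.
Lemma ip_sumr (I : Type) (r : seq I) (P : pred I) (F : I -> X) w :
  ip w (\sum_(i <- r | P i) F i) = \sum_(i <- r | P i) ip w (F i).
Proof. by rewrite ipC ip_suml; apply: eq_bigr => i _; rewrite ipC. Qed.

(** Expansion of the squared norm of |v|^2 u - <u, v> v. *)
Lemma cauchy_schwarz u v : `|ip u v| <= `|u| * `|v|.
Proof.
have [->|v0] := eqVneq v 0; first by rewrite ip0r !normr0 mulr0.
have a0 : 0 < `|v| ^+ 2 by rewrite exprn_gt0// normr_gt0.
have : 0 <= ip (`|v| ^+ 2 *: u - ip u v *: v) (`|v| ^+ 2 *: u - ip u v *: v).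
  by rewrite ip_norm sqr_ge0.
rewrite !ipBl !ipBr !ipZl !ipZr (ipC v u) !ip_norm.
have -> : `|v| ^+ 2 * (`|v| ^+ 2 * `|u| ^+ 2) - `|v| ^+ 2 * (ip u v * ip u v) -
    (ip u v * (`|v| ^+ 2 * ip u v) - ip u v * (ip u v * `|v| ^+ 2)) =
    `|v| ^+ 2 * ((`|u| * `|v|) ^+ 2 - `|ip u v| ^+ 2).
  by rewrite real_normK ?num_real//; ring.
by rewrite pmulr_rge0// subr_ge0 ler_pXn2r// nnegrE// mulr_ge0.
Qed.

Lemma cvg_ip (T : Type) (F : set_system T) {FF : Filter F} (f g : T -> X) (a b : X) :
  f x @[x --> F] --> a -> g x @[x --> F] --> b -> ip (f x) (g x) @[x --> F] --> ip a b.
Proof.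
move=> fa gb.
apply: (@cvg_dist_le _ _ _ _ _ _ _ (fun x => `|f x - a| * `|g x - b| + `|f x - a| * `|b| + `|a| * `|g x - b|)).
  near=> x; have -> : ip (f x) (g x) - ip a b =
      ip (f x - a) (g x - b) + ip (f x - a) b + ip a (g x - b).
    by rewrite !ipBl !ipBr; ring.
  rewrite (le_trans (ler_normD _ _))// lerD ?cauchy_schwarz//.
  by rewrite (le_trans (ler_normD _ _))// lerD ?cauchy_schwarz.
have f0 := @cvg_dist0 _ _ _ _ FF _ _ fa; have g0 := @cvg_dist0 _ _ _ _ FF _ _ gb.
rewrite [X in _ --> X](_ : 0 = 0 * 0 + 0 * `|b| + `|a| * 0); last by rewrite !mulr0 mul0r !addr0.
apply: cvgD; first apply: cvgD.
- exact: cvgM.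
- by apply: cvgM => //; exact: cvg_cst.
- by apply: cvgM => //; exact: cvg_cst.
Unshelve. all: by end_near. Qed.

Lemma ip_eq0 u : (forall v, ip u v = 0) -> u = 0.
Proof. by move=> /(_ u)/eqP; rewrite ip_norm sqrf_eq0 normr_eq0 => /eqP. Qed.

Lemma dense_approx (D : set X) u (e : R) : dense D -> 0 < e ->
  exists2 a, D a & `|u - a| < e.
Proof.
move=> dD e0; have [] := dD (ball u e).
- by exists u; exact: ballxx.
- exact: ball_open.
by move=> a []; rewrite -ball_normE /= => ? ?; exists a.
Qed.

End inner_product.

(** * Bochner integrals *)

Section bochner.
Context {R : realType} {X : normedModType R} (ip : {dot X for @idfun R}).
Hypothesis ip_norm : forall u : X, ip u u = `|u| ^+ 2.
Notation mu := (@lebesgue_measure R).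

Lemma integrable_indic_fin (D B : set R) : measurable D -> measurable B ->
  (mu B < +oo)%E -> mu.-integrable D (EFin \o \1_B).
Proof.
move=> mD mB Boo; apply/integrableP; split.
  by apply/measurable_EFinP; exact: measurable_funTS.
rewrite (_ : (fun _ => _) = (fun x => (\1_B x)%:E)); last first.
  by apply/funext => x /=; rewrite ger0_norm.
rewrite integral_indic//; apply: le_lt_trans Boo; apply: le_measure; rewrite ?inE//.
exact: measurableI.
Qed.

(** The integrals of the paired simple functions converge both to the integral of
    the pairing, by convergence in mean, and to the pairing of the integral. *)
Lemma bochner_pairing (D : set R) (f : R -> X) (v z : X) : measurable D ->
  measurable_fun D (fun t => ip (f t) z) -> bochner D f v ->
  mu.-integrable D (fun t => (ip (f t) z)%:E) /\
  \int[mu]_(t in D) ip (f t) z = ip v z.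
Proof.
move=> mD mf [k [B [c /= [mB mg I0 V]]]].
pose g n u := \sum_(j < k n) (\1_(B n j) u *: c n j).
pose p n u := ip (g n u) z.
pose d n := (\int[mu]_(u in D) `|f u - g n u|%:E)%E.
have indB n j : mu.-integrable D (EFin \o \1_(B n j)).
  by have [? ?] := mB n j; exact: integrable_indic_fin.
have pE n : (fun u => (p n u)%:E) =
    (fun u => \sum_(j < k n) ((ip (c n j) z)%:E * (\1_(B n j) u)%:E))%E.
  apply/funext => u; rewrite /p /g (ip_suml ip) -sumEFin.
  by apply: eq_bigr => j _; rewrite ipZl -EFinM mulrC.
have pint n : mu.-integrable D (fun u => (p n u)%:E).
  rewrite pE; apply: integrable_sum => // j _.
  by apply: integrableZl => //; exact: indB.
have pval n : \int[mu]_(u in D) p n u =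
    ip (\sum_(j < k n) (fine (mu (B n j `&` D)) *: c n j)) z.
  rewrite (ip_suml ip) /Rintegral pE integral_sum//; last first.
    by move=> j; apply: integrableZl => //; exact: indB.
  transitivity (fine (\sum_(j < k n) (fine (mu (B n j `&` D)) * ip (c n j) z)%:E)%E).
    congr fine; apply: eq_bigr => j _; have [mBj Bj] := mB n j.
    rewrite integralZl//; last exact: indB.
    rewrite integral_indic// EFinM fineK 1?muleC// ge0_fin_numE//.
    by apply: le_lt_trans Bj; apply: le_measure; rewrite ?inE//; exact: measurableI.
  by rewrite sumEFin/=; apply: eq_bigr => j _; rewrite ipZl.
have fpd n t : `|ip (f t) z - p n t| <= `|z| * `|f t - g n t|.
  by rewrite -ipBl mulrC cauchy_schwarz.
have mp n : measurable_fun D (p n).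
  by apply/measurable_EFinP; have /integrableP[] := pint n.
have mfp n : measurable_fun D (fun t => ip (f t) z - p n t) by exact: measurable_funB.
have /fine_cvgP[dfin d0] : d @ \oo --> 0%:E by [].
have dint n : d n \is a fin_num -> mu.-integrable D (fun t => (`|z| * `|f t - g n t|)%:E).
  move=> dn; under eq_fun do rewrite EFinM; apply: integrableZl => //.
  apply/integrableP; split; first by apply/measurable_EFinP; exact: mg.
  under eq_integral do rewrite gee0_abs ?lee_fin//.
  by move: dn; rewrite fin_numElt => /andP[].
have fpint n : d n \is a fin_num -> mu.-integrable D (fun t => (ip (f t) z - p n t)%:E).
  move=> dn; apply: le_integrable (dint n dn) => //; first by apply/measurable_EFinP; exact: mfp.
  by move=> t _ /=; rewrite lee_fin (le_trans (fpd n t))// ler_norm.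
have fint : mu.-integrable D (fun t => (ip (f t) z)%:E).
  near \oo => n; have dn : d n \is a fin_num by near: n.
  have := @integrableD _ _ _ mu D mD _ _ (fpint n dn) (pint n).
  by under eq_fun do rewrite -EFinD subrK.
split => //.
have c1 : \int[mu]_(u in D) p n u @[n --> \oo] --> ip v z.
  by under eq_fun do rewrite pval; apply: (cvg_ip ip_norm); [exact: V | exact: cvg_cst].
have c2 : \int[mu]_(u in D) p n u @[n --> \oo] --> \int[mu]_(t in D) ip (f t) z.
  apply: (@cvg_dist_le _ R^o _ _ _ _ _ (fun n => `|z| * fine (d n))).
    near=> n; have dn : d n \is a fin_num by near: n.
    rewrite distrC -RintegralB//; last exact: pint.
    apply: (le_trans (le_normr_Rintegral _ _)) => //; first exact: fpint.
    have -> : `|z| * fine (d n) = \int[mu]_(t in D) (`|z| * `|f t - g n t|).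
      rewrite RintegralZl//; apply/integrableP; split.
        by apply/measurable_EFinP; exact: mg.
      under eq_integral do rewrite gee0_abs ?lee_fin//.
      by move: dn; rewrite fin_numElt => /andP[].
    apply: le_Rintegral => //; last exact: dint.
    by apply: integrable_abse (fpint n dn).
  rewrite -[X in _ --> X](mulr0 `|z|); apply: cvgM; first exact: cvg_cst.
  exact: d0.
exact: (cvg_unique _ c2 c1).
Unshelve. all: by end_near. Qed.

(** Measurability of all the functions |F - c| survives the subtraction of simple
    functions from F, whereas measurability of |F| alone does not. *)
Definition subtraction_measurable (D : set R) (F : R -> X) : Prop :=
  forall c : X, measurable_fun D (fun u => `|F u - c|).

Lemma subtraction_measurable_indic (D B : set R) (F : R -> X) (c : X) :
  measurable D -> measurable B -> subtraction_measurable D F ->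
  subtraction_measurable D (fun u => F u - \1_B u *: c).
Proof.
move=> mD mB hF c'.
rewrite (_ : (fun u => _) = (fun u => if u \in B then `|F u - (c + c')| else `|F u - c'|)).
  apply: measurable_fun_if => //.
  - apply: (measurable_fun_bool true).
    rewrite (_ : _ @^-1` _ = B); first exact: measurableI.
    by apply/seteqP; split => u /=; [move/set_mem | move/mem_set].
  - by apply: measurable_funS (hF _) => // u [].
  - by apply: measurable_funS (hF _) => // u [].
apply/funext => u; rewrite indicE; case: ifP => _; last by rewrite scale0r subr0.
by rewrite scale1r opprD addrA.
Qed.

Lemma subtraction_measurable_sum (D : set R) (F : R -> X) (k : nat)
    (B : nat -> set R) (c : nat -> X) :
  measurable D -> (forall j, measurable (B j)) -> subtraction_measurable D F ->
  measurable_fun D (fun u => `|F u - \sum_(j < k) (\1_(B j) u *: c j)|).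
Proof.
move=> mD mB hF.
have : subtraction_measurable D (fun u => F u - \sum_(j < k) (\1_(B j) u *: c j)).
  elim: k => [|k IH].
    by under [X in subtraction_measurable _ X]eq_fun do rewrite big_ord0 subr0.
  under [X in subtraction_measurable _ X]eq_fun do rewrite big_ord_recr /= opprD addrA.
  exact: subtraction_measurable_indic.
by move=> /(_ 0); under eq_fun do rewrite subr0.
Qed.

Lemma subtraction_measurable_continuous (D : set R) (F : R -> X) : open D ->
  {in D, continuous F} -> subtraction_measurable D F.
Proof.
move=> oD cF c; apply: open_continuous_measurable_fun => // u uD.
have : {for u, continuous (fun u => F u - c)}.
  by apply: continuousB; [exact: cF | exact: cst_continuous].
by move=> h; apply: (continuous_comp h); exact: norm_continuous.
Qed.

(** The two families of simple functions are concatenated.  The definition of the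
    integral asks for measurable error norms, and these are not determined by the
    error norms of f and of g. *)
Lemma bochner_linear (D : set R) (f g : R -> X) (v w : X) (a : R) :
  measurable D -> subtraction_measurable D (fun u => a *: f u + g u) ->
  bochner D f v -> bochner D g w ->
  bochner D (fun t => a *: f t + g t) (a *: v + w).
Proof.
move=> mD mfg [k [B [c /= [mB mf If Vf]]]] [k' [B' [c' /= [mB' mg Ig Vg]]]].
pose B'' n j := if (j < k n)%N then B n j else B' n (j - k n)%N.
pose c'' n j := if (j < k n)%N then a *: c n j else c' n (j - k n)%N.
have split_sum n (h h' : set R -> R) :
    \sum_(j < k n + k' n) ((if (j < k n)%N then h (B'' n j) else h' (B'' n j)) *: c'' n j) =
    a *: \sum_(j < k n) (h (B n j) *: c n j) + \sum_(j < k' n) (h' (B' n j) *: c' n j).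
  rewrite big_split_ord/=; congr (_ + _).
    rewrite scaler_sumr; apply: eq_bigr => j _.
    by rewrite /B'' /c'' ltn_ord !scalerA mulrC.
  apply: eq_bigr => j _; rewrite /B'' /c''.
  by rewrite ltnNge leq_addr/= addnC addnK.
have split_sum' n (h : set R -> R) :
    \sum_(j < k n + k' n) (h (B'' n j) *: c'' n j) =
    a *: \sum_(j < k n) (h (B n j) *: c n j) + \sum_(j < k' n) (h (B' n j) *: c' n j).
  by rewrite -split_sum; apply: eq_bigr => j _; case: ifP.
have mB'' n j : measurable (B'' n j) /\ (mu (B'' n j) < +oo)%E.
  by rewrite /B''; case: ifP => _; [exact: mB | exact: mB'].
exists (fun n => k n + k' n)%N, B'', c''; split.
- exact: mB''.
- move=> n; apply: subtraction_measurable_sum => // j.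
  by have [] := mB'' n j.
- pose h n := (`|a|%:E * \int[mu]_(u in D) `|f u - \sum_(j < k n) (\1_(B n j) u *: c n j)|%:E +
     \int[mu]_(u in D) `|g u - \sum_(j < k' n) (\1_(B' n j) u *: c' n j)|%:E)%E.
  apply: (@squeeze_cvge _ _ _ _ (cst 0%E) _ h); last 2 first.
  + exact: cvg_cst.
  + rewrite -[X in _ --> X](adde0) -[X in _ --> (X + _)%E](mule0 `|a|%:E).
    apply: cvgeD => //; exact: cvgeZl.
  near=> n; apply/andP; split; first by apply: integral_ge0 => u _; rewrite lee_fin.
  rewrite /h -ge0_integralZl_EFin//; last by apply/measurable_EFinP; exact: mf.
  rewrite -ge0_integralD//; last 2 first.
  + by apply/measurable_EFinP; apply: measurable_funM => //; exact: mf.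
  + by apply/measurable_EFinP; exact: mg.
  apply: ge0_le_integral => //.
  + apply/measurable_EFinP; apply: subtraction_measurable_sum => // j.
    by have [] := mB'' n j.
  + apply: emeasurable_funD.
      by apply/measurable_EFinP; apply: measurable_funM => //; exact: mf.
    by apply/measurable_EFinP; exact: mg.
  + move=> u _; rewrite -EFinM -EFinD lee_fin (split_sum' n (fun B => \1_B u)).
    rewrite opprD addrACA -scalerBr (le_trans (ler_normD _ _))//.
    by rewrite normrZ.
- under eq_fun do rewrite (split_sum' _ (fun B => fine (mu (B `&` D)))).
  by apply: cvgD => //; exact: cvgZl_tmp.
Unshelve. all: by end_near. Qed.

End bochner.

(** * Integrability of second differences *)

Section profile_bounds.
Context {R : realType}.
Notation mu := (@lebesgue_measure R).
Variables k k1 k2 : R -> R.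
Hypothesis kP : convex_profile k k1 k2.

Let ck : continuous k. Proof. by case: kP. Qed.
Let dk (t : R) : 0 < t -> is_derive t (1 : R) k (k1 t).
Proof. by case: kP => _ _ _ + _ => /[apply] -[]. Qed.
Let k_ge0 t : 0 <= t -> 0 <= k t.
Proof. by case: kP => _ _ _ _ /[apply] -[]. Qed.
Let k1_le0 t : 0 <= t -> k1 t <= 0.
Proof. by case: kP => _ _ _ _ /[apply] -[]. Qed.

Lemma profile_nonincreasing t s : 0 <= t -> 0 <= s -> k (t + s) <= k t.
Proof.
move=> t0; rewrite le_eqVlt => /predU1P[<-|s0]; first by rewrite addr0.
have ts : t < t + s by rewrite ltrDl.
have dk' (r : R) : r \in `]t, t + s[ -> is_derive r (1 : R) k (k1 r).
  by rewrite in_itv/= => /andP[tr _]; apply: dk; exact: le_lt_trans tr.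
have [c] := @MVT _ k k1 t (t + s) ts dk' (continuous_subspaceT ck).
rewrite in_itv/= => /andP[tc _]; rewrite [t + s]addrC addrK => h.
rewrite -subr_le0 h mulr_le0_ge0 ?(ltW s0)// k1_le0// (le_trans t0)//.
exact: ltW.
Qed.

Lemma second_difference_ge0 t s : 0 <= t -> 0 <= s -> 0 <= second_difference k t s.
Proof.
move=> t0; rewrite le_eqVlt => /predU1P[<-|s0].
  by rewrite /second_difference addr0; lra.
pose G r := k (t + r) - k r.
have cG : continuous G by move=> r; apply: cvgB; [exact: continuous_shiftl | exact: ck].
have dG (r : R) : r \in `]0, s[ -> is_derive r (1 : R) G (k1 (t + r) - k1 r).
  rewrite in_itv/= => /andP[r0 _].
  have h : is_derive r (1 : R) (fun p => k (t + p)) (k1 (t + r)).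
    by apply: is_derive_shiftl; apply: dk; rewrite ltr_wpDl.
  have h4 := dk r0.
  rewrite (_ : G = (fun p => k (t + p)) - k)//.
  exact: is_derive_eq.
have [c] := @MVT _ G (fun r => k1 (t + r) - k1 r) 0 s s0 dG (continuous_subspaceT cG).
rewrite in_itv/= => /andP[c0 _]; rewrite subr0 /G addr0 => h.
have -> : second_difference k t s = k (t + s) - k s - (k t - k 0).
  by rewrite /second_difference; ring.
rewrite h mulr_ge0 ?(ltW s0)// subr_ge0.
exact: (profile_slope_nondecreasing kP (ltW c0) t0).
Qed.

Lemma second_difference_le t s : 0 <= t -> 0 <= s ->
  second_difference k t s <= k 0 - k s.
Proof.
move=> t0 s0; rewrite /second_difference -subr_ge0.
by have := profile_nonincreasing t0 s0; lra.
Qed.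

(** A domination by the integrand of the Balakrishnan constant: the first summand
    of the constant handles s <= 1, where the decay is at most linear, and the
    second handles s > 1, where it is at most k(0). *)
Lemma profile_decay_exp : exists2 K, 0 <= K &
  forall s, 0 <= s -> k 0 - k s <= K * (1 - expR (- s)).
Proof.
have e1 : 0 < 1 - expR (- 1) :> R by rewrite subr_gt0 expR_lt1 oppr_lt0.
have a0 : 0 <= - k1 0 by rewrite oppr_ge0 k1_le0.
have k0 : 0 <= k 0 by exact: k_ge0.
exists (- k1 0 * expR 1 + k 0 / (1 - expR (- 1))).
  by rewrite addr_ge0// ?mulr_ge0 ?expR_ge0// divr_ge0// ltW.
move=> s s0; have x0 : 0 <= 1 - expR (- s) by rewrite subr_ge0 expR_le1 oppr_le0.
have [s1|s1] := leP s 1.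
  apply: (le_trans (profile_decay_le kP s0)).
  apply: (@le_trans _ _ (- k1 0 * expR 1 * (1 - expR (- s)))); last first.
    by rewrite ler_wpM2r// lerDl divr_ge0// ltW.
  rewrite -mulrA ler_wpM2l//.
  (* 1 - exp(- s) = exp(- s) (exp(s) - 1) >= exp(- 1) s for 0 <= s <= 1. *)
  apply: (@le_trans _ _ (expR 1 * (expR (- s) * s))).
    rewrite mulrA -expRD ler_peMl// -[leLHS]expR0 ler_expR subr_ge0//.
  rewrite ler_wpM2l ?expR_ge0//.
  have -> : 1 - expR (- s) = expR (- s) * (expR s - 1).
    by rewrite mulrBr -expRD addNr expR0 mulr1.
  by rewrite ler_wpM2l ?expR_ge0// lerBrDl expR_ge1Dx.
apply: (@le_trans _ _ (k 0)); first by rewrite gerBl k_ge0.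
apply: (@le_trans _ _ (k 0 / (1 - expR (- 1)) * (1 - expR (- s)))).
  rewrite -mulrA ler_peMr// ler_pdivlMl// mulr1 lerB// ler_expR lerN2 ltW//.
by rewrite ler_wpM2r// lerDr mulr_ge0// expR_ge0.
Qed.

Lemma measurable_second_difference (b t : R) :
  measurable_fun [set: R] (fun s => pospow (- b - 1) s * second_difference k t s).
Proof.
apply: measurable_funM; first exact: measurable_pospow.
apply: continuous_measurableR => s; apply: cvgD; last exact: continuous_shiftl.
by apply: cvgB; [exact: cvg_cst | exact: ck].
Qed.

Lemma second_difference_weight_ge0 b t s : 0 <= t ->
  0 <= pospow (- b - 1) s * second_difference k t s.
Proof.
move=> t0; have [s0|s0] := leP s 0; first by rewrite pospow_le0// mul0r.
by rewrite mulr_ge0 ?pospow_ge0// second_difference_ge0// ltW.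
Qed.

Lemma integrable_second_difference (b t : R) : 0 < b < 1 -> 0 <= t ->
  mu.-integrable setT (fun s => (pospow (- b - 1) s * second_difference k t s)%:E).
Proof.
move=> b01 t0; have [K K0 hK] := profile_decay_exp.
have mB := @measurable_balakrishnan_integrand R (- b - 1).
have gint : mu.-integrable setT
    (fun s => (K * (pospow (- b - 1) s * (1 - expR (- s))))%:E).
  under eq_fun do rewrite EFinM; apply: integrableZl => //.
  apply/integrableP; split; first by apply/measurable_EFinP; exact: mB.
  under eq_integral do rewrite gee0_abs ?lee_fin ?balakrishnan_integrand_ge0//.
  exact: integral_balakrishnan_lty.
apply: le_integrable gint => //.
  by apply/measurable_EFinP; exact: measurable_second_difference.
move=> s _ /=; rewrite lee_fin.
rewrite (ger0_norm (second_difference_weight_ge0 _ _ t0)).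
rewrite (ger0_norm (mulr_ge0 K0 (balakrishnan_integrand_ge0 _ _))).
have [s0|s0] := leP s 0; first by rewrite pospow_le0// !mul0r mulr0.
rewrite mulrCA ler_wpM2l ?pospow_ge0//.
by rewrite (le_trans (second_difference_le _ _))// ?hK// ltW.
Qed.

(** A version with finite values, so that the iterated integrals of two profiles
    can be subtracted in the polarisation. *)
Lemma profile_iterated_integral (a b : R) : 0 < a -> 0 < b -> a + b = 1 ->
  let f t := pospow (- a - 1) t *
    \int[mu]_s (pospow (- b - 1) s * second_difference k t s) in
  mu.-integrable setT (EFin \o f) /\
  \int[mu]_t (f t) = balakrishnan_cst a * balakrishnan_cst b * - k1 0.
Proof.
move=> a0 b0 ab f.
have b01 : 0 < b < 1 by lra.
pose g t s := pospow (- a - 1) t * (pospow (- b - 1) s * second_difference k t s).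
have g0 t s : 0 <= g t s.
  have [t0|t0] := leP t 0; first by rewrite /g pospow_le0// mul0r.
  by rewrite mulr_ge0 ?pospow_ge0// second_difference_weight_ge0// ltW.
have mg : measurable_fun [set: R * R] (fun z => g z.1 z.2).
  apply: measurable_funM.
    by apply: (measurableT_comp (measurable_pospow _)); exact: measurable_fst.
  apply: measurable_funM.
    by apply: (measurableT_comp (measurable_pospow _)); exact: measurable_snd.
  have mk := continuous_measurableR ck.
  apply: measurable_funD; first apply: measurable_funB; first apply: measurable_funB => //.
  - by apply: (measurableT_comp mk); exact: measurable_fst.
  - by apply: (measurableT_comp mk); exact: measurable_snd.
  - apply: (measurableT_comp mk); apply: measurable_funD; first exact: measurable_fst.
    exact: measurable_snd.
have inner t : 0 < t -> (\int[mu]_s (pospow (- b - 1) s * second_difference k t s)%:E =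
    (\int[mu]_s (pospow (- b - 1) s * second_difference k t s))%:E)%E.
  move=> t0; rewrite /Rintegral fineK//.
  by apply: integrable_fin_num => //; apply: integrable_second_difference => //; exact: ltW.
have fE t : (f t)%:E = (\int[mu]_s (g t s)%:E)%E.
  have [t0|t0] := leP t 0.
    by rewrite /f pospow_le0// mul0r integral0_eq// => s _; rewrite /g pospow_le0// mul0r.
  under eq_integral do rewrite EFinM.
  rewrite ge0_integralZl_EFin ?pospow_ge0//; last 2 first.
  - by move=> s _; rewrite lee_fin second_difference_weight_ge0// ltW.
  - by apply/measurable_EFinP; exact: measurable_second_difference.
  by rewrite inner// -EFinM.
have f0 t : 0 <= f t by rewrite -lee_fin fE; apply: integral_ge0 => s _; rewrite lee_fin.
have val : (\int[mu]_t (f t)%:E = (balakrishnan_cst a * balakrishnan_cst b * - k1 0)%:E)%E.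
  rewrite EFinM -(stieltjes_cstE a0 b0 ab).
  rewrite -(iterated_integral_second_difference kP a0 b0 ab).
  apply: eq_integral => t _; have [t0|t0] := leP t 0.
    by rewrite /f pospow_le0// mul0r mul0e.
  by rewrite inner.
split; last by rewrite /Rintegral val.
apply/integrableP; split.
  rewrite (_ : EFin \o f = (fun t => \int[mu]_s (g t s)%:E)%E); last exact/funext.
  exact: measurable_inner_integral.
under eq_integral do rewrite /= ger0_norm//.
by rewrite val ltry.
Qed.

End profile_bounds.

(** * Dyadic sewing and Young integrals *)

Section sewing.
Context {R : realType}.

Fixpoint dyadic (n : nat) (s t : R) : seq R :=
  if n is n'.+1 then dyadic n' s ((s + t) / 2) ++ dyadic n' ((s + t) / 2) t
  else [:: t].

Lemma midpoint_lt (s t : R) : s < t -> s < (s + t) / 2 < t.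
Proof. by move=> st; apply/andP; split; lra. Qed.

Lemma last_dyadic n (s t x : R) : last x (dyadic n s t) = t.
Proof. by elim: n s t x => //= n IH s t x; rewrite last_cat IH. Qed.

Lemma dyadic_partition n (s t : R) : s < t -> itv_partition s t (dyadic n s t).
Proof.
elim: n s t => [|n IH] s t st /=; first exact: itv_partition1.
have /andP[sm mt] := midpoint_lt st.
by apply: itv_partition_cat; exact: IH.
Qed.

Lemma dyadic_mesh n (s t d : R) : (t - s) / 2 ^+ n < d ->
  all (fun l => l < d) (pairmap (fun s t => t - s) s (dyadic n s t)).
Proof.
elim: n s t => [|n IH] s t /=; first by rewrite expr0 divr1 andbT.
have -> : (t - s) / 2 ^+ n.+1 = (t - s) / 2 / 2 ^+ n.
  by rewrite exprS invfM mulrA.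
move=> h; rewrite pairmap_cat last_dyadic all_cat !IH//.
- by have -> : t - (s + t) / 2 = (t - s) / 2 by field.
- by have -> : (s + t) / 2 - s = (t - s) / 2 by field.
Qed.

Lemma dyadic_small (l d : R) : 0 < d -> exists n, l / 2 ^+ n < d.
Proof.
move=> d0; pose N := (Num.truncn (`|l| / d)).+1; exists N.
rewrite ltr_pdivrMr ?exprn_gt0// mulrC -ltr_pdivrMr//.
apply: (@le_lt_trans _ _ (`|l| / d)); first by rewrite ler_wpM2r ?invr_ge0 ?ler_norm// ltW.
apply: (@lt_trans _ _ N%:R); first exact: truncnS_gt.
by rewrite -natrX ltr_nat ltn_expl.
Qed.

Context {V : normedModType R}.
Implicit Types Xi : R -> R -> V.

(** Halving an interval multiplies the power th of its length by 2^(-th), and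
    there are two halves: the defects of successive dyadic refinements decrease
    geometrically, with ratio 2^(1 - th) < 1. *)
Lemma dyadic_sum_bound Xi (a b C th : R) n : 0 <= C -> 1 < th ->
  (forall s u t, a <= s -> s <= u -> u <= t -> t <= b ->
     `|Xi s t - Xi s u - Xi u t| <= C * (t - s) `^ th) ->
  forall s t, a <= s -> s < t -> t <= b ->
  `|\sum_(z <- pairmap Xi s (dyadic n s t)) z - Xi s t| <=
    C / (1 - 2 `^ (1 - th)) * (t - s) `^ th.
Proof.
move=> C0 th1 hXi; set K := C / _.
have q1 : 2 `^ (1 - th) < 1 :> R.
  rewrite -opprB powRN invf_lt1 ?powR_gt0//.
  have : 1 `^ (th - 1) < 2 `^ (th - 1) :> R.
    by apply: gt0_ltr_powR; rewrite ?subr_gt0 ?nnegrE// ltr1n.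
  by rewrite powR1.
have K0 : 0 <= K by rewrite divr_ge0// subr_ge0 ltW.
elim: n => [|n IH] s t sa st tb /=.
  by rewrite big_seq1 subrr normr0 mulr_ge0// powR_ge0.
have /andP[sm mt] := midpoint_lt st; set u := (s + t) / 2 in sm mt *.
rewrite pairmap_cat last_dyadic big_cat/=.
set S1 := \sum_(_ <- _) _; set S2 := \sum_(_ <- _) _.
have h1 : `|S1 - Xi s u| <= K * (u - s) `^ th by apply: IH => //; rewrite (le_trans (ltW mt)).
have h2 : `|S2 - Xi u t| <= K * (t - u) `^ th by apply: IH => //; exact: (le_trans sa (ltW sm)).
have h3 := hXi s u t sa (ltW sm) (ltW mt) tb.
have half w : w = (t - s) / 2 -> w `^ th = 2 `^ (- th) * (t - s) `^ th.
  move=> ->; rewrite mulrC powRM ?invr_ge0 ?subr_ge0 ?(ltW st)//.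
  by rewrite -powR_inv1// -powRrM mulN1r.
have -> : S1 + S2 - Xi s t = (S1 - Xi s u) + (S2 - Xi u t) - (Xi s t - Xi s u - Xi u t).
  by rewrite addrACA -opprD -(addrA (Xi s t)) -opprD opprB addrA subrK.
rewrite (le_trans (ler_normB _ _))// (le_trans (lerD (ler_normD _ _) (lexx _)))//.
rewrite (le_trans (lerD (lerD h1 h2) h3))//.
rewrite (half (u - s)) ?(half (t - u)); try by rewrite /u; field.
set w := (t - s) `^ th.
have -> : K * (2 `^ (- th) * w) + K * (2 `^ (- th) * w) = K * 2 `^ (1 - th) * w.
  rewrite powRD ?pnatr_eq0 ?implybT// powRr1//; ring.
rewrite -mulrDl ler_wpM2r ?powR_ge0//.
rewrite le_eqVlt; apply/orP; left; apply/eqP.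
by rewrite /K; field; rewrite subr_eq0 eq_sym lt_eqF.
Qed.

Definition sewing_cst (C th : R) : R := C / (1 - 2 `^ (1 - th)).

(** The bound is uniform over dyadic partitions, whose mesh tends to 0. *)
Lemma sewing Xi (a b C th : R) (v : V) : a < b -> 0 <= C -> 1 < th ->
  (forall s u t, a <= s -> s <= u -> u <= t -> t <= b ->
     `|Xi s t - Xi s u - Xi u t| <= C * (t - s) `^ th) ->
  partition_limit Xi a b v ->
  `|v - Xi a b| <= sewing_cst C th * (b - a) `^ th.
Proof.
move=> ab C0 th1 hXi lim; apply/ler_addgt0Pl => e e0.
have [d d0 hd] := lim e e0.
have [n hn] := dyadic_small (b - a) d0.
have := hd _ (dyadic_partition n ab) (dyadic_mesh hn).
set sum := \sum_(_ <- _) _ => close.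
rewrite -(subrKA sum) (le_trans (ler_normD _ _))// lerD//; first by rewrite distrC ltW.
exact: (dyadic_sum_bound n C0 th1 hXi (lexx a) ab (lexx b)).
Qed.

End sewing.

Section partition_sums.
Context {R : realType} {V : normedModType R}.
Implicit Types F G : R -> R -> V.

Lemma pairmap_sum_congr F G (a b : R) p : itv_partition a b p ->
  (forall s t, a <= s -> s < t -> t <= b -> F s t = G s t) ->
  \sum_(z <- pairmap F a p) z = \sum_(z <- pairmap G a p) z.
Proof.
elim: p a => [//|c p IH] a pab FG /=.
have pcb := itv_partition_cons pab.
have ac : a < c by case: pab => /= /andP[].
rewrite !big_cons FG ?lexx ?(itv_partition_le pcb)// (IH c)// => s t cs.
by apply: FG; rewrite (le_trans (ltW ac)).
Qed.

Lemma pairmap_sum_linear (W : normedModType R) (L : {linear V -> W}) F (a : R) p :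
  \sum_(z <- pairmap (fun s t => L (F s t)) a p) z =
  L (\sum_(z <- pairmap F a p) z).
Proof.
by elim: p a => [|c p IH] a /=; rewrite ?big_nil ?linear0// !big_cons IH linearD.
Qed.

End partition_sums.

Lemma mul_powR_le (R : realType) (p q l a b : R) : 0 <= p <= l -> 0 <= q <= l ->
  0 <= a -> 0 <= b -> 0 < a + b -> p `^ a * q `^ b <= l `^ (a + b).
Proof.
move=> /andP[p0 pl] /andP[q0 ql] a0 b0 ab.
have l0 : 0 <= l by exact: le_trans pl.
have -> : l `^ (a + b) = l `^ a * l `^ b by rewrite powRD// (gt_eqF ab).
by apply: ler_pM; rewrite ?powR_ge0// ge0_ler_powR// nnegrE.
Qed.

Section young_estimates.
Context {R : realType}.

(** The defect of the germ at s <= u <= t is (x(t) - x(u)) (g(s) - g(u)). *)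
Lemma young_germ_estimate (T eta al Cx Cg : R) (x g : R -> R) (a b v : R) :
  0 <= eta -> 0 <= al -> 1 < eta + al -> 0 <= Cx -> 0 <= Cg ->
  0 <= a -> a < b -> b <= T ->
  (forall s t, 0 <= s <= T -> 0 <= t <= T -> `|x s - x t| <= Cx * `|s - t| `^ eta) ->
  (forall s t, 0 <= s -> s <= t -> t <= T -> `|g s - g t| <= Cg * (t - s) `^ al) ->
  young (V := R^o) x g a b v ->
  `|v - (x b - x a) * g a| <= sewing_cst (Cx * Cg) (eta + al) * (b - a) `^ (eta + al).
Proof.
move=> eta0 al0 ea Cx0 Cg0 a0 ab bT hx hg yv.
apply: (sewing (Xi := fun s t => (x t - x s) *: (g s : R^o))) => //; first exact: mulr_ge0.
move=> s u t sa su ut tb.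
have s0 : 0 <= s by exact: le_trans sa.
have tT : t <= T by exact: le_trans bT.
have -> : (x t - x s) *: (g s : R^o) - (x u - x s) *: (g s : R^o) - (x t - x u) *: (g u : R^o) =
    (x t - x u) * (g s - g u) by rewrite /GRing.scale/=; ring.
rewrite normrM; apply: (@le_trans _ _ (Cx * (t - u) `^ eta * (Cg * (u - s) `^ al))).
  rewrite ler_pM//.
    rewrite -[in leRHS](ger0_norm (x := t - u)) ?subr_ge0//; apply: hx.
      by rewrite tT (le_trans s0) ?(le_trans su).
    by rewrite (le_trans s0 su) (le_trans ut).
  by apply: hg => //; exact: le_trans tT.
rewrite mulrACA ler_wpM2l ?mulr_ge0// mul_powR_le//.
- by rewrite subr_ge0 ut lerB.
- by rewrite subr_ge0 su lerB.
- by rewrite (lt_trans ltr01).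
Qed.

End young_estimates.

Section young_convolution.
Context {R : realType} {X : normedModType R} (S : R -> {linear X -> X}).
Hypothesis S_C0 : C0_semigroup S.
Variables (T M : R).
Hypothesis M_gt0 : 0 < M.
Hypothesis S_le : forall t u, 0 <= t <= T -> `|S t u| <= M * `|u|.

Let SD s t u : 0 <= s -> 0 <= t -> S (s + t) u = S s (S t u).
Proof. by case: S_C0 => _ _ + _; apply. Qed.
Let S0 u : S 0 u = u. Proof. by case: S_C0. Qed.

(** A partition of [t0, t] is appended to one of [0, t0], and S(t - t0) factors
    out of the terms of the latter. *)
Lemma young_conv_flow (x : R -> R) (f : R -> X) (t0 t : R) (I0 I1 : X) :
  0 <= t0 -> t0 < t -> t <= T ->
  young_conv S x f 0 t0 I0 -> young_conv S x f 0 t I1 ->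
  young_conv S x f t0 t (I1 - S (t - t0) I0).
Proof.
move=> t00 t0t tT h0 h1 e e0.
have tt0 : 0 <= t - t0 <= T.
  by rewrite subr_ge0 (ltW t0t)/= (le_trans _ tT)// gerBl.
have e2 : 0 < e / 2 by rewrite divr_gt0.
have [d1 d10 hd1] := h1 _ e2.
have [d0 d00 hd0] := h0 _ (divr_gt0 e2 M_gt0).
exists d1 => // p pp pmesh.
have dmin : 0 < Num.min d0 d1 by rewrite lt_min d00 d10.
have [q [qp [qm0 qm1]]] : exists q, itv_partition 0 t0 q /\
    (all (fun l => l < d0) (pairmap (fun s t => t - s) 0 q) /\
     all (fun l => l < d1) (pairmap (fun s t => t - s) 0 q)).
  move: t00; rewrite le_eqVlt => /predU1P[<-|t00]; first by exists [::].
  have [n hn] := dyadic_small (t0 - 0) dmin.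
  exists (dyadic n 0 t0); split; first exact: dyadic_partition.
  by split; apply: dyadic_mesh; rewrite (lt_le_trans hn)// ge_min lexx ?orbT.
have lastq : last 0 q = t0 by case: qp => _ /eqP.
have full := itv_partition_cat qp pp.
have := hd1 _ full; rewrite !pairmap_cat lastq all_cat qm1 pmesh => /(_ isT).
rewrite big_cat/=; set P := \sum_(_ <- pairmap _ t0 p) _.
have -> : \sum_(z <- pairmap (fun s r => (x r - x s) *: S (t - s) (f s)) 0 q) z =
    S (t - t0) (\sum_(z <- pairmap (fun s r => (x r - x s) *: S (t0 - s) (f s)) 0 q) z).
  rewrite -pairmap_sum_linear; apply: (pairmap_sum_congr qp) => s r s0 sr rt0.
  rewrite linearZ; congr (_ *: _); rewrite -SD ?subrKA//; first by case/andP: tt0.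
  by rewrite subr_ge0 (le_trans (ltW sr)).
have := hd0 _ qp qm0; set Q := \sum_(_ <- _) _ => hQ hP.
have -> : P - (I1 - S (t - t0) I0) = (S (t - t0) Q + P - I1) - S (t - t0) (Q - I0).
  rewrite (raddfB (S (t - t0))) !opprB [S _ Q + P]addrC -!addrA; congr (_ + _).
  by rewrite [RHS]addrCA [X in - I1 + X]addrC subrK addrC.
rewrite (le_lt_trans (ler_normB _ _))// [e]splitr ltrD//.
by rewrite (le_lt_trans (S_le _ tt0))// mulrC -ltr_pdivlMr.
Qed.

(** The defect of the germ at s <= u <= t is
    (x(t) - x(u)) S(b - u) (S(u - s) f(s) - f(u)), in which twisted increments of f
    replace the increments of the scalar case. *)
Lemma young_conv_germ_estimate (eta al Cx Cf : R) (x : R -> R) (f : R -> X) (a b : R) (v : X) :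
  0 <= eta -> 0 <= al -> 1 < eta + al -> 0 <= Cx -> 0 <= Cf ->
  0 <= a -> a < b -> b <= T ->
  (forall s t, 0 <= s <= T -> 0 <= t <= T -> `|x s - x t| <= Cx * `|s - t| `^ eta) ->
  (forall s t, 0 <= s -> s < t -> t <= T -> `|f t - S (t - s) (f s)| <= Cf * (t - s) `^ al) ->
  young_conv S x f a b v ->
  `|v - (x b - x a) *: S (b - a) (f a)| <=
    sewing_cst (Cx * (M * Cf)) (eta + al) * (b - a) `^ (eta + al).
Proof.
move=> eta0 al0 ea Cx0 Cf0 a0 ab bT hx hf yv.
apply: (sewing (Xi := fun s t => (x t - x s) *: S (b - s) (f s))) => //.
  by rewrite !mulr_ge0// ltW.
move=> s u t sa su ut tb.
have s0 : 0 <= s by exact: le_trans sa.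
have tT : t <= T by exact: le_trans bT.
have [us|] := eqVneq s u.
  rewrite us subrr scale0r subr0 subrr normr0.
  by rewrite !mulr_ge0 ?powR_ge0// ltW.
move=> nsu; have {}su : s < u by rewrite lt_neqAle nsu.
have -> : S (b - s) (f s) = S (b - u) (S (u - s) (f s)).
  by rewrite -SD ?subrKA// subr_ge0 ?(le_trans ut)// ltW.
rewrite -scalerBl opprB addrA subrK.
rewrite -scalerBr -linearB normrZ.
apply: (@le_trans _ _ (Cx * (t - u) `^ eta * (M * (Cf * (u - s) `^ al)))).
  rewrite ler_pM//.
    rewrite -[in leRHS](ger0_norm (x := t - u)) ?subr_ge0//; apply: hx.
      by rewrite tT (le_trans s0) ?(le_trans (ltW su)).
    by rewrite (le_trans s0 (ltW su)) (le_trans ut).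
  rewrite (le_trans (S_le _ _))//.
    by rewrite subr_ge0 (le_trans ut)//= (le_trans _ bT)// gerBl (le_trans s0)// ltW.
  rewrite ler_wpM2l ?(ltW M_gt0)// distrC hf//.
  exact: le_trans tT.
rewrite (mulrA M Cf) mulrACA ler_wpM2l ?mulr_ge0 ?(ltW M_gt0)// mul_powR_le//.
- by rewrite subr_ge0 ut lerB// ltW.
- by rewrite subr_ge0 (ltW su) lerB.
- by rewrite (lt_trans ltr01).
Qed.

End young_convolution.

(** * Upper limits with a power weight *)

Section limsup.
Context {R : realType}.

Lemma limf_esup_le (f : R -> R) (F : set_system R) {FF : Filter F} (l : R) :
  (forall e, 0 < e -> \forall t \near F, f t <= l + e) ->
  (limf_esup (fun t => (f t)%:E) F <= l%:E)%E.
Proof.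
move=> h; apply/lee_addgt0Pr => e e0.
rewrite limf_esupE; apply: (@le_trans _ _ (ereal_sup ((fun t => (f t)%:E) @` [set t | f t <= l + e]))).
  apply: ereal_inf_lbound; exists [set t | f t <= l + e] => //.
  exact: h.
apply: ge_ereal_sup => _ [t /= ft <-].
by rewrite -EFinD lee_fin.
Qed.

Lemma powR_small (p e : R) (t0 : R) : 0 < p -> 0 < e ->
  \forall t \near t0^'+, (t - t0) `^ p <= e.
Proof.
move=> p0 e0; have d0 : 0 < e `^ p^-1 by exact: powR_gt0.
near=> t; have t0t : t0 < t by near: t; exact: nbhs_right_gt.
have td : t < t0 + e `^ p^-1 by near: t; apply: nbhs_right_lt; rewrite ltrDl.
rewrite -[leRHS](powRr1 (ltW e0)) -(mulVf (lt0r_neq0 p0)) powRrM.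
apply: ge0_ler_powR; rewrite ?nnegrE ?subr_ge0 ?powR_ge0 ?(ltW t0t) ?(ltW p0)//.
by rewrite lerBlDl ltW.
Unshelve. all: by end_near. Qed.

Lemma limf_esup_power_le0 (w N : R -> R) (t0 p beta C : R) : 0 <= C -> beta < p ->
  (\forall t \near t0^'+, w t = (t - t0) `^ (- beta)) ->
  (\forall t \near t0^'+, N t <= C * (t - t0) `^ p) ->
  (limf_esup (fun t => (w t * N t)%:E) t0^'+ <= 0)%E.
Proof.
move=> C0 bp hw hN; apply: limf_esup_le => e e0; rewrite add0r.
have C1 : 0 < C + 1 by rewrite ltr_wpDl.
have pb : 0 < p - beta by rewrite subr_gt0.
have small := powR_small t0 pb (divr_gt0 e0 C1).
near=> t; have t0t : t0 < t by near: t; exact: nbhs_right_gt.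
have Nt : N t <= C * (t - t0) `^ p by near: t.
have st : (t - t0) `^ (p - beta) <= e / (C + 1) by near: t.
have h0 : 0 < t - t0 by rewrite subr_gt0.
have -> : w t = (t - t0) `^ (- beta) by near: t.
apply: (@le_trans _ _ ((t - t0) `^ (- beta) * (C * (t - t0) `^ p))).
  by rewrite ler_wpM2l ?powR_ge0.
rewrite mulrCA -powRD ?(gt_eqF h0) ?implybT// [- beta + p]addrC.
apply: (@le_trans _ _ (C * (e / (C + 1)))); first by rewrite ler_wpM2l.
by rewrite mulrCA ger_pMr// ler_pdivrMr// mul1r lerDl.
Unshelve. all: by end_near. Qed.

(** Negation exchanges the positive and the negative part of f. *)
Lemma RintegralN_any (D : set R) (f : R -> R) :
  \int[@lebesgue_measure R]_(t in D) (- f t) = - \int[@lebesgue_measure R]_(t in D) f t.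
Proof.
rewrite /Rintegral integralE [in RHS]integralE.
have -> : (fun t => (- f t)%:E)^\+%E = (fun t => (f t)%:E)^\-%E.
  by rewrite -funeposN; congr funepos; apply/funext => t.
have -> : (fun t => (- f t)%:E)^\-%E = (fun t => (f t)%:E)^\+%E.
  by rewrite -funenegN; congr funeneg; apply/funext => t.
set a := (\int[_]_(_ in _) _)%E; set b := (\int[_]_(_ in _) _)%E.
by case: a => [a||]; case: b => [b||] //=; rewrite ?oppr0//= opprB.
Qed.

End limsup.

(** * The squared positive part of an affine function *)

Section posp.
Context {R : realType}.

Lemma maxr0_lipschitz (a b : R) : `|Num.max a 0 - Num.max b 0| <= `|a - b|.
Proof.
case: (leP a 0) => a0; case: (leP b 0) => b0; rewrite ?subrr ?normr0//.
- rewrite sub0r normrN [leRHS]distrC gtr0_norm// (le_trans _ (ler_norm _))//.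
  by rewrite lerBrDr -lerBrDl subrr.
- by rewrite subr0 gtr0_norm// (le_trans _ (ler_norm _))// lerBrDr -lerBrDl subrr.
Qed.

(** Taylor bound for the square of the positive part, a C^1 function whose
    derivative is 2-Lipschitz. *)
Lemma maxr0_sqr_expansion (r h : R) :
  `|Num.max (h + r) 0 ^+ 2 - Num.max r 0 ^+ 2 - 2 * h * Num.max r 0| <= h ^+ 2.
Proof.
rewrite ler_norml; case: (leP (h + r) 0) => a0; case: (leP r 0) => b0.
- by rewrite expr0n/= mulr0 !subr0 oppr_le0 sqr_ge0.
- by apply/andP; split; nra.
- by apply/andP; split; nra.
- by apply/andP; split; nra.
Qed.

Lemma is_derive_maxr0_sqr (c r : R) :
  is_derive r (1 : R) (fun s : R => c * Num.max s 0 ^+ 2 : R) (c * (2 * Num.max r 0)).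
Proof.
have lim : h^-1 *: ((c * Num.max (h *: 1 + r) 0 ^+ 2) - c * Num.max r 0 ^+ 2 : R) @[h --> (0 : R)^'] --> c * (2 * Num.max r 0).
  apply: (@cvg_dist_le _ _ _ _ _ _ _ (fun h => `|c| * `|h|)).
    near=> h; have h0 : h != 0 by near: h; exact: nbhs_dnbhs_neq.
    rewrite /GRing.scale/= mulr1.
    have -> : h^-1 * (c * Num.max (h + r) 0 ^+ 2 - c * Num.max r 0 ^+ 2) - c * (2 * Num.max r 0) =
      c * (h^-1 * (Num.max (h + r) 0 ^+ 2 - Num.max r 0 ^+ 2 - 2 * h * Num.max r 0)) by field.
    rewrite normrM ler_wpM2l// normrM normfV ler_pdivrMl ?normr_gt0//.
    by rewrite (le_trans (maxr0_sqr_expansion _ _))// -normrM -expr2 ler_norm.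
  have z : `|h| @[h --> (0 : R)^'] --> `|0 : R|.
    by apply: cvg_norm; apply: cvg_within_filter; exact: cvg_id.
  rewrite normr0 in z.
  have cz : `|c| * `|h| @[h --> (0 : R)^'] --> `|c| * 0.
    by apply: cvgM; [exact: cvg_cst|exact: z].
  by rewrite mulr0 in cz.
apply: DeriveDef; last exact: (cvg_lim _ lim).
by apply/cvg_ex; eexists; exact: lim.
Unshelve. all: by end_near. Qed.

(** The point 0 is negligible: the drift of a mild solution is controlled only at
    positive times. *)
Lemma Rintegral_obnd_eq (t : R) (f g : R -> R) : measurable_fun `]0, t] f ->
  (forall u, 0 < u <= t -> f u = g u) ->
  \int[@lebesgue_measure R]_(u in `[0, t]) f u = \int[@lebesgue_measure R]_(u in `[0, t]) g u.
Proof.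
move=> mf fg; have fgE u : u \in `]0, t]%classic -> (f u)%:E = (g u)%:E.
  by rewrite inE/= in_itv/= => ?; rewrite fg.
have mg : measurable_fun `]0, t] g.
  by apply: eq_measurable_fun mf => u hu; have [] := fgE u hu.
rewrite /Rintegral -integral_itv_obnd_cbnd; last exact/measurable_EFinP.
rewrite -[in RHS]integral_itv_obnd_cbnd; last exact/measurable_EFinP.
by congr fine; exact: eq_integral.
Qed.
End posp.

Section affine_sqr.
Context {R : realType} {X : normedModType R} (ip : {dot X for @idfun R}).
Hypothesis ip_norm : forall u : X, ip u u = `|u| ^+ 2.
Variables (phi : X) (lambda : R).

(** F(z) = cutoff(z)^2 / (2 lambda) has gradient (cutoff(z) / lambda) phi.  On the
    half-space <phi, z> <= 0 the factor cutoff(z) / lambda lies in [0, 1], and it is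
    1 exactly on the boundary hyperplane. *)
Definition cutoff (z : X) : R := Num.max (lambda + ip phi z) 0.

Lemma cutoff_lipschitz z w : `|cutoff z - cutoff w| <= `|phi| * `|z - w|.
Proof.
rewrite (le_trans (maxr0_lipschitz _ _))// opprD addrACA subrr add0r -ipBr.
exact: (cauchy_schwarz ip_norm).
Qed.

Lemma cutoff_continuous : continuous cutoff.
Proof.
move=> z; apply: (@cvg_dist_le _ _ _ _ _ _ _ (fun w => `|phi| * `|w - z|)).
  by near=> w; exact: cutoff_lipschitz.
have h : `|w - z| @[w --> z] --> `|z - z|.
  by apply: cvg_norm; apply: cvgB; [exact: cvg_id|exact: cvg_cst].
rewrite subrr normr0 in h.
have cz : `|phi| * `|w - z| @[w --> z] --> `|phi| * 0.
  by apply: cvgM; [exact: cvg_cst|exact: h].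
by rewrite mulr0 in cz.
Unshelve. all: by end_near. Qed.

Lemma cutoff_sqr_diff (c : R) (z : X) :
  let F := (fun w => c * cutoff w ^+ 2) : X -> R^o in
  differentiable F z /\ forall h, 'd F z h = ip ((c * 2 * cutoff z) *: phi) h.
Proof.
have lin : linear (ip phi : X -> R^o) by move=> a u v; rewrite ipDr ipZr.
pose linM := GRing.isLinear.Build _ _ _ _ _ lin.
pose L : {linear X -> R^o} := HB.pack (ip phi : X -> R^o) linM.
have cL : continuous L.
  by move=> u; apply: (cvg_ip ip_norm); [exact: cvg_cst|exact: cvg_id].
have dL : differentiable L z by exact: linear_differentiable.
pose G : X -> R^o := cst (lambda : R^o) + L.
have dG : differentiable G z by apply: differentiableD => //; exact: differentiable_cst.
have dGE h : 'd G z h = ip phi h.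
  by rewrite /G (diffD (differentiable_cst _ _) dL) diff_cst diff_lin//= add0r.
have dg := is_derive_maxr0_sqr c (G z).
pose g : R^o -> R^o := fun s : R => c * Num.max s 0 ^+ 2.
have dgd : differentiable g (G z) by apply/derivable1_diffP; exact: (@ex_derive _ _ _ _ _ _ _ dg).
have FE : (fun w => c * cutoff w ^+ 2 : R^o) = g \o G by [].
rewrite /= FE; split; first exact: differentiable_comp.
move=> h; rewrite diff_comp//= dGE diff1E// derive1E.
have -> : 'D_1 g (G z) = c * (2 * Num.max (G z) 0) by exact: (@derive_val _ _ _ _ _ _ _ dg).
by rewrite ipZl /GRing.scale/= -mulrA mulrC.
Qed.

End affine_sqr.

(** * Self-adjoint semigroups *)

Lemma npow0_graph (R : realType) (X : normedModType R) (A : operator X)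
    (S : R -> {linear X -> X}) (u v : X) : power_graph A S 0 u v <-> v = u.
Proof.
rewrite /power_graph truncn0 /=; split.
  by move=> [w [-> ]]; rewrite /fracpow_graph subrr eqxx.
by move=> ->; exists u; split => //; rewrite /fracpow_graph subrr eqxx.
Qed.

Lemma npow1_graph (R : realType) (X : normedModType R) (A : operator X)
    (S : R -> {linear X -> X}) (u v : X) : power_graph A S 1 u v <-> dom A u /\ v = - A u.
Proof.
rewrite /power_graph truncn1 /=; split.
  by move=> [w [[du ->]]]; rewrite /fracpow_graph subrr eqxx/= => ->.
by move=> [du ->]; exists (- A u); split => //; rewrite /fracpow_graph subrr eqxx.
Qed.

Lemma xget_unique (T : choiceType) (x0 v : T) (P : set T) :
  P v -> (forall w, P w -> w = v) -> xget x0 P = v.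
Proof.
by move=> Pv Pu; case: xgetP => [w _ /Pu//|/(_ v)/(_ Pv)].
Qed.

Section self_adjoint_semigroup.
Context {R : realType} {X : normedModType R} (ip : {dot X for @idfun R}).
Hypothesis ip_norm : forall u : X, ip u u = `|u| ^+ 2.
Variables (A : operator X) (S : R -> {linear X -> X}).
Hypothesis A_linear : linear_operator A.
Hypothesis A_self_adjoint : self_adjoint ip A.
Hypothesis A_nonpositive : nonpositive ip A.
Hypothesis S_C0 : C0_semigroup S.
Hypothesis A_generates : generates A S.
Hypothesis S_estimates : semigroup_estimates A S.
Notation mu := (@lebesgue_measure R).

Lemma npow0 u : npow A S 0 u = u.
Proof.
by apply: xget_unique => [|w]; rewrite /= npow0_graph.
Qed.

Lemma Xdom0 u : Xdom A S 0 u.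
Proof. by exists u; rewrite npow0_graph. Qed.

Lemma Xnorm0 u : Xnorm A S 0 u = 2 * `|u|.
Proof. by rewrite /Xnorm npow0; ring. Qed.

Lemma Xdom1 u : Xdom A S 1 u <-> dom A u.
Proof.
by split=> [[v /npow1_graph[]//]|du]; exists (- A u); rewrite npow1_graph.
Qed.

Lemma npow1 u : dom A u -> npow A S 1 u = - A u.
Proof.
by move=> du; apply: xget_unique => [|w] /=; rewrite npow1_graph// => -[].
Qed.

Lemma norm_le_Xnorm z u : `|u| <= Xnorm A S z u.
Proof. by rewrite /Xnorm lerDl. Qed.

Lemma S0 u : S 0 u = u. Proof. by case: S_C0. Qed.
Lemma SD s t u : 0 <= s -> 0 <= t -> S (s + t) u = S s (S t u).
Proof. by case: S_C0 => _ _ + _; apply. Qed.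
Lemma S_continuous t : 0 <= t -> continuous (S t).
Proof. by case: S_C0 => + _ _ _; apply. Qed.

(** The smoothing estimate with both exponents equal to 0. *)
Lemma S_bounded T : 0 < T ->
  exists2 M, 0 < M & forall t u, 0 <= t <= T -> `|S t u| <= M * `|u|.
Proof.
move=> T0; have [/(_ 0 0 (lexx 0) (lexx 0)) h _] := S_estimates T0.
have {h}[|M M0 hM] := h; first by rewrite ltr0n.
exists (M + 1) => [|t u /andP[t0 tT]]; first by rewrite addr_gt0.
have [->|tn0] := eqVneq t 0; first by rewrite S0 ler_peMl// lerDr ltW.
have {}t0 : 0 < t by rewrite lt0r tn0.
have t0T : 0 < t <= T by rewrite t0.
have [_] := hM t u t0T (Xdom0 u).
rewrite !Xnorm0 oppr0 addr0 powRr0 mulr1 mulrCA ler_pM2l// => /le_trans; apply.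
by rewrite ler_wpM2r// lerDl.
Qed.

Let nearE0 (f : R -> X) (v : X) (e : R) : f h @[h --> 0^'+] --> v -> 0 < e ->
  exists2 d, 0 < d & forall h, 0 < h < d -> `|f h - v| < e.
Proof.
move=> /cvgrPdist_lt h e0; have [d /= d0 hd] := h _ e0.
exists d => // t /andP[t0 td]; rewrite distrC; apply: hd => //=.
by rewrite sub0r normrN gtr0_norm.
Qed.

Lemma S_cvg0 u (e : R) : 0 < e ->
  exists2 d, 0 < d & forall h, 0 <= h < d -> `|S h u - u| < e.
Proof.
move=> e0; have [d d0 hd] : exists2 d, 0 < d & forall h, 0 < h < d -> `|S h u - u| < e.
  by apply: nearE0 => //; case: S_C0.
exists d => // h /andP[h0 hd']; have [->|hn0] := eqVneq h 0.
  by rewrite S0 subrr normr0.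
by apply: hd; rewrite lt0r hn0 h0.
Qed.

Lemma S_dist (T M : R) : (forall t u, 0 <= t <= T -> `|S t u| <= M * `|u|) ->
  forall s t u, 0 <= s <= T -> 0 <= t <= T ->
  `|S s u - S t u| <= M * `|S `|s - t| u - u|.
Proof.
move=> hM s t u; wlog st : s t / t <= s => [hw sT tT|/andP[s0 sT] /andP[t0 tT]].
  by have [ts|st] := leP t s; [exact: hw | rewrite distrC [`|s - t|]distrC hw// ltW].
have -> : S s u = S t (S (s - t) u).
  by rewrite -SD ?subr_ge0// addrC subrK.
rewrite ger0_norm ?subr_ge0//.
by rewrite -linearB hM// t0.
Qed.

Lemma continuous_S u : continuous (fun t : R => S (Num.max t 0) u).
Proof.
move=> t; set t' := Num.max t 0.
have t'0 : 0 <= t' by rewrite le_max lexx orbT.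
have [M M0 hM] : exists2 M, 0 < M & forall s v, 0 <= s <= t' + 1 -> `|S s v| <= M * `|v|.
  by apply: S_bounded; rewrite ltr_wpDl.
apply/cvgrPdist_lt => e e0.
have [d d0 hd] := S_cvg0 u (divr_gt0 e0 M0).
have clamp : (Num.max s 0 @[s --> t] --> t') by exact: continuous_clamp.
have c1 : \forall s \near t, `|t' - Num.max s 0| < d by move/cvgrPdist_lt: clamp; apply.
have c2 : \forall s \near t, `|t' - Num.max s 0| < 1 by move/cvgrPdist_lt: clamp; apply.
near=> s; have s1 : `|t' - Num.max s 0| < d by near: s.
have s2 : `|t' - Num.max s 0| < 1 by near: s.
rewrite -/t'; apply: le_lt_trans (S_dist hM _ _ _) _.
- by rewrite t'0/= lerDl.
- rewrite le_max lexx orbT/=; move: s2; rewrite ltr_norml => /andP[+ _].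
  by move=> ?; lra.
by rewrite mulrC -ltr_pdivlMr// hd// normr_ge0.
Unshelve. all: by end_near. Qed.

Lemma domA_S_comm t u : 0 <= t -> dom A u -> dom A (S t u) /\ A (S t u) = S t (A u).
Proof.
move=> t0 du; apply/A_generates.
have /A_generates h : dom A u /\ A u = A u by [].
have hS : S t (h^-1 *: (S h u - u)) @[h --> 0^'+] --> S t (A u).
  have hc : S t x @[x --> A u] --> S t (A u) by exact: S_continuous.
  exact: (@continuous_cvg _ _ _ _ _ _ _ _ hc h).
apply: cvg_trans hS; apply: near_eq_cvg; near=> r.
have r0 : 0 < r by near: r; exact: nbhs_right_gt.
by rewrite linearZ linearB -!SD ?(ltW r0)// [t + r]addrC.
Unshelve. all: by end_near. Qed.

Lemma domA_S t u : 0 <= t -> dom A u -> dom A (S t u).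
Proof. by move=> t0 du; have [] := domA_S_comm t0 du. Qed.

Lemma A_S t u : 0 <= t -> dom A u -> A (S t u) = S t (A u).
Proof. by move=> t0 du; have [] := domA_S_comm t0 du. Qed.

(** The generator provides right derivatives.  For h < 0 the quotient at s is
    S(s + h) applied to the right quotient at 0 with increment |h|, and local
    boundedness of S transfers the limit. *)
Lemma S_quotient_cvg (s : R) (u : X) : 0 < s -> dom A u ->
  h^-1 *: (S (Num.max (s + h) 0) u - S s u) @[h --> 0^'] --> S s (A u).
Proof.
move=> s0 du.
have [M M0 hM] : exists2 M, 0 < M & forall t v, 0 <= t <= s + 1 -> `|S t v| <= M * `|v|.
  by apply: S_bounded; rewrite addr_gt0.
have /A_generates hA : dom A u /\ A u = A u by [].
apply/cvgrPdist_lt => e e0.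
have e2 : 0 < e / 2 by rewrite divr_gt0.
have [d1 d10 h1] := nearE0 hA (divr_gt0 e2 M0).
have [d2 d20 h2] : exists2 d, 0 < d & forall r, `|s - r| < d -> `|S s (A u) - S (Num.max r 0) (A u)| < e / 2.
  have := @continuous_S (A u) s; rewrite /continuous_at max_l ?(ltW s0)// => /cvgrPdist_lt/(_ _ e2)[d /= d0 hd].
  by exists d => // r; exact: hd.
near=> h.
have h0 : h != 0 by near: h; exact: nbhs_dnbhs_neq.
have hs : `|h| < s by near: h; apply: dnbhs0_lt.
have hd1 : `|h| < d1 by near: h; apply: dnbhs0_lt.
have hd2 : `|h| < d2 by near: h; apply: dnbhs0_lt.
have hone : `|h| < 1 by near: h; apply: dnbhs0_lt.
have hs' : 0 <= s + h by move: hs; rewrite ltr_norml => /andP[? _]; lra.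
pose r := if 0 < h then s else s + h.
have r0 : 0 <= r by rewrite /r; case: ifP => // _; exact: ltW.
have -> : h^-1 *: (S (Num.max (s + h) 0) u - S s u) = S r (`|h|^-1 *: (S `|h| u - u)).
  rewrite max_l// /r; case: ltgtP h0 => // h0 _.
  - by rewrite gtr0_norm// SD ?ltW// -linearB -linearZ.
  - have -> : S s u = S (s + h) (S (- h) u) by rewrite -SD ?oppr_ge0 ?(ltW h0)// addrK.
    by rewrite ltr0_norm// -linearB -linearZ invrN scaleNr -scalerN opprB.
rewrite -(subrK (S r (A u)) (S s (A u))) -addrA (le_lt_trans (ler_normD _ _))//.
rewrite [e]splitr ltrD//.
  rewrite -(max_l r0); apply: h2; rewrite /r; case: ifP => _; first by rewrite subrr normr0.
  by rewrite opprD addNKr normrN.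
rewrite -linearB (le_lt_trans (hM _ _ _))//.
  rewrite r0/= /r; case: ifP => _; first by rewrite lerDl.
  by rewrite lerD2l ltW// (le_lt_trans (ler_norm _)).
by rewrite mulrC -ltr_pdivlMr// distrC h1// hd1 normr_gt0 h0.
Unshelve. all: by end_near. Qed.

Let is_derive_quotient (f : R -> R) (s d : R) :
  h^-1 * (f (s + h) - f s) @[h --> 0^'] --> d -> is_derive s (1 : R) f d.
Proof.
move=> h; have h' : h^-1 *: ((f \o shift s) (h *: (1 : R)) - f s) @[h --> 0^'] --> d.
  apply: cvg_trans h; apply: near_eq_cvg; near=> r.
  by rewrite /GRing.scale/= mulr1 [r + s]addrC.
split; first by apply/cvg_ex; exists d.
exact: cvg_lim h'.
Unshelve. all: by end_near. Qed.

Lemma is_derive_ipS (s : R) (u v : X) : 0 < s -> dom A u ->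
  is_derive s (1 : R) (fun t => ip (S (Num.max t 0) u) v) (ip (S s (A u)) v).
Proof.
move=> s0 du; apply: is_derive_quotient.
have h : ip (h^-1 *: (S (Num.max (s + h) 0) u - S s u)) v @[h --> 0^'] --> ip (S s (A u)) v.
  by apply: (cvg_ip ip_norm); [exact: S_quotient_cvg | exact: cvg_cst].
apply: cvg_trans h; apply: near_eq_cvg; near=> r.
by rewrite ipZl ipBl (max_l (ltW s0)).
Unshelve. all: by end_near. Qed.

Lemma continuous_ipS u v : continuous (fun t : R => ip (S (Num.max t 0) u) v).
Proof.
move=> t; apply: (cvg_ip ip_norm); last exact: cvg_cst.
exact: continuous_S.
Qed.

Lemma A_symmetric u v : dom A u -> dom A v -> ip (A u) v = ip u (A v).
Proof.
by move=> du dv; have [_ /(_ v (A v))[/(_ (conj dv erefl)) h _]] := A_self_adjoint; exact: h.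
Qed.

(** The function r |-> <S(r) u, S(t - r) v> has derivative
    <S(r) A u, S(t - r) v> - <S(r) u, S(t - r) A v> = 0. *)
Let S_symmetric_dom t u v : 0 < t -> dom A u -> dom A v ->
  ip (S t u) v = ip u (S t v).
Proof.
move=> t0 du dv.
pose p (r : R) := ip (S (Num.max r 0) u) (S (Num.max (t - r) 0) v).
have cp : continuous p.
  move=> r; apply: (cvg_ip ip_norm); first exact: continuous_S.
  apply: (@continuous_comp R R X (fun r => t - r) (fun r => S (Num.max r 0) v)).
    by apply: cvgB; [exact: cvg_cst | exact: cvg_id].
  exact: continuous_S.
have dp (r : R) : r \in `]0, t[ -> is_derive r (1 : R) p 0.
  rewrite in_itv/= => /andP[r0 rt]; have tr0 : 0 < t - r by rewrite subr_gt0.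
  apply: is_derive_quotient.
  have q1 := S_quotient_cvg r0 du.
  have q2 : h^-1 *: (S (Num.max (t - r - h) 0) v - S (t - r) v) @[h --> 0^'] --> - S (t - r) (A v).
    have q := S_quotient_cvg tr0 dv.
    have /cvgN : (- h)^-1 *: (S (Num.max (t - r - h) 0) v - S (t - r) v) @[h --> 0^'] --> S (t - r) (A v).
      have nN : (- h : R) @[h --> 0^'] --> 0^'.
        move=> B [d /= d0 hd]; exists d => // h /=; rewrite sub0r normrN => hd' h0.
        by apply: hd; rewrite /= ?sub0r ?opprK ?oppr_eq0.
      exact: (cvg_comp _ _ nN q).
    apply: cvg_trans; apply: near_eq_cvg; near=> h.
    by rewrite fctE /= invrN scaleNr opprK.
  have c1 : S (Num.max (t - r - h) 0) v @[h --> 0^'] --> S (t - r) v.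
    have c : continuous (fun h : R => S (Num.max (t - r - h) 0) v).
      move=> w; apply: (@continuous_comp R R X (fun h => t - r - h) (fun r => S (Num.max r 0) v)).
        by apply: cvgB; [exact: cvg_cst | exact: cvg_id].
      exact: continuous_S.
    have := c 0; rewrite /continuous_at subr0 (max_l (ltW tr0)).
    by apply: cvg_trans; apply: cvg_app; exact: cvg_within.
  have h1 : ip (h^-1 *: (S (Num.max (r + h) 0) u - S r u)) (S (Num.max (t - r - h) 0) v)
      @[h --> 0^'] --> ip (S r (A u)) (S (t - r) v) by exact: cvg_ip.
  have h2 : ip (S r u) (h^-1 *: (S (Num.max (t - r - h) 0) v - S (t - r) v))
      @[h --> 0^'] --> ip (S r u) (- S (t - r) (A v)).
    by apply: (cvg_ip ip_norm) => //; exact: cvg_cst.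
  rewrite [X in _ --> X](_ : 0 = ip (S r (A u)) (S (t - r) v) + ip (S r u) (- S (t - r) (A v))); last first.
    rewrite ipNr -!A_S ?ltW// A_symmetric ?subrr//; apply: domA_S => //; exact: ltW.
  apply: cvg_trans (cvgD h1 h2); apply: near_eq_cvg; near=> h.
  rewrite fctE /= /p ipZl ipZr /= ipBl ipBr (max_l (ltW r0)) (max_l (ltW tr0)).
  by rewrite opprD addrA; ring.
have [c ct] := @MVT _ p (cst 0) 0 t t0 dp (continuous_subspaceT cp).
rewrite /cst mul0r => /eqP; rewrite subr_eq0 => /eqP.
by rewrite /p maxxx subr0 subrr maxxx !S0 (max_l (ltW t0)).
Unshelve. all: by end_near. Qed.

Let bilinear_dense (B : X -> X -> R) (M : R) : 0 < M ->
  (forall u v w, B (u - v) w = B u w - B v w) ->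
  (forall u v w, B w (u - v) = B w u - B w v) ->
  (forall u v, `|B u v| <= M * (`|u| * `|v|)) ->
  (forall u v, dom A u -> dom A v -> B u v = 0) -> forall u v, B u v = 0.
Proof.
move=> M0 Bl Br BM B0.
have dense_dom : dense (dom A) by case: A_self_adjoint.
suff h u v : dom A u -> B u v = 0.
  move=> u v; apply/eqP/negPn/negP; rewrite -normr_gt0 => h0.
  have e0 : 0 < `|B u v| / (M * (`|v| + 1)).
    by rewrite divr_gt0// mulr_gt0// ltr_wpDl.
  have [a da ua] := dense_approx u dense_dom e0.
  have : `|B u v| < `|B u v|; last by rewrite ltxx.
  rewrite -[X in `|X| < _](subr0) -(h a v da) -Bl (le_lt_trans (BM _ _))//.
  rewrite ltr_pdivlMr ?mulr_gt0 ?ltr_wpDl// in ua.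
  by apply: le_lt_trans ua; rewrite mulrCA ler_wpM2l// ler_wpM2l ?(ltW M0)// lerDl.
move=> du; apply/eqP/negPn/negP; rewrite -normr_gt0 => h0.
have e0 : 0 < `|B u v| / (M * (`|u| + 1)).
  by rewrite divr_gt0// mulr_gt0// ltr_wpDl.
have [a da va] := dense_approx v dense_dom e0.
have : `|B u v| < `|B u v|; last by rewrite ltxx.
rewrite -[X in `|X| < _](subr0) -(B0 u a du da) -Br (le_lt_trans (BM _ _))//.
rewrite ltr_pdivlMr ?mulr_gt0 ?ltr_wpDl// in va.
apply: le_lt_trans va; rewrite [`|u| * _]mulrC mulrCA ler_wpM2l// ler_wpM2l ?(ltW M0)//.
by rewrite lerDl.
Qed.

Lemma S_symmetric t u v : 0 <= t -> ip (S t u) v = ip u (S t v).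
Proof.
rewrite le_eqVlt => /predU1P[<-|t0]; first by rewrite !S0.
have [M M0 hM] := S_bounded t0.
apply/eqP; rewrite -subr_eq0; apply/eqP.
apply: (@bilinear_dense (fun u v => ip (S t u) v - ip u (S t v)) (M + M)).
- by rewrite addr_gt0.
- by move=> a b w; rewrite linearB !ipBl; ring.
- by move=> a b w; rewrite (raddfB (S t)) !ipBr; ring.
- move=> a b; rewrite (le_trans (ler_normB _ _))// mulrDl lerD//.
    rewrite (le_trans (cauchy_schwarz ip_norm _ _))// mulrA ler_wpM2r//.
    by rewrite hM// lexx ltW.
  rewrite (le_trans (cauchy_schwarz ip_norm _ _))// mulrCA ler_wpM2l//.
  by rewrite hM// lexx ltW.
- by move=> a b da db; rewrite S_symmetric_dom// subrr.
Qed.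

Lemma S_half t u : 0 <= t -> ip (S t u) u = `|S (t / 2) u| ^+ 2.
Proof.
move=> t0; by rewrite {1}[t]splitr SD ?divr_ge0// S_symmetric ?divr_ge0// ip_norm.
Qed.

(** The signs come from <S(t) u, u> = |S(t/2) u|^2, from
    <S(t) A u, u> = <A S(t/2) u, S(t/2) u> and from the first formula at A u. *)
Lemma semigroup_profile u : dom A u ->
  convex_profile (fun t => ip (S (Num.max t 0) u) u)
                 (fun t => ip (S (Num.max t 0) (A u)) u)
                 (fun t => ip (S (Num.max t 0) (A u)) (A u)).
Proof.
move=> du; split; try exact: continuous_ipS.
- move=> t t0; split.
    by have := is_derive_ipS u t0 du; rewrite -{2}(max_l (ltW t0)).
  have h := is_derive_ipS (A u) t0 du.
  rewrite (_ : (fun t => _) = (fun t => ip (S (Num.max t 0) u) (A u))); last first.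
    apply/funext => r; rewrite S_symmetric ?le_max ?lexx ?orbT// ipC//.
  by move: h; rewrite -{2}(max_l (ltW t0)).
- move=> t t0; rewrite (max_l t0); split.
  + by rewrite S_half// sqr_ge0.
  + have t2 : 0 <= t / 2 by rewrite divr_ge0.
    rewrite [t]splitr SD// S_symmetric// -A_S//.
    by apply: A_nonpositive; exact: domA_S.
  + by rewrite S_half// sqr_ge0.
Qed.

Lemma ip_domA_MVT phi u h : 0 < h -> dom A u -> exists2 c, 0 < c < h &
  ip phi (S h u - u) = h * ip phi (A (S c u)).
Proof.
move=> h0 du; pose f (t : R) := ip (S (Num.max t 0) u) phi.
have df (t : R) : t \in `]0, h[ -> is_derive t (1 : R) f (ip (S t (A u)) phi).
  by rewrite in_itv/= => /andP[t0 _]; apply: is_derive_ipS.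
have cf : {within `[0, h], continuous f}.
  by apply: continuous_subspaceT => t; exact: continuous_ipS.
have [c] := @MVT _ f (fun t => ip (S t (A u)) phi) 0 h h0 df cf.
rewrite in_itv/= => /andP[c0 ch]; rewrite /f maxxx S0 (max_l (ltW h0)) subr0 => E.
exists c; first by rewrite c0.
by rewrite ipC ipBl E A_S ?(ltW c0)// [ip phi _]ipC mulrC.
Qed.

(** * Fractional powers *)

Lemma domA_lin a u v : dom A u -> dom A v -> dom A (a *: u + v).
Proof. by move=> du dv; have [_ /(_ a u v du dv)[]] := A_linear. Qed.
Lemma A_lin a u v : dom A u -> dom A v -> A (a *: u + v) = a *: A u + A v.
Proof. by move=> du dv; have [_ /(_ a u v du dv)[]] := A_linear. Qed.
Lemma domAD u v : dom A u -> dom A v -> dom A (u + v).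
Proof. by move=> du dv; rewrite -[u]scale1r; exact: domA_lin. Qed.
Lemma AD u v : dom A u -> dom A v -> A (u + v) = A u + A v.
Proof. by move=> du dv; rewrite -{1}[u]scale1r A_lin// scale1r. Qed.
Lemma domAB u v : dom A u -> dom A v -> dom A (u - v).
Proof. by move=> du dv; rewrite addrC -scaleN1r; exact: domA_lin. Qed.
Lemma AB u v : dom A u -> dom A v -> A (u - v) = A u - A v.
Proof. by move=> du dv; rewrite addrC -scaleN1r A_lin// scaleN1r addrC. Qed.

Definition balakrishnan_weight (a : R) (u z : X) (t : R) : R :=
  pospow (- a - 1) t * ip (u - S (Num.max t 0) u) z.

(** Balakrishnan's formula tested against every vector, which replaces the Bochner
    integral by integrals of real functions. *)
Definition weak_power (a : R) (u v : X) : Prop :=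
  dom A u /\ forall z,
    mu.-integrable setT (fun t => (balakrishnan_weight a u z t)%:E) /\
    \int[mu]_t (balakrishnan_weight a u z t) = balakrishnan_cst a * ip v z.

Lemma measurable_balakrishnan_weight a u z :
  measurable_fun setT (balakrishnan_weight a u z).
Proof.
apply: measurable_funM; first exact: measurable_pospow.
apply: continuous_measurableR => t; apply: (cvg_ip ip_norm); last exact: cvg_cst.
by apply: cvgB; [exact: cvg_cst | exact: continuous_S].
Qed.

Lemma balakrishnan_weak a u v : balakrishnan A S a u v -> weak_power a u v.
Proof.
move=> [du h]; split => // z.
pose D : set R := `]0%R, +oo[%classic.
have mD : measurable D by exact: measurable_itv.
have inD t : (t \in D) = (0 < t) by rewrite mem_setE in_itv/= andbT.
have mw : measurable_fun D (fun t => ip (t `^ (- a - 1) *: (u - S t u)) z).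
  apply: (eq_measurable_fun (balakrishnan_weight a u z)).
    move=> t; rewrite inD => t0.
    by rewrite /balakrishnan_weight pospowE// ipZl (max_l (ltW t0)).
  by apply: measurable_funTS; exact: measurable_balakrishnan_weight.
have [int_f val_f] := bochner_pairing ip_norm mD mw h.
have patched : (fun t => (balakrishnan_weight a u z t)%:E) =
    (fun t => (ip (t `^ (- a - 1) *: (u - S t u)) z)%:E) \_ D.
  apply/funext => t; rewrite patchE inD /balakrishnan_weight /pospow.
  by case: ifPn => t0; rewrite ?mul0r// ipZl (max_l (ltW t0)).
split; last by rewrite -ipZl -val_f /Rintegral patched -integral_mkcond.
rewrite patched; apply/integrable_restrict => //.
by rewrite setTI.
Qed.

Lemma balakrishnan_weightC a u z t :
  balakrishnan_weight a u z t = balakrishnan_weight a z u t.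
Proof.
rewrite /balakrishnan_weight !ipBl S_symmetric ?le_max ?lexx ?orbT//.
by rewrite [ip u z]ipC [ip u (S _ z)]ipC.
Qed.

(** By symmetry of S the integrands of the two tested formulas coincide. *)
Lemma weak_power_symmetric a u v z w : 0 < a < 1 ->
  weak_power a u v -> weak_power a z w -> ip v z = ip u w.
Proof.
move=> a01 [_ /(_ z)[_ h1]] [_ /(_ u)[_ h2]].
have c0 := balakrishnan_cst_gt0 a01.
apply: (mulfI (lt0r_neq0 c0)); rewrite -h1 [ip u w]ipC -h2.
by congr Rintegral; apply/funext => t; rewrite balakrishnan_weightC.
Qed.

Lemma weak_power_S a u v s : 0 <= s -> weak_power a u v ->
  weak_power a (S s u) (S s v).
Proof.
move=> s0 [du h]; split; first exact: domA_S.
move=> z; have := h (S s z).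
have -> : balakrishnan_weight a u (S s z) = balakrishnan_weight a (S s u) z.
  apply/funext => t; rewrite /balakrishnan_weight -S_symmetric//; congr (_ * ip _ z).
  by rewrite linearB -!SD ?le_max ?lexx ?orbT// [s + _]addrC.
by rewrite -S_symmetric.
Qed.

Lemma semigroup_second_difference y t s : 0 <= t -> 0 <= s ->
  second_difference (fun t => ip (S (Num.max t 0) y) y) t s =
  ip (y - S t y) (y - S s y).
Proof.
move=> t0 s0; rewrite /second_difference maxxx S0 !max_l ?addr_ge0//.
rewrite SD// ipBl !ipBr [ip (S t (S s y)) y]S_symmetric// [ip y (S s y)]ipC.
by rewrite [ip (S s y) (S t y)]ipC; ring.
Qed.

Lemma ip_polar (p q p' q' : X) :
  ip (p + q) (p' + q') - ip (p - q) (p' - q') = 2 * (ip p q' + ip q p').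
Proof. by rewrite !ipBl !ipDl !ipBr !ipDr; ring. Qed.

(** I - S(t) and I - S(s) are symmetric and commute. *)
Lemma ip_increment_swap t s y z : 0 <= t -> 0 <= s ->
  ip (y - S t y) (z - S s z) = ip (y - S s y) (z - S t z).
Proof.
move=> t0 s0; rewrite !ipBl !ipBr !S_symmetric// -!SD// [s + t]addrC; ring.
Qed.

(** The formula for u is tested against w, and inside it the formula for u' is
    tested against u - S(t) u.  This is an iterated integral of
    <u - S(t) u, u' - S(s) u'>, which polarisation over u + u' and u - u' writes as
    the difference of two iterated integrals of second differences. *)
Lemma weak_power_mul a b u v u' w : 0 < a -> 0 < b -> a + b = 1 ->
  weak_power a u v -> weak_power b u' w -> ip v w = ip u (- A u').
Proof.
move=> a0 b0 ab [du /(_ w)[iv hv]] [du' hw].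
have ca := @balakrishnan_cst_gt0 R a _; have cb := @balakrishnan_cst_gt0 R b _.
have {}ca : 0 < balakrishnan_cst a by apply: ca; rewrite a0 -ab ltrDl.
have {}cb : 0 < balakrishnan_cst b by apply: cb; rewrite b0 -ab ltrDr.
have b01 : 0 < b < 1 by rewrite b0 -ab ltrDr.
have dp := domAD du du'; have dm := domAB du du'.
have kp := semigroup_profile dp; have km := semigroup_profile dm.
have [ip_ vp] := profile_iterated_integral kp a0 b0 ab.
have [im_ vm] := profile_iterated_integral km a0 b0 ab.
have split_weight t : 4 * (balakrishnan_cst b * balakrishnan_weight a u w t) =
    pospow (- a - 1) t * \int[mu]_s (pospow (- b - 1) s *
      second_difference (fun t => ip (S (Num.max t 0) (u + u')) (u + u')) t s) -
    pospow (- a - 1) t * \int[mu]_s (pospow (- b - 1) s *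
      second_difference (fun t => ip (S (Num.max t 0) (u - u')) (u - u')) t s).
  rewrite /balakrishnan_weight; have [t0|t0] := leP t 0.
    by rewrite pospow_le0// !mul0r !mulr0 subrr.
  rewrite -mulrBr -RintegralB//; last 2 first.
  - have hp := integrable_second_difference kp b01 (ltW t0); exact: hp.
  - have hm := integrable_second_difference km b01 (ltW t0); exact: hm.
  transitivity (pospow (- a - 1) t * (4 * (balakrishnan_cst b * ip w (u - S t u)))).
    by rewrite [ip w _]ipC; ring.
  congr (_ * _).
  have [int_w <-] := hw (u - S t u).
  rewrite -RintegralZl//; congr Rintegral; apply/funext => s.
  rewrite /balakrishnan_weight; have [s0|s0] := leP s 0.
    by rewrite pospow_le0// !mul0r mulr0 subrr.
  rewrite -mulrBr mulrCA; congr (_ * _).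
  rewrite !semigroup_second_difference ?(ltW s0) ?(ltW t0)//.
  have incD r : u + u' - S r (u + u') = (u - S r u) + (u' - S r u').
    by rewrite (raddfD (S r)) opprD addrACA.
  have incB r : u - u' - S r (u - u') = (u - S r u) - (u' - S r u').
    by rewrite (raddfB (S r)) !opprD !opprK addrACA.
  rewrite !incD !incB ip_polar.
  rewrite [ip (u' - S t u') (u - S s u)]ip_increment_swap ?(ltW s0) ?(ltW t0)//.
  rewrite [ip (u - S t u) (u' - S s u')]ipC; ring.
apply: (mulfI (lt0r_neq0 ca)); rewrite -hv.
have E : \int[mu]_t (4 * balakrishnan_cst b * balakrishnan_weight a u w t) =
    balakrishnan_cst a * balakrishnan_cst b *
      (- ip (A (u + u')) (u + u') - - ip (A (u - u')) (u - u')).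
  under [in LHS]eq_fun do rewrite -mulrA split_weight.
  rewrite RintegralB//.
  by rewrite vp vm maxxx !S0 mulrBr.
move: E; rewrite RintegralZl//.
rewrite opprK [- _ + _]addrC -opprB AD// AB// ip_polar.
rewrite (A_symmetric du du') [ip (A u') u]ipC ipNr => h.
apply: (mulfI (lt0r_neq0 cb)); apply: (@mulfI _ 4); first by rewrite pnatr_eq0.
by rewrite mulrA h; ring.
Qed.

Lemma powR_continuous (b t : R) : 0 < t -> {for t, continuous (fun t : R => t `^ b)}.
Proof.
move=> t0; apply: differentiable_continuous; apply/derivable1_diffP/derivable_powR.
by rewrite in_itv/= andbT.
Qed.

Lemma graph_closureP (G : set (X * X)) u v :
  closure G (u, v) <->
  forall e, 0 < e -> exists u' v', [/\ G (u', v'), `|u - u'| < e & `|v - v'| < e].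
Proof.
split=> [h e e0|h B].
  have /h [[u' v'] [Guv []]] : nbhs (u, v) (ball u e `*` ball v e).
    by exists (ball u e, ball v e) => //; split => /=; exact: nbhsx_ballx.
  by rewrite -!ball_normE /=; exists u', v'.
move=> [[B1 B2] /= [/nbhs_ballP[e1 /= e10 h1] /nbhs_ballP[e2 /= e20 h2]] B12].
have [|u' [v' [Guv uu vv]]] := h (Num.min e1 e2); first by rewrite lt_min e10 e20.
exists (u', v'); split => //; apply: B12; split => /=.
  by apply: h1; rewrite -ball_normE/= (lt_le_trans uu)// ge_min lexx.
by apply: h2; rewrite -ball_normE/= (lt_le_trans vv)// ge_min lexx orbT.
Qed.

(** Pairings are continuous, so adjointness relations pass to closed graphs. *)
Lemma closure_pairing (G : set (X * X)) z z' : (forall p, G p -> ip p.2 z = ip p.1 z') ->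
  forall u v, closure G (u, v) -> ip v z = ip u z'.
Proof.
move=> hG u v /graph_closureP h.
apply/eqP; rewrite -subr_eq0 -normr_le0; apply/ler_addgt0Pl => e e0; rewrite addr0.
pose K := `|z| + `|z'| + 1.
have K0 : 0 < K by rewrite ltr_wpDl// addr_ge0.
have [u' [v' [Guv uu vv]]] := h _ (divr_gt0 e0 K0).
have -> : ip v z - ip u z' = ip (v - v') z - ip (u - u') z'.
  by rewrite !ipBl (hG _ Guv)/=; ring.
rewrite (le_trans (ler_normB _ _))//.
apply: (@le_trans _ _ (e / K * `|z| + e / K * `|z'|)).
  apply: lerD; rewrite (le_trans (cauchy_schwarz ip_norm _ _))// ler_wpM2r// ltW//.
rewrite -mulrDr mulrAC ler_pdivrMr// ler_wpM2l ?(ltW e0)//.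
by rewrite /K lerDl.
Qed.

Definition balakrishnan_graph (a : R) : set (X * X) :=
  closure [set p | balakrishnan A S a p.1 p.2].

Lemma power_graphE a u v : 0 < a < 1 ->
  power_graph A S a u v <-> balakrishnan_graph a (u, v).
Proof.
move=> /andP[a0 a1]; rewrite /power_graph.
have -> : Num.truncn a = 0%N by apply/eqP; rewrite truncn_eq ?ltW//= ltW.
rewrite /= subr0 /fracpow_graph gt_eqF//; split; first by move=> [w [-> ]].
by move=> h; exists u.
Qed.

Lemma balakrishnan_linear a c u v u' v' :
  balakrishnan A S a u v -> balakrishnan A S a u' v' ->
  balakrishnan A S a (c *: u + u') (c *: v + v').
Proof.
move=> [du hu] [du' hu']; split; first exact: domA_lin.
have combo : (fun t => t `^ (- a - 1) *: (c *: u + u' - S t (c *: u + u'))) =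
    (fun t => c *: (t `^ (- a - 1) *: (u - S t u)) + t `^ (- a - 1) *: (u' - S t u')).
  apply/funext => t; rewrite linearP scalerA mulrC -scalerA -scalerDr; congr (_ *: _).
  by rewrite scalerBr opprD addrACA.
have val : balakrishnan_cst a *: (c *: v + v') =
    c *: (balakrishnan_cst a *: v) + balakrishnan_cst a *: v'.
  by rewrite scalerDr !scalerA mulrC.
rewrite combo val; apply: bochner_linear => //.
rewrite -combo; set w := c *: u + u' => r.
apply: (eq_measurable_fun (fun t => `|t `^ (- a - 1) *: (w - S (Num.max t 0) w) - r|)).
  by move=> t; rewrite inE/= in_itv/= andbT => t0; rewrite (max_l (ltW t0)).
apply: subtraction_measurable_continuous => // t.
rewrite inE/= in_itv/= andbT => t0; apply: cvgZ.
  exact: powR_continuous.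
by apply: cvgB; [exact: cvg_cst | exact: continuous_S].
Qed.

Lemma balakrishnan_graph_linear a c u v u' v' :
  balakrishnan_graph a (u, v) -> balakrishnan_graph a (u', v') ->
  balakrishnan_graph a (c *: u + u', c *: v + v').
Proof.
move=> /graph_closureP h /graph_closureP h'; apply/graph_closureP => e e0.
have K0 : 0 < `|c| + 1 by rewrite ltr_wpDl.
have e1 : 0 < e / 2 / (`|c| + 1) by rewrite !divr_gt0.
have comb (p q p1 q1 : X) : `|p - p1| < e / 2 / (`|c| + 1) -> `|q - q1| < e / 2 ->
    `|c *: p + q - (c *: p1 + q1)| < e.
  move=> pp qq; rewrite opprD addrACA -scalerBr (le_lt_trans (ler_normD _ _))//.
  rewrite [e]splitr ler_ltD// normrZ.
  rewrite (le_trans (ler_wpM2l _ (ltW pp)))// mulrCA ger_pMr ?divr_gt0//.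
  by rewrite ler_pdivrMr// mul1r lerDl.
have [u1 [v1 [G1 uu1 vv1]]] := h _ e1.
have [u2 [v2 [G2 uu2 vv2]]] := h' _ (divr_gt0 e0 (ltr0n R 2)).
exists (c *: u1 + u2), (c *: v1 + v2); split; first exact: balakrishnan_linear.
  exact: comb.
exact: comb.
Qed.

(** S(t) z is in the domain of the closure for every t > 0, by smoothing, and tends
    to z; elements of the domain of the closure are limits of elements of D(A)
    where Balakrishnan's integral converges. *)
Lemma weak_power_dense a z (e : R) : 0 < a < 1 -> 0 < e ->
  exists w w', balakrishnan A S a w w' /\ `|z - w| < e.
Proof.
move=> /[dup] a01 /andP[a0 a1] e0.
have e2 : 0 < e / 2 by rewrite divr_gt0.
have [d d0 hd] := S_cvg0 z e2.
have [/(_ 0 a (lexx 0) (ltW a0)) h _] := S_estimates ltr01.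
have {h} [|M M0 hM] := h; first by rewrite (lt_trans a1)// ltr1n.
pose t := Num.min 1 (d / 2).
have t0 : 0 < t by rewrite lt_min ltr01 divr_gt0.
have t1 : t <= 1 by rewrite ge_min lexx.
have td : t < d by rewrite gt_min ltr_pdivrMr// mulr_natr mulr2n ltrDl d0 orbT.
have [|[v /power_graphE -/(_ a01)/graph_closureP/(_ _ e2)[w [w' [/= Gw zw _]]]] _] := hM t z _ (Xdom0 z).
  by rewrite t0.
exists w, w'; split => //.
rewrite -(subrK (S t z) z) -addrA (le_lt_trans (ler_normD _ _))// [e]splitr ltrD//.
by rewrite distrC hd// (ltW t0).
Qed.

Lemma orthogonal_to_domain a d : 0 < a < 1 ->
  (forall w w', balakrishnan A S a w w' -> ip d w = 0) -> forall z, ip d z = 0.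
Proof.
move=> a01 orth z; apply/eqP; rewrite -normr_le0; apply/ler_addgt0Pl => e e0.
rewrite addr0; have K0 : 0 < `|d| + 1 by rewrite ltr_wpDl.
have [w [w' [hw zw]]] := weak_power_dense z a01 (divr_gt0 e0 K0).
rewrite -[X in `|X|]subr0 -(orth _ _ hw) -ipBr.
rewrite (le_trans (cauchy_schwarz ip_norm _ _))//.
rewrite (le_trans (ler_wpM2l _ (ltW zw)))// mulrCA ger_pMr//.
by rewrite ler_pdivrMr// mul1r lerDl.
Qed.

(** A symmetric operator with dense domain is closable: the difference of two
    values of the closure is orthogonal to the domain. *)
Lemma balakrishnan_graph_single a u v v' : 0 < a < 1 ->
  balakrishnan_graph a (u, v) -> balakrishnan_graph a (u, v') -> v = v'.
Proof.
move=> a01 h h'; apply/eqP; rewrite -subr_eq0; apply/eqP.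
have orth w w' : balakrishnan A S a w w' -> ip (v - v') w = 0.
  move=> hw; rewrite ipBl; apply/eqP; rewrite subr_eq0; apply/eqP.
  have ext p : [set p | balakrishnan A S a p.1 p.2] p -> ip p.2 w = ip p.1 w'.
    by move=> hp; apply: (@weak_power_symmetric a) => //; exact: balakrishnan_weak.
  by rewrite (closure_pairing ext h) (closure_pairing ext h').
by apply: (ip_eq0 ip_norm); exact: orthogonal_to_domain orth.
Qed.

Let unit_itv_cases (P : R -> Prop) : P 0 -> P 1 -> (forall a, 0 < a < 1 -> P a) ->
  forall a, 0 <= a <= 1 -> P a.
Proof.
move=> P0 P1 Pa a /andP[]; rewrite le_eqVlt => /predU1P[<-//|a0].
rewrite le_eqVlt => /predU1P[->//|a1]; apply: Pa; exact/andP.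
Qed.

Lemma power_graph_single a u v v' : 0 <= a <= 1 ->
  power_graph A S a u v -> power_graph A S a u v' -> v = v'.
Proof.
move: a; apply: unit_itv_cases => [|| a a01].
- by move=> /npow0_graph -> /npow0_graph ->.
- by move=> /npow1_graph[_ ->] /npow1_graph[_ ->].
- by move=> /(power_graphE _ _ a01) h /(power_graphE _ _ a01); exact: balakrishnan_graph_single h.
Qed.

Lemma power_graph_linear a c u v u' v' : 0 <= a <= 1 ->
  power_graph A S a u v -> power_graph A S a u' v' ->
  power_graph A S a (c *: u + u') (c *: v + v').
Proof.
move: a; apply: unit_itv_cases => [|| a a01].
- by move=> /npow0_graph -> /npow0_graph ->; apply/npow0_graph.
- move=> /npow1_graph[du ->] /npow1_graph[du' ->]; apply/npow1_graph.
  by split; [exact: domA_lin | rewrite A_lin// scalerN -opprD].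
- move=> /(power_graphE _ _ a01) h /(power_graphE _ _ a01) h'.
  by apply/(power_graphE _ _ a01); exact: balakrishnan_graph_linear.
Qed.

Lemma npow_eq a u v : 0 <= a <= 1 -> power_graph A S a u v -> npow A S a u = v.
Proof.
by move=> a01 h; apply: xget_unique => // w h'; exact: power_graph_single h' h.
Qed.

Lemma npowP a u : Xdom A S a u -> power_graph A S a u (npow A S a u).
Proof. by move=> [v h]; rewrite /npow; case: xgetP => [//|/(_ v)]. Qed.

Lemma Xdom_lin a c u v : 0 <= a <= 1 -> Xdom A S a u -> Xdom A S a v ->
  Xdom A S a (c *: u + v).
Proof.
move=> a01 [u' hu] [v' hv]; exists (c *: u' + v'); exact: power_graph_linear.
Qed.

Lemma npow_lin a c u v : 0 <= a <= 1 -> Xdom A S a u -> Xdom A S a v ->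
  npow A S a (c *: u + v) = c *: npow A S a u + npow A S a v.
Proof.
by move=> a01 hu hv; apply: npow_eq => //; apply: power_graph_linear => //; exact: npowP.
Qed.

Lemma XdomB a u v : 0 <= a <= 1 -> Xdom A S a u -> Xdom A S a v -> Xdom A S a (u - v).
Proof. by move=> a01 hu hv; rewrite addrC -scaleN1r; exact: Xdom_lin. Qed.

Lemma Xnorm_triangle a u v : 0 <= a <= 1 -> Xdom A S a u -> Xdom A S a v ->
  Xnorm A S a (u + v) <= Xnorm A S a u + Xnorm A S a v.
Proof.
move=> a01 hu hv; rewrite /Xnorm -{2}[u]scale1r npow_lin// scale1r addrACA.
by rewrite lerD// ler_normD.
Qed.

Lemma Xdom_S a u t : 0 <= a < 2 -> 0 < t -> Xdom A S a (S t u).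
Proof.
move=> /andP[a0 a2] t0; have [/(_ 0 a (lexx 0) a0 a2) h _] := S_estimates t0.
have {h} [M M0 hM] := h.
by have [] := hM t u _ (Xdom0 u); rewrite ?t0 ?lexx.
Qed.

Lemma domA_smoothing u t : 0 < t -> dom A (S t u).
Proof. by move=> t0; apply/Xdom1; apply: Xdom_S => //; rewrite ler01 ltr1n. Qed.

(** In u = S(1) u - (S(1) u - u) the first term is smooth and the second is
    covered by the estimate on S(t) - I. *)
Lemma Xdom_le a b u : 0 <= b <= a -> a <= 1 -> Xdom A S a u -> Xdom A S b u.
Proof.
move=> /andP[b0]; rewrite le_eqVlt => /predU1P[->//|ba] a1 hu.
have b1 : b <= 1 by rewrite (le_trans (ltW ba)).
have [_ /(_ a b b0 ba a1)[C C0 hC]] := S_estimates ltr01.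
have [|h _] := hC 1 u _ hu; first by rewrite ltr01 lexx.
suff : Xdom A S b (S 1 u - (S 1 u - u)) by rewrite subKr.
apply: XdomB h; first by rewrite b0.
by apply: Xdom_S; rewrite ?ltr01// b0 (le_lt_trans b1)// ltr1n.
Qed.

(** Both powers are closures, so [closure_pairing] reduces the identity to vectors
    where Balakrishnan's integrals converge; there it is [weak_power_mul]. *)
Lemma npow_pairing a phi u : 0 <= a < 1 -> Xdom A S a phi -> dom A u ->
  ip (npow A S a phi) (npow A S (1 - a) u) = ip phi (- A u).
Proof.
move=> /andP[]; rewrite le_eqVlt => /predU1P[<-|a0] a1 hphi du.
  by rewrite subr0 npow0 npow1.
have a01 : 0 < a < 1 by rewrite a0.
have b01 : 0 < 1 - a < 1 by rewrite subr_gt0 a1 gtrBl.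
have hu : Xdom A S (1 - a) u.
  apply: (@Xdom_le 1); [by rewrite subr_ge0 gerBl !ltW | by rewrite lexx | exact/Xdom1].
have /(power_graphE _ _ a01) gphi := npowP hphi.
have /(power_graphE _ _ b01) gu := npowP hu.
have h1 p p' : balakrishnan A S a p p' -> ip p' (npow A S (1 - a) u) = ip p (- A u).
  move=> hp; have dp : dom A p by case: hp.
  rewrite ipC ipNr -A_symmetric// [ip (A p) u]ipC -ipNr.
  apply: closure_pairing gu => -[q q'] /= hq.
  have dq : dom A q by case: hq.
  rewrite ipC (@weak_power_mul a (1 - a) p p' q q') ?subr_gt0 ?subrKC//; try exact: balakrishnan_weak.
  by rewrite !ipNr -A_symmetric// ipC.
by apply: closure_pairing gphi => -[p p'] /= hp; exact: h1.
Qed.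

(** The difference of the two sides is orthogonal to the domain of Balakrishnan's
    operator, on which S commutes with the power. *)
Lemma npow_S a u s : 0 < a < 1 -> 0 < s -> Xdom A S a u ->
  npow A S a (S s u) = S s (npow A S a u).
Proof.
move=> a01 s0 hu.
have a01' : 0 <= a < 2 by case/andP: a01 => a0 a1; rewrite ltW//= (lt_trans a1)// ltr1n.
have /(power_graphE _ _ a01) gu := npowP hu.
have /(power_graphE _ _ a01) gS := npowP (Xdom_S u a01' s0).
apply/eqP; rewrite -subr_eq0; apply/eqP; apply: (ip_eq0 ip_norm) => z.
set d := _ - _.
have orth w w' : balakrishnan A S a w w' -> ip d w = 0.
  move=> /balakrishnan_weak hw; rewrite ipBl; apply/eqP; rewrite subr_eq0; apply/eqP.
  rewrite (S_symmetric _ _ (ltW s0)).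
  have ext1 p : [set p | balakrishnan A S a p.1 p.2] p -> ip p.2 w = ip p.1 w'.
    by move=> hp; apply: (@weak_power_symmetric a) => //; exact: balakrishnan_weak.
  have ext2 p : [set p | balakrishnan A S a p.1 p.2] p -> ip p.2 (S s w) = ip p.1 (S s w').
    move=> hp; apply: (@weak_power_symmetric a) => //; first exact: balakrishnan_weak.
    by apply: weak_power_S => //; exact: ltW.
  by rewrite (closure_pairing ext1 gS) (closure_pairing ext2 gu) (S_symmetric _ _ (ltW s0)).
by apply: orthogonal_to_domain orth z.
Qed.

(** For u in D(A) the mean value theorem and [npow_pairing] give
    <phi, u - S(h) u> = h <(-A)^a phi, S(c) (-A)^(1 - a) u> for some c in ]0, h[.
    This is applied to S(r) u, and then r tends to 0. *)
Lemma pairing_increment a phi u (e : R) : 0 < a < 1 -> Xdom A S a phi ->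
  Xdom A S (1 - a) u -> 0 < e -> exists2 d, 0 < d & forall h, 0 < h < d ->
  `|ip phi (u - S h u) - h * ip (npow A S a phi) (npow A S (1 - a) u)| <= e * h.
Proof.
move=> a01 hphi hu e0.
have /andP[a0 a1] := a01.
have b01 : 0 < 1 - a < 1 by rewrite subr_gt0 a1 gtrBl.
set v := npow A S a phi; set w := npow A S (1 - a) u.
have K0 : 0 < `|v| + 1 by rewrite ltr_wpDl.
have [d d0 hd] := S_cvg0 w (divr_gt0 e0 K0).
exists d => // h /andP[h0 hdd].
have shifted r : 0 < r -> h + r < d ->
    `|ip phi (S r u - S h (S r u)) - h * ip v w| <= e * h.
  move=> r0 hrd.
  have dr : dom A (S r u) by exact: domA_smoothing.
  have [c /andP[c0 ch] E] := ip_domA_MVT phi h0 dr.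
  have -> : ip phi (S r u - S h (S r u)) - h * ip v w = h * ip v (S (c + r) w - w).
    rewrite -[_ - S h _]opprB ipNr E.
    have dcr : dom A (S c (S r u)) by apply: domA_S => //; exact: ltW.
    have a01' : 0 <= a < 1 by rewrite (ltW a0).
    have P : ip v (S (c + r) w) = - ip phi (A (S c (S r u))).
      have -> : S (c + r) w = npow A S (1 - a) (S (c + r) u).
        by rewrite npow_S// addr_gt0.
      rewrite SD ?(ltW c0) ?(ltW r0)//.
      by rewrite (npow_pairing a01' hphi dcr) ipNr.
    by rewrite ipBr P; ring.
  rewrite normrM gtr0_norm// mulrC ler_wpM2r ?(ltW h0)//.
  rewrite (le_trans (cauchy_schwarz ip_norm _ _))//.
  have := hd (c + r); rewrite addr_ge0 ?(ltW c0) ?(ltW r0)//=.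
  rewrite (lt_trans _ hrd) ?ltrD2r// => /(_ isT)/ltW cr.
  rewrite (le_trans (ler_wpM2l _ cr))// mulrCA ger_pMr//.
  by rewrite ler_pdivrMr// mul1r lerDl.
have cvg_r : `|ip phi (S (Num.max r 0) u - S h (S (Num.max r 0) u)) - h * ip v w| @[r --> 0^'+] -->
    `|ip phi (u - S h u) - h * ip v w|.
  apply: cvg_norm; apply: cvgB; last exact: cvg_cst.
  have c : S (Num.max r 0) u @[r --> 0^'+] --> u.
    have := @continuous_S u 0; rewrite /continuous_at maxxx S0.
    by apply: cvg_trans; apply: cvg_app; exact: cvg_within.
  apply: (cvg_ip ip_norm); first exact: cvg_cst.
  apply: cvgB => //.
  by apply: (@continuous_cvg _ _ _ _ _ _ _ _ _ c); apply: S_continuous; exact: ltW.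
apply: (ler_cvg_to cvg_r (cvg_cst (e * h))); near=> r.
have r0 : 0 < r by near: r; exact: nbhs_right_gt.
rewrite (max_l (ltW r0)); apply: shifted => //.
by rewrite addrC -ltrBrDr; near: r; apply: nbhs_right_lt; rewrite subr_gt0.
Unshelve. all: by end_near. Qed.

(** * Increments of orbits and of functions in the twisted spaces *)

(** By the mean value theorem the increment is - r <(-A)^eps phi,
    (-A)^(1 - eps) S(c) psi> for some c in ]r, 2 r[, and smoothing bounds the last
    vector by a multiple of c^(zeta + eps - 1). *)
Lemma increment_doubling (T eps zeta : R) phi psi : 0 < T -> 0 <= eps < 1 ->
  0 <= zeta -> 0 < zeta + eps <= 1 -> Xdom A S eps phi -> Xdom A S zeta psi ->
  exists2 C, 0 <= C & forall r, 0 < r -> r + r <= T ->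
    `|ip phi (S (r + r) psi - S r psi)| <= C * r `^ (zeta + eps).
Proof.
move=> T0 /[dup] eps01 /andP[eps0 eps1] zeta0 /andP[p0 p1] hphi hpsi.
have ze : zeta <= 1 - eps by rewrite lerBrDr.
have e2 : 1 - eps < 2 by rewrite (le_lt_trans (_ : _ <= 1)) ?ltr1n// gerBl.
have [/(_ zeta (1 - eps) zeta0 ze e2)[M M0 hM] _] := S_estimates T0.
pose v := npow A S eps phi; pose C := `|v| * (M * Xnorm A S zeta psi).
have Xn0 : 0 <= Xnorm A S zeta psi by rewrite addr_ge0.
have C0 : 0 <= C by rewrite !mulr_ge0// ltW.
exists C => // r r0 rT.
have dr : dom A (S r psi) by exact: domA_smoothing.
have [c /andP[c0 cr]] := ip_domA_MVT phi r0 dr.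
rewrite -SD ?(ltW r0)// => ->; rewrite normrM gtr0_norm//.
have cr0 : 0 < c + r by rewrite addr_gt0.
have crT : 0 < c + r <= T by rewrite cr0 (le_trans _ rT)// lerD2r ltW.
rewrite -SD ?(ltW c0) ?(ltW r0)//.
rewrite -normrN -ipNr -(npow_pairing eps01 hphi (domA_smoothing _ cr0)) -/v.
have [_ hn] := hM (c + r) psi crT hpsi.
have nb : `|npow A S (1 - eps) (S (c + r) psi)| <= M * (c + r) `^ (zeta + eps - 1) * Xnorm A S zeta psi.
  apply: le_trans (_ : _ <= Xnorm A S (1 - eps) (S (c + r) psi)) _; first by rewrite /Xnorm lerDr.
  by rewrite (_ : zeta + eps - 1 = - (1 - eps) + zeta)//; ring.
have mono : (c + r) `^ (zeta + eps - 1) <= r `^ (zeta + eps - 1).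
  rewrite -opprB !powRN lef_pV2 ?posrE ?powR_gt0//.
  by apply: ge0_ler_powR; rewrite ?subr_ge0 ?nnegrE ?(ltW r0) ?(ltW cr0)// lerDr ltW.
apply: (@le_trans _ _ (r * (`|v| * (M * r `^ (zeta + eps - 1) * Xnorm A S zeta psi)))).
  rewrite ler_wpM2l ?(ltW r0)// (le_trans (cauchy_schwarz ip_norm _ _))// ler_wpM2l//.
  by rewrite (le_trans nb)// ler_wpM2r// ler_wpM2l ?(ltW M0).
rewrite (_ : r * _ = C * (r * r `^ (zeta + eps - 1))); last by rewrite /C; ring.
by rewrite mulr_powRB1// ltW.
Qed.

(** The interval ]0, h] splits into the dyadic pieces [h / 2^(n + 1), h / 2^n], whose
    increments form a convergent geometric series because zeta + eps > 0. *)
Lemma increment_power (T eps zeta : R) phi psi : 0 < T -> 0 <= eps < 1 ->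
  0 <= zeta -> 0 < zeta + eps <= 1 -> Xdom A S eps phi -> Xdom A S zeta psi ->
  exists2 C, 0 <= C & forall h, 0 < h <= T ->
    `|ip phi (psi - S h psi)| <= C * h `^ (zeta + eps).
Proof.
move=> T0 eps01 zeta0 /[dup] pp /andP[p0 p1] hphi hpsi.
have [C C0 hC] := increment_doubling T0 eps01 zeta0 pp hphi hpsi.
set p := zeta + eps in pp p0 p1 hC *.
pose q : R := 2 `^ (- p).
have q0 : 0 < q by exact: powR_gt0.
have q1 : q < 1.
  rewrite /q powRN invf_lt1 ?powR_gt0//.
  have : 1 `^ p < 2 `^ p :> R by apply: gt0_ltr_powR; rewrite ?nnegrE// ltr1n.
  by rewrite powR1.
(* K = q (C + K) makes the induction on the number of dyadic pieces close. *)
pose K := C * q / (1 - q).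
have K0 : 0 <= K by rewrite divr_ge0 ?mulr_ge0 ?subr_ge0// ltW.
have half (h : R) : 0 < h -> (h / 2) `^ p = q * h `^ p.
  move=> h0; rewrite mulrC powRM ?invr_ge0 ?(ltW h0)//.
  by rewrite -powR_inv1// -powRrM mulN1r.
have bound n h : 0 < h <= T -> `|ip phi (S (h / 2 ^+ n) psi - S h psi)| <= K * h `^ p.
  elim: n h => [|n IH] h /andP[h0 hT].
    by rewrite expr0 divr1 subrr ip0r normr0 mulr_ge0 ?powR_ge0.
  have h20 : 0 < h / 2 by rewrite divr_gt0.
  have hh : h / 2 + h / 2 = h by rewrite -splitr.
  have -> : h / 2 ^+ n.+1 = h / 2 / 2 ^+ n by rewrite exprS invfM mulrA.
  rewrite -(subrKA (S (h / 2) psi)) ipDr (le_trans (ler_normD _ _))//.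
  have h2T : h / 2 <= T by rewrite (le_trans _ hT)// -[leRHS]hh lerDl ltW.
  have b1 := IH (h / 2); rewrite h20 h2T in b1.
  have b2 := hC (h / 2) h20; rewrite hh in b2.
  rewrite (le_trans (lerD (b1 isT) (_ : _ <= C * (h / 2) `^ p)))//.
    by rewrite -normrN -ipNr opprB b2.
  rewrite half// -mulrDl mulrA ler_wpM2r ?powR_ge0// le_eqVlt; apply/orP; left; apply/eqP.
  by rewrite /K; field; rewrite gt_eqF// subr_gt0.
exists K => // h hT; apply/ler_addgt0Pl => e e0.
have f0 : 0 < `|phi| + 1 by rewrite ltr_wpDl.
have [d d0 hd] := S_cvg0 psi (divr_gt0 e0 f0).
have [n hn] := dyadic_small h d0.
have h0 : 0 < h by case/andP: hT.
have hd' := hd (h / 2 ^+ n); rewrite hn divr_ge0 ?(ltW h0) ?exprn_ge0//= in hd'.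
rewrite -(subrKA (S (h / 2 ^+ n) psi)) ipDr (le_trans (ler_normD _ _))// lerD ?bound//.
rewrite (le_trans (cauchy_schwarz ip_norm _ _))// distrC.
rewrite (le_trans (ler_wpM2l _ (ltW (hd' isT))))// mulrCA ger_pMr//.
by rewrite ler_pdivrMr// mul1r lerDl.
Qed.

(** f(t) - f(s) = (f(t) - S(t - s) f(s)) + (S(t - s) - I) f(s), where the second term
    is O((t - s)^al) since f is bounded in X_al. *)
Lemma holder_of_hat (T al C B : R) (f : R -> X) : 0 < T -> 0 < al < 1 ->
  0 <= C -> 0 <= B ->
  (forall s t, 0 <= s -> s < t -> t <= T -> `|f t - S (t - s) (f s)| <= C * (t - s) `^ al) ->
  (forall s, 0 <= s <= T -> Xdom A S al (f s) /\ Xnorm A S al (f s) <= B) ->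
  exists2 H, 0 <= H & forall s t, 0 <= s -> s <= t -> t <= T ->
    `|f s - f t| <= H * (t - s) `^ al.
Proof.
move=> T0 /andP[al0 al1] C0 B0 hf hB.
have [_ /(_ al 0 (lexx 0) al0 (ltW al1))[D D0 hD]] := S_estimates T0.
exists (C + D * B) => [|s t s0 st tT]; first by rewrite addr_ge0// mulr_ge0// ltW.
have [->|nst] := eqVneq s t.
  by rewrite subrr normr0 mulr_ge0 ?powR_ge0// addr_ge0// mulr_ge0// ltW.
have {}st : s < t by rewrite lt_neqAle nst.
have ts0 : 0 < t - s by rewrite subr_gt0.
have sT : 0 <= s <= T by rewrite s0 (le_trans (ltW st)).
have [ds nB] := hB s sT.
have tsT : 0 < t - s <= T by rewrite ts0 (le_trans _ tT)// gerBl.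
have [_] := hD (t - s) (f s) tsT ds.
rewrite Xnorm0 // subr0 => h2.
have {}h2 : `|S (t - s) (f s) - f s| <= D * B * (t - s) `^ al.
  apply: (@le_trans _ _ (2 * `|S (t - s) (f s) - f s|)); first by rewrite ler_peMl// ler1n.
  by rewrite (le_trans h2)// mulrAC ler_wpM2r ?powR_ge0// ler_wpM2l ?(ltW D0).
rewrite distrC -(subrKA (S (t - s) (f s))) (le_trans (ler_normD _ _))// mulrDl.
by rewrite lerD// hf.
Qed.

Lemma hatC_bound beta a b z f : hatC A S beta a b z f ->
  exists2 C, 0 <= C & forall s t, a <= s -> s < t -> t <= b ->
    `|f t - S (t - s) (f s)| <= C * (t - s) `^ beta.
Proof.
move=> [_ _ [C hC]]; exists `|C| => // s t a_s st tb.
have := hC (s, t) (And3 a_s st tb); rewrite /hat_delta/= => h.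
apply: (le_trans (norm_le_Xnorm z _)); apply: (le_trans h).
by rewrite ler_wpM2r ?powR_ge0// ler_norm.
Qed.

(** f(s) = (f(s) - S(s) f(0)) + S(s) f(0). *)
Lemma hatC_Xnorm_bound T al f : 0 < T -> 0 < al < 1 -> hatC A S al 0 T al f ->
  exists2 B, 0 <= B & forall s, 0 <= s <= T ->
    Xdom A S al (f s) /\ Xnorm A S al (f s) <= B.
Proof.
move=> T0 /andP[al0 al1] [cf cd [C hC]].
have al01 : 0 <= al <= 1 by rewrite !ltW.
have fdom s : 0 <= s <= T -> Xdom A S al (f s).
  by move=> sT; have [] := cf s; rewrite /= ?in_itv.
have al2 : al < 2 by rewrite (lt_trans al1)// ltr1n.
have [/(_ al al (ltW al0) (lexx al) al2)[M M0 hM] _] := S_estimates T0.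
have Xn0 u : 0 <= Xnorm A S al u by rewrite addr_ge0.
have d0 : Xdom A S al (f 0) by apply: fdom; rewrite lexx ltW.
exists (`|C| * T `^ al + (M + 1) * Xnorm A S al (f 0)).
  have M1 : 0 <= M + 1 by rewrite addr_ge0 ?ler01// ltW.
  by apply: addr_ge0; apply: mulr_ge0 => //; rewrite ?powR_ge0 ?normr_ge0 ?Xn0.
move=> s /[dup] sT01 /andP[s0 sT]; split; first exact: fdom.
have [->|sn0] := eqVneq s 0.
  rewrite mulrDl mul1r addrA lerDr addr_ge0 ?mulr_ge0 ?powR_ge0//.
  exact: ltW.
have {}s0 : 0 < s by rewrite lt0r sn0.
have sT' : 0 < s <= T by rewrite s0.
have [dS nS] := hM s (f 0) sT' d0.
have simp : simplex2 0 T (0, s) by split.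
have [dd _] := cd (0, s) simp.
have := hC (0, s) simp; rewrite /hat_delta/= subr0 in dd * => nd.
rewrite -(subrK (S s (f 0)) (f s)) (le_trans (Xnorm_triangle _ _ _))// lerD//.
  rewrite (le_trans nd)//; apply: (@le_trans _ _ (`|C| * s `^ al)).
    by rewrite ler_wpM2r ?powR_ge0// ler_norm.
  by rewrite ler_wpM2l// ge0_ler_powR ?nnegrE// ltW.
rewrite addNr powRr0 mulr1 in nS; rewrite (le_trans nS)// ler_wpM2r ?lerDl ?ler01//.
Qed.

(** * Mild solutions *)

Section mild_solutions.
Variables (T eta alpha : R) (m : nat) (x : 'I_m -> R -> R) (sigma : 'I_m -> X -> X).
Hypothesis T_gt0 : 0 < T.
Hypothesis eta_itv : 2^-1 < eta < 1.
Hypothesis x_holder : forall i, holder_on T eta (x i).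
Hypothesis alpha_itv : 0 < alpha < 1.
Hypothesis eta_alpha : 1 < eta + alpha.
Hypothesis sigma_ok : forall i, sigma_assumptions A S alpha (sigma i).
Variables (psi : X) (y : R -> X).
Hypothesis y_sol : solution A S sigma x T alpha psi y.

Let eta_gt0 : 0 < eta. Proof. by case/andP: eta_itv => + _; apply: lt_trans; rewrite invr_gt0. Qed.
Let alpha_gt0 : 0 < alpha. Proof. by case/andP: alpha_itv. Qed.

Lemma x_holder_cst i : exists2 C, 0 <= C &
  forall s t, 0 <= s <= T -> 0 <= t <= T -> `|x i s - x i t| <= C * `|s - t| `^ eta.
Proof.
have [C hC] := x_holder i; exists `|C| => // s t hs ht.
by rewrite (le_trans (hC s t hs ht))// ler_wpM2r ?powR_ge0// ler_norm.
Qed.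

Lemma solution_bound : exists2 B, 0 <= B & forall s, 0 <= s <= T ->
  Xdom A S alpha (y s) /\ Xnorm A S alpha (y s) <= B.
Proof. by case: y_sol => _ hy; exact: hatC_Xnorm_bound. Qed.

Lemma sigma_solution_bound i : exists2 B, 0 <= B & forall s, 0 <= s <= T ->
  Xdom A S alpha (sigma i (y s)) /\ Xnorm A S alpha (sigma i (y s)) <= B.
Proof.
have [B B0 hB] := solution_bound; have [_ _ _ _ [L L0 hL]] := sigma_ok i.
exists (L * (1 + B)); first by rewrite mulr_ge0 ?addr_ge0// ltW.
move=> s sT; have [ds nB] := hB s sT; have [d n] := hL _ ds.
by split => //; rewrite (le_trans n)// ler_wpM2l ?(ltW L0)// lerD2l.
Qed.

Lemma solution_holder : exists2 H, 0 <= H & forall s t, 0 <= s -> s <= t -> t <= T ->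
  `|y s - y t| <= H * (t - s) `^ alpha.
Proof.
have [B B0 hB] := solution_bound.
have [C C0 hC] : exists2 C, 0 <= C & forall s t, 0 <= s -> s < t -> t <= T ->
    `|y t - S (t - s) (y s)| <= C * (t - s) `^ alpha.
  by case: y_sol => _; exact: hatC_bound.
exact: holder_of_hat hC hB.
Qed.

Lemma sigma_solution_holder i : exists2 H, 0 <= H &
  forall s t, 0 <= s -> s <= t -> t <= T ->
  `|sigma i (y s) - sigma i (y t)| <= H * (t - s) `^ alpha.
Proof.
have [B B0 hB] := sigma_solution_bound i.
have [C C0 hC] := hatC_bound (y_sol.1.1 i).
exact: holder_of_hat hC hB.
Qed.

Lemma solution_at0 : y 0 = psi.
Proof.
have [I [hI ->]] := y_sol.1.2 0 (andb_true_intro (conj (lexx 0) (ltW T_gt0))).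
rewrite S0 big1 ?addr0// => i _; apply/eqP; rewrite -normr_le0; apply/ler_addgt0Pl => e e0.
have [d d0 hd] := hI i e e0.
have := hd [::]; rewrite /= big_nil sub0r normrN addr0 => h.
by apply: ltW; apply: h => //; split.
Qed.

(** The mild formula at t minus S(t - t0) applied to the one at t0. *)
Lemma solution_flow t0 t : 0 <= t0 -> t0 < t -> t <= T -> exists J : 'I_m -> X,
  (forall i, young_conv S (x i) (fun r => sigma i (y r)) t0 t (J i)) /\
  y t - S (t - t0) (y t0) = \sum_(i < m) J i.
Proof.
move=> t00 t0t tT.
have t0T : 0 <= t0 <= T by rewrite t00 (le_trans (ltW t0t)).
have tT' : 0 <= t <= T by rewrite tT (le_trans t00)// ltW.
have [I0 [hI0 ->]] := y_sol.1.2 t0 t0T.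
have [I1 [hI1 ->]] := y_sol.1.2 t tT'.
have [M M0 hM] := S_bounded T_gt0.
exists (fun i => I1 i - S (t - t0) (I0 i)); split => [i|].
  exact: (young_conv_flow S_C0 M0 hM).
rewrite linearD -SD ?subr_ge0 ?(ltW t0t)// subrK opprD addrACA subrr add0r.
by rewrite sumrB linear_sum.
Qed.

(** The Young integral over [t0, t] is (x_i(t) - x_i(t0)) S(t - t0) sigma_i(y(t0)) up
    to O((t - t0)^(eta + alpha)).  Dropping the factor S(t - t0) costs
    |x_i(t) - x_i(t0)| O((t - t0)^alpha), since sigma_i(y(t0)) is in X_alpha. *)
Lemma noise_estimate phi t0 : 0 <= t0 < T -> exists2 K, 0 <= K &
  forall t, t0 < t <= T ->
  `|\sum_(i < m) ip phi (sigma i (y t0)) * (x i t - x i t0) -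
    ip phi (y t - S (t - t0) (y t0))| <= K * (t - t0) `^ (eta + alpha).
Proof.
move=> /andP[t00 t0T].
have [M M0 hM] := S_bounded T_gt0.
have each i : exists K, 0 <= K /\ forall t J, t0 < t <= T ->
    young_conv S (x i) (fun r => sigma i (y r)) t0 t J ->
    `|ip phi (sigma i (y t0)) * (x i t - x i t0) - ip phi J| <= K * (t - t0) `^ (eta + alpha).
  have [Cx Cx0 hx] := x_holder_cst i.
  have [Cf Cf0 hf] := hatC_bound (y_sol.1.1 i).
  have [B B0 hB] := sigma_solution_bound i.
  have t0T' : 0 <= t0 <= T by rewrite t00 ltW.
  have [ds _] := hB t0 t0T'.
  have al1 : alpha <= 1 by case/andP: alpha_itv => _ /ltW.
  have [_ /(_ alpha 0 (lexx 0) alpha_gt0 al1)[D D0 hD]] := S_estimates T_gt0.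
  pose Q := sewing_cst (Cx * (M * Cf)) (eta + alpha).
  pose n := Xnorm A S alpha (sigma i (y t0)).
  exists (`|phi| * (`|Q| + Cx * (D * n))); split.
    by rewrite mulr_ge0// addr_ge0// !mulr_ge0 ?(ltW D0)// addr_ge0.
  move=> t J /andP[t0t tT] hJ.
  have h0 : 0 < t - t0 by rewrite subr_gt0.
  have hT : 0 < t - t0 <= T by rewrite h0 (le_trans _ tT)// gerBl.
  have g := young_conv_germ_estimate S_C0 M0 hM (ltW eta_gt0) (ltW alpha_gt0) eta_alpha Cx0 Cf0 t00 t0t tT hx hf hJ.
  have [_] := hD _ _ hT ds; rewrite Xnorm0// subr0 -/n => s.
  have {}s : `|S (t - t0) (sigma i (y t0)) - sigma i (y t0)| <= D * n * (t - t0) `^ alpha.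
    apply: (@le_trans _ _ (2 * `|S (t - t0) (sigma i (y t0)) - sigma i (y t0)|)).
      by rewrite ler_peMl// ler1n.
    by rewrite (le_trans s)// mulrAC.
  have dx : `|x i t - x i t0| <= Cx * (t - t0) `^ eta.
    rewrite -[X in _ <= _ * X `^ _](gtr0_norm h0); apply: hx => //.
    by rewrite tT (le_trans t00)// ltW.
  rewrite mulrC -ipZr -ipBr (le_trans (cauchy_schwarz ip_norm _ _))// -mulrA.
  rewrite ler_wpM2l// -(subrKA ((x i t - x i t0) *: S (t - t0) (sigma i (y t0)))).
  rewrite (le_trans (ler_normD _ _))// addrC mulrDl lerD//.
    rewrite -normrN opprB (le_trans g)// ler_wpM2r ?powR_ge0//.
    exact: ler_norm.
  rewrite -scalerBr normrZ powRD ?(gt_eqF h0) ?implybT// mulrACA mulrA.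
  by rewrite -[leRHS]mulrA ler_pM// distrC.
have [K hK] := choice each.
exists (\sum_(i < m) K i) => [|t tt]; first by rewrite sumr_ge0// => i _; exact: (hK i).1.
have [J [hJ ->]] := solution_flow t00 (andP tt).1 (andP tt).2.
rewrite (ip_sumr ip) -sumrB mulr_suml (le_trans (ler_norm_sum _ _ _))// ler_sum// => i _.
exact: (hK i).2.
Qed.

(** * Inequalities at the boundary *)

(** The point where invariance is used: <phi, y(t)> <= 0 = <phi, y(t0)>. *)
Lemma noise_upper_bound phi t0 : 0 <= t0 < T -> ip phi (y t0) = 0 ->
  (forall t, 0 <= t <= T -> ip phi (y t) <= 0) -> exists2 K, 0 <= K &
  forall t, t0 < t <= T ->
  \sum_(i < m) ip phi (sigma i (y t0)) * (x i t - x i t0) <=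
    ip phi (y t0 - S (t - t0) (y t0)) + K * (t - t0) `^ (eta + alpha).
Proof.
move=> t0T z hK; have [K K0 hn] := noise_estimate phi t0T.
exists K => // t tt; have := le_trans (ler_norm _) (hn t tt).
rewrite lerBlDl => /le_trans; apply; rewrite lerD2r !ipBr lerD2r z.
apply: hK; case/andP: tt => t0t ->; case/andP: t0T => t00 _.
by rewrite (le_trans t00)// ltW.
Qed.

(** The increment of the orbit of psi is O(t^(zeta + eps)), and
    zeta + eps <= 1 < eta + alpha. *)
Lemma boundary_inequality_below eps zeta phi beta :
  0 <= eps < 1 -> 0 <= zeta -> 0 < zeta + eps <= 1 ->
  Xdom A S eps phi -> Xdom A S zeta psi ->
  ip phi psi = 0 -> (forall t, 0 <= t <= T -> ip phi (y t) <= 0) ->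
  beta < zeta + eps ->
  (limf_esup (fun t : R => (t `^ (- beta) *
     \sum_(i < m) (ip phi (sigma i psi) * (x i t - x i 0)))%:E) 0^'+ <= 0)%E.
Proof.
move=> eps01 zeta0 ze hphi hpsi z hK bz.
have [C C0 hC] := increment_power T_gt0 eps01 zeta0 ze hphi hpsi.
have y0 := solution_at0.
have t0T : 0 <= (0 : R) < T by rewrite lexx.
have [|K K0 hn] := noise_upper_bound (phi := phi) t0T _ hK; first by rewrite y0.
rewrite y0 in hn.
have d0 : 0 <= eta + alpha - (zeta + eps).
  by rewrite subr_ge0 (le_trans (andP ze).2)// ltW.
have hN : \forall t \near (0 : R)^'+, \sum_(i < m) (ip phi (sigma i psi) * (x i t - x i 0)) <= (C + K * T `^ (eta + alpha - (zeta + eps))) * (t - 0) `^ (zeta + eps).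
  near=> t; have t0 : 0 < t by near: t; exact: nbhs_right_gt.
  have tT : t <= T by near: t; exact: nbhs_right_le.
  have tt : 0 < t <= T by rewrite t0.
  rewrite (le_trans (hn t tt))// subr0 mulrDl lerD//.
    by rewrite (le_trans (ler_norm _))// hC.
  rewrite -mulrA ler_wpM2l// -{1}(subrK (zeta + eps) (eta + alpha)).
  rewrite [leLHS]powRD ?(gt_eqF t0) ?implybT// ler_wpM2r ?powR_ge0//.
  by apply: ge0_ler_powR; rewrite ?nnegrE// ltW.
have CK : 0 <= C + K * T `^ (eta + alpha - (zeta + eps)) by rewrite addr_ge0 ?mulr_ge0 ?powR_ge0.
apply: limf_esup_power_le0 CK bz _ hN; near=> t; by rewrite subr0.
Unshelve. all: by end_near. Qed.

(** The increment of the orbit of y(t0) has slope L, and the remainder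
    O((t - t0)^(eta + alpha)) is o(t - t0). *)
Lemma boundary_inequality_above eps phi t0 : 0 < eps < 1 -> 0 <= t0 < T ->
  Xdom A S eps phi -> Xdom A S (1 - eps) (y t0) ->
  ip phi (y t0) = 0 -> (forall t, 0 <= t <= T -> ip phi (y t) <= 0) ->
  let L := ip (npow A S eps phi) (npow A S (1 - eps) (y t0)) in
  forall e, 0 < e -> \forall t \near t0^'+,
    \sum_(i < m) ip phi (sigma i (y t0)) * (x i t - x i t0) <= (L + e) * (t - t0).
Proof.
move=> eps01 /[dup] t0T /andP[t00 t0T'] hphi hy z hK L e e0.
have [K K0 hn] := noise_upper_bound t0T z hK.
have e20 : 0 < e / 2 by rewrite divr_gt0.
have [d d0 hd] := pairing_increment eps01 hphi hy e20.
have K1 : 0 < K + 1 by rewrite ltr_wpDl.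
have q0 : 0 < eta + alpha - 1 by rewrite subr_gt0.
have small := powR_small t0 q0 (divr_gt0 e20 K1).
near=> t; have t0t : t0 < t by near: t; exact: nbhs_right_gt.
have tT : t <= T by near: t; exact: nbhs_right_le.
have td : t < t0 + d by near: t; apply: nbhs_right_lt; rewrite ltrDl.
have tt : t0 < t <= T by rewrite t0t.
have h0 : 0 < t - t0 by rewrite subr_gt0.
have hh : 0 < t - t0 < d by rewrite h0 ltrBlDl.
have st : (t - t0) `^ (eta + alpha - 1) <= e / 2 / (K + 1) by near: t.
rewrite (le_trans (hn t tt))//.
have b1 := le_trans (ler_norm _) (hd _ hh); rewrite lerBlDr -/L in b1.
have b2 : K * (t - t0) `^ (eta + alpha) <= e / 2 * (t - t0).
  rewrite -(mulr_powRB1 (ltW h0)) ?(lt_trans ltr01)// [(t - t0) * _]mulrC mulrA.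
  rewrite ler_wpM2r ?(ltW h0)// (le_trans (ler_wpM2l K0 st))// mulrCA ger_pMr//.
  by rewrite ler_pdivrMr// mul1r lerDl.
rewrite (le_trans (lerD b1 b2))// addrAC -mulrDl -splitr.
by rewrite [(t - t0) * L]mulrC -mulrDl addrC.
Unshelve. all: by end_near. Qed.

(** Spatial regularity of the solution with gamma = 1, which is allowed because
    eta + alpha - 1 <= 1 < eta + alpha. *)
Lemma solution_domA s : space_regular A S T eta alpha y -> 0 < s < T ->
  dom A (y s).
Proof.
move=> [reg _] sT; have g1 : eta + alpha - 1 <= 1 < eta + alpha.
  rewrite eta_alpha andbT lerBlDr; apply: lerD; first by case/andP: eta_itv => _ /ltW.
  by case/andP: alpha_itv => _ /ltW.
have [cy _ _] := reg s 1 sT g1.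
have [|d1 _] := cy s; first by rewrite /= in_itv/= lexx; case/andP: sT => _ /ltW.
exact/(Xdom1 _).
Qed.

Lemma solution_Xdom eps zeta t0 : space_regular A S T eta alpha y ->
  0 <= eps < 1 -> zeta < 1 -> 1 < zeta + eps -> Xdom A S zeta psi ->
  0 <= t0 < T -> Xdom A S (1 - eps) (y t0).
Proof.
move=> reg /andP[eps0 eps1] zeta1 ze hpsi /andP[t00 t0T].
have e1 : 0 <= 1 - eps by rewrite subr_ge0 ltW.
have [->|t0n] := eqVneq t0 0.
  rewrite solution_at0; apply: Xdom_le hpsi; last exact: ltW.
  by rewrite e1 lerBlDr ltW.
have sT : 0 < t0 < T by rewrite lt0r t0n t00.
have e01 : 0 <= 1 - eps <= 1 by rewrite e1 gerBl.
apply: (Xdom_le e01 (lexx 1)); apply/(Xdom1 _); exact: solution_domA.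
Qed.

Lemma boundary_inequality_right eps phi t0 beta : 0 < eps < 1 -> 0 <= t0 < T ->
  Xdom A S eps phi -> Xdom A S (1 - eps) (y t0) ->
  ip phi (y t0) = 0 -> (forall t, 0 <= t <= T -> ip phi (y t) <= 0) ->
  beta < 1 ->
  (limf_esup (fun t : R => (`|t - t0| `^ (- beta) *
     \sum_(i < m) (ip phi (sigma i (y t0)) * (x i t - x i t0)))%:E) t0^'+ <= 0)%E.
Proof.
move=> eps01 t0T hphi hy z hK b1.
have hN := boundary_inequality_above eps01 t0T hphi hy z hK ltr01.
set L := ip (npow _ _ _ _) _ in hN.
apply: (limf_esup_power_le0 (C := `|L| + 1) _ b1); first by rewrite addr_ge0.
- by near=> t; rewrite gtr0_norm// subr_gt0; near: t; exact: nbhs_right_gt.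
near=> t; have h0 : 0 <= t - t0.
  by rewrite subr_ge0 ltW//; near: t; exact: nbhs_right_gt.
rewrite powRr1//; apply: (@le_trans _ _ ((L + 1) * (t - t0))); first by near: t.
by rewrite ler_wpM2r// lerD2r ler_norm.
Unshelve. all: by end_near. Qed.

Lemma boundary_slope_right eps phi t0 : 0 < eps < 1 -> 0 <= t0 < T ->
  Xdom A S eps phi -> Xdom A S (1 - eps) (y t0) ->
  ip phi (y t0) = 0 -> (forall t, 0 <= t <= T -> ip phi (y t) <= 0) ->
  (limf_esup (fun t : R => (`|t - t0| `^ (-1) *
     \sum_(i < m) (ip phi (sigma i (y t0)) * (x i t - x i t0)))%:E) t0^'+ <=
   (ip (npow A S eps phi) (npow A S (1 - eps) (y t0)))%:E)%E.
Proof.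
move=> eps01 t0T hphi hy z hK.
apply: limf_esup_le => e e0.
have hN := boundary_inequality_above eps01 t0T hphi hy z hK e0.
near=> t; have h0 : 0 < t - t0.
  by rewrite subr_gt0; near: t; exact: nbhs_right_gt.
rewrite gtr0_norm// powR_inv1 ?(ltW h0)// ler_pdivrMl// mulrC.
by near: t.
Unshelve. all: by end_near. Qed.

Lemma solution_cvg_graph_norm u : space_regular A S T eta alpha y ->
  0 < u < T -> Xnorm A S 1 (y s - y u) @[s --> u] --> (0 : R).
Proof.
move=> reg /andP[u0 u1].
have g1 : eta + alpha - 1 <= 1 < eta + alpha.
  rewrite eta_alpha andbT lerBlDr; apply: lerD; first by case/andP: eta_itv => _ /ltW.
  by case/andP: alpha_itv => _ /ltW.
have u2 : 0 < u / 2 < u by rewrite divr_gt0//= ltr_pdivrMr// ltr_pMr// ltr1n.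
have u2T : 0 < u / 2 < T by case/andP: u2 => -> /lt_trans; apply.
have [cy _ _] := reg.1 (u / 2) 1 u2T g1.
have uin : `]u / 2, T[%classic u by rewrite /= in_itv/= u1 andbT; case/andP: u2.
have oin : open_nbhs u `]u / 2, T[%classic by split => //; exact: interval_open.
have nin : interior `[u / 2, T]%classic u.
  rewrite /interior/=; apply: filterS (open_nbhs_nbhs oin) => q /=.
  by rewrite !in_itv/= => /andP[/ltW -> /ltW ->].
by have [_] := cy u (interior_subset nin); rewrite within_interior.
Qed.

Lemma continuous_ip_A_solution phi u : space_regular A S T eta alpha y ->
  0 < u < T -> {for u, continuous (fun s : R => ip phi (A (y s)) : R)}.
Proof.
move=> reg /[dup] uT /andP[u0 u1].
have oin : open_nbhs u `]0, T[%classic.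
  by split; [exact: interval_open|rewrite /= in_itv].
have lim := solution_cvg_graph_norm reg uT.
apply: (@cvg_dist_le _ _ _ _ _ _ _ (fun q => `|phi| * Xnorm A S 1 (y q - y u))).
  apply: filterS (open_nbhs_nbhs oin) => q /=; rewrite in_itv/= => qT.
  have dq := solution_domA reg qT.
  have du := solution_domA reg uT.
  rewrite -ipBr -AB// (le_trans (cauchy_schwarz ip_norm _ _))// ler_wpM2l//.
  rewrite /Xnorm npow1; last exact: domAB.
  by rewrite normrN lerDr.
have cz : `|phi| * Xnorm A S 1 (y q - y u) @[q --> u] --> `|phi| * 0.
  by apply: cvgM; [exact: cvg_cst|exact: lim].
by rewrite mulr0 in cz.
Qed.

Lemma measurable_ip_A_solution phi lambda t : space_regular A S T eta alpha y ->
  0 < t < T ->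
  measurable_fun `]0, t] (fun s : R => cutoff ip phi lambda (y s) / lambda * ip phi (A (y s)) : R).
Proof.
move=> reg /andP[t0 tT]; apply: (@measurable_funS _ _ _ _ `]0, T[%classic) => //.
  by move=> s /=; rewrite !in_itv/= => /andP[-> /le_lt_trans]; apply.
apply: open_continuous_measurable_fun; first exact: interval_open.
move=> s; rewrite inE/= in_itv/= => sT.
have cy : {for s, continuous y}.
  apply: (@cvg_dist_le _ _ _ _ _ _ _ (fun q => Xnorm A S 1 (y q - y s))).
    by near=> q; exact: norm_le_Xnorm.
  exact: solution_cvg_graph_norm.
apply: cvgM; last exact: continuous_ip_A_solution.
apply: cvgM; last exact: cvg_cst.
exact: (continuous_comp cy (@cutoff_continuous _ _ ip ip_norm phi lambda _)).
Unshelve. all: by end_near. Qed.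

(** F(z) = cutoff(z)^2 / (2 lambda) is C^1 with Lipschitz gradient, so every Hoelder
    exponent below 1 is available in the chain rule. *)
Lemma cutoff_chain_rule phi lambda t : chain_rule ip A sigma x T eta alpha y ->
  0 < lambda -> 0 < t <= T -> exists I : 'I_m -> R,
  (forall i, young (V := R^o) (x i)
     (fun u => cutoff ip phi lambda (y u) / lambda * ip phi (sigma i (y u))) 0 t (I i)) /\
  (2 * lambda)^-1 * cutoff ip phi lambda (y t) ^+ 2 -
  (2 * lambda)^-1 * cutoff ip phi lambda (y 0) ^+ 2 =
    (\int[mu]_(u in `[0, t]) (cutoff ip phi lambda (y u) / lambda * ip phi (A (y u)))) +
    \sum_(i < m) I i.
Proof.
move=> chain lambda0 /andP[t0 tT].
pose cut := cutoff ip phi lambda.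
pose F (_ : R) z := (2 * lambda)^-1 * cut z ^+ 2.
pose Fx (_ : R) z := (cut z / lambda) *: phi.
(* The midpoint of ](1 - eta) / alpha, 1[, so that g < 1 < eta + alpha g. *)
pose g := ((1 - eta) / alpha + 1) / 2.
have [eta1 alpha1] : eta < 1 /\ alpha < 1.
  by split; [case/andP: eta_itv | case/andP: alpha_itv].
have q0 : 0 < (1 - eta) / alpha by rewrite divr_gt0 ?subr_gt0.
have q1 : (1 - eta) / alpha < 1 by rewrite ltr_pdivrMr// mul1r ltrBlDl.
have g01 : 0 < g < 1.
  by rewrite divr_gt0 ?addr_gt0//= ltr_pdivrMr// mul1r ltrD2r.
have gbig : 1 < eta + alpha * g.
  rewrite -ltrBlDl -ltr_pdivrMl// mulrC ltr_pdivlMr// mulr_natr mulr2n.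
  by rewrite ltrD2l.
have ccut : continuous cut := @cutoff_continuous _ _ ip ip_norm phi lambda.
have cont2 (V : topologicalType) (f : X -> V) : continuous f -> continuous (fun p : R * X => f p.2).
  by move=> cf p; apply: (continuous_comp _ (cf p.2)); exact: cvg_snd.
have C1 : C1_on ip T F (fun _ _ => 0) Fx.
  split.
  - move=> s z _; rewrite (_ : (fun _ => _) = cst 0); first exact: cvg_cst.
    by apply/funext => r; rewrite subrr mulr0.
  - move=> s z _; have [d h] := cutoff_sqr_diff ip_norm phi lambda (2 * lambda)^-1 z.
    split; first exact: d.
    move=> w; rewrite h; congr (ip (_ *: _) _); rewrite /cut.
    by field; rewrite gt_eqF.
  - apply: continuous_subspaceT; apply: (cont2 _ (fun z => (2 * lambda)^-1 * cut z ^+ 2)) => z.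
    by apply: cvgM; [exact: cvg_cst|apply: cvgM; exact: ccut].
  - by apply: continuous_subspaceT; exact: cst_continuous.
  - apply: continuous_subspaceT; apply: (cont2 _ (fun z => (cut z / lambda) *: phi)) => z.
    by apply: cvgZ; last (exact: cvg_cst); apply: cvgM; [exact: ccut|exact: cvg_cst].
have ht (r : R) : exists C, forall s t z, 0 <= s <= T -> 0 <= t <= T -> `|z| <= r ->
    `|Fx s z - Fx t z| <= C * `|s - t| `^ alpha.
  by exists 0 => s' t' z _ _ _; rewrite subrr normr0 mul0r.
(* The gradient is Lipschitz in z, hence g-Hoelder on bounded sets. *)
have hx (r : R) : exists C, forall t z w, 0 <= t <= T -> `|z| <= r -> `|w| <= r ->
    `|Fx t z - Fx t w| <= C * `|z - w| `^ g.
  exists (`|phi| / lambda * `|phi| * (r + r) `^ (1 - g)) => t' z w _ zr wr.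
  rewrite -scalerBl -mulrBl normrZ normrM normfV (gtr0_norm lambda0).
  apply: (@le_trans _ _ (`|phi| * `|z - w| / lambda * `|phi|)).
    by rewrite ler_wpM2r// ler_wpM2r ?invr_ge0 ?(ltW lambda0)// cutoff_lipschitz.
  rewrite [leRHS](_ : _ = `|phi| * ((r + r) `^ (1 - g) * `|z - w| `^ g) / lambda * `|phi|); last by ring.
  rewrite ler_wpM2r// ler_wpM2r ?invr_ge0 ?(ltW lambda0)// ler_wpM2l//.
  have [/eqP zw|zw] := boolP (`|z - w| == 0); first by rewrite zw mulr_ge0 ?powR_ge0.
  rewrite -{1}[`|z - w|]powRr1// -{1}(subrK g 1) powRD ?(negPf zw) ?implybT//.
  rewrite ler_wpM2r ?powR_ge0//; have g1 : 0 <= 1 - g by case/andP: g01 => _ /ltW; rewrite subr_ge0.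
  have zr2 : `|z - w| <= r + r by rewrite (le_trans (ler_normB _ _))// lerD.
  by apply: ge0_ler_powR; rewrite ?nnegrE// (le_trans _ zr2).
have simp : simplex2 0 T (0, t) by split.
have [I [hI E]] := chain F _ Fx g C1 g01 gbig ht hx 0 t simp.
exists I; split => [i|].
  by have := hI i; under eq_fun do rewrite ipZl.
rewrite E Rintegral_cst// mul0r add0r; congr (_ + _); apply: eq_Rintegral => u _.
by rewrite ipZl.
Qed.

(** The integrand is alpha-Hoelder in time, so the Young integral is its germ at 0
    up to O(t^(eta + alpha)), and there cutoff / lambda = 1 as <phi, psi> = 0. *)
Lemma cutoff_noise_estimate phi lambda : 0 < lambda -> ip phi psi = 0 ->
  (forall t, 0 <= t <= T -> ip phi (y t) <= 0) -> exists2 K, 0 <= K &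
  forall t (I : 'I_m -> R), 0 < t <= T ->
  (forall i, young (V := R^o) (x i)
     (fun u => cutoff ip phi lambda (y u) / lambda * ip phi (sigma i (y u))) 0 t (I i)) ->
  `|\sum_(i < m) I i - \sum_(i < m) ip phi (sigma i psi) * (x i t - x i 0)| <=
    K * t `^ (eta + alpha).
Proof.
move=> lambda0 z hK.
have l1 : lambda^-1 * lambda = 1 by rewrite mulVf// gt_eqF.
have c01 u : 0 <= u <= T -> `|cutoff ip phi lambda (y u) / lambda| <= 1.
  move=> uT; rewrite normrM normfV (gtr0_norm lambda0) ler_pdivrMr// mul1r.
  rewrite ger0_norm /cutoff; last by rewrite le_max lexx orbT.
  by rewrite ge_max (ltW lambda0) andbT gerDl hK.
have [H H0 hH] := solution_holder.
have each i : exists K, 0 <= K /\ forall t v, 0 < t <= T ->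
    young (V := R^o) (x i)
     (fun u => cutoff ip phi lambda (y u) / lambda * ip phi (sigma i (y u))) 0 t v ->
    `|v - ip phi (sigma i psi) * (x i t - x i 0)| <= K * t `^ (eta + alpha).
  have [Cx Cx0 hx] := x_holder_cst i.
  have [Hs Hs0 hHs] := sigma_solution_holder i.
  have [B B0 hB] := sigma_solution_bound i.
  pose Cg := `|phi| * H / lambda * (`|phi| * B) + `|phi| * Hs.
  have Cg0 : 0 <= Cg.
    by rewrite addr_ge0// ?mulr_ge0// ?invr_ge0 ?(ltW lambda0)// mulr_ge0.
  exists `|sewing_cst (Cx * Cg) (eta + alpha)|; split => // t v /andP[t0 tT] hv.
  have hg s u : 0 <= s -> s <= u -> u <= T ->
      `|cutoff ip phi lambda (y s) / lambda * ip phi (sigma i (y s)) -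
        cutoff ip phi lambda (y u) / lambda * ip phi (sigma i (y u))| <= Cg * (u - s) `^ alpha.
    move=> s0 su uT; have sT : 0 <= s <= T by rewrite s0 (le_trans su).
    have uT' : 0 <= u <= T by rewrite uT (le_trans s0).
    rewrite [X in `|X|](_ : _ = (cutoff ip phi lambda (y s) - cutoff ip phi lambda (y u)) / lambda * ip phi (sigma i (y s))
      + cutoff ip phi lambda (y u) / lambda * ip phi (sigma i (y s) - sigma i (y u))); last by rewrite ipBr; ring.
    apply: (le_trans (ler_normD _ _)); rewrite /Cg [leRHS]mulrDl; apply: lerD.
      have -> : `|phi| * H / lambda * (`|phi| * B) * (u - s) `^ alpha =
        `|phi| * (H * (u - s) `^ alpha) / lambda * (`|phi| * B) by ring.
      rewrite normrM ler_pM//.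
        rewrite normrM normfV (gtr0_norm lambda0) ler_wpM2r ?invr_ge0 ?(ltW lambda0)//.
        by rewrite (le_trans (cutoff_lipschitz ip_norm _ _ _ _))// ler_wpM2l// hH.
      rewrite (le_trans (cauchy_schwarz ip_norm _ _))// ler_wpM2l//.
      exact: le_trans (norm_le_Xnorm alpha _) (hB s sT).2.
    apply: (@le_trans _ _ (1 * (`|phi| * (Hs * (u - s) `^ alpha)))); last by rewrite mul1r mulrA.
      rewrite normrM ler_pM ?c01// (le_trans (cauchy_schwarz ip_norm _ _))// ler_wpM2l//.
      exact: hHs.
  have := young_germ_estimate (ltW eta_gt0) (ltW alpha_gt0) eta_alpha Cx0 Cg0 (lexx 0) t0 tT hx hg hv.
  rewrite solution_at0 /cutoff z addr0 max_l ?(ltW lambda0)// divff ?gt_eqF// mul1r subr0.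
  rewrite [_ * (_ - _)]mulrC => /le_trans; apply; rewrite ler_wpM2r ?powR_ge0//.
  exact: ler_norm.
have [K hKi] := choice each.
exists (\sum_(i < m) K i) => [|t I tt hI]; first by rewrite sumr_ge0// => i _; exact: (hKi i).1.
rewrite -sumrB mulr_suml (le_trans (ler_norm_sum _ _ _))// ler_sum// => i _.
exact: ((hKi i).2 t).
Qed.

(** At positive times y is in D(A), where [npow_pairing] applies. *)
Lemma drift_integral eps phi lambda t : space_regular A S T eta alpha y ->
  0 <= eps < 1 -> Xdom A S eps phi -> 0 < t < T ->
  \int[mu]_(u in `[0, t]) (cutoff ip phi lambda (y u) / lambda * ip phi (A (y u))) =
  - \int[mu]_(u in `[0, t]) (Num.max (lambda + ip phi (y u)) 0 / lambda *
       ip (npow A S eps phi) (npow A S (1 - eps) (y u))).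
Proof.
move=> reg eps01 hphi tT; rewrite -RintegralN_any.
apply: Rintegral_obnd_eq; first exact: measurable_ip_A_solution.
move=> u /andP[u0 ut]; have uT : 0 < u < T.
  by rewrite u0 (le_lt_trans ut)//; case/andP: tT.
by rewrite (npow_pairing eps01 hphi (solution_domA reg uT)) ipNr mulrN opprK.
Qed.

(** F(z) = cutoff(z)^2 / (2 lambda) is at most lambda / 2 on the half-space, with
    equality at psi, so the right-hand side of [cutoff_chain_rule] is
    nonpositive. *)
Lemma boundary_inequality_drift eps phi lambda beta :
  space_regular A S T eta alpha y -> chain_rule ip A sigma x T eta alpha y ->
  0 <= eps < 1 -> Xdom A S eps phi -> 0 < lambda ->
  ip phi psi = 0 -> (forall t, 0 <= t <= T -> ip phi (y t) <= 0) ->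
  beta <= 1 ->
  (limf_esup (fun t : R => (t `^ (- beta) *
     (- (\int[mu]_(s in `[0, t]) (Num.max (lambda + ip phi (y s)) 0 / lambda *
          ip (npow A S eps phi) (npow A S (1 - eps) (y s)))) +
      \sum_(i < m) (ip phi (sigma i psi) * (x i t - x i 0))))%:E) 0^'+ <= 0)%E.
Proof.
move=> reg chain eps01 hphi lambda0 z hK b1.
have [K K0 hn] := cutoff_noise_estimate lambda0 z hK.
apply: (limf_esup_power_le0 K0 (le_lt_trans b1 eta_alpha)).
  by near=> t; rewrite subr0.
near=> t; have t0 : 0 < t by near: t; exact: nbhs_right_gt.
have tT : t < T by near: t; exact: nbhs_right_lt.
have tt : 0 < t <= T by rewrite t0 ltW.
have tT' : 0 < t < T by rewrite t0.
have [I [hI E]] := cutoff_chain_rule phi chain lambda0 tt.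
have hN := hn t I tt hI; rewrite subr0.
rewrite (drift_integral lambda reg eps01 hphi tT') in E.
have le0 : (2 * lambda)^-1 * cutoff ip phi lambda (y t) ^+ 2 -
  (2 * lambda)^-1 * cutoff ip phi lambda (y 0) ^+ 2 <= 0.
  have cl : cutoff ip phi lambda (y 0) = lambda.
    by rewrite solution_at0 /cutoff z addr0 max_l// ltW.
  have cp : 0 <= cutoff ip phi lambda (y t) by rewrite /cutoff le_max lexx orbT.
  rewrite subr_le0 cl ler_wpM2l ?invr_ge0 ?mulr_ge0 ?(ltW lambda0)//.
  rewrite ler_sqr ?nnegrE ?(ltW lambda0)// /cutoff ge_max (ltW lambda0) andbT gerDl.
  by apply: hK; rewrite !ltW.
rewrite E in le0; rewrite distrC in hN; have h := le_trans (ler_norm _) hN.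
rewrite lerBlDr in h; apply: le_trans (lerD (lexx _) h) _.
by rewrite addrCA gerDl.
Unshelve. all: by end_near. Qed.

End mild_solutions.
End self_adjoint_semigroup.

Lemma boundary_half_space (R : realType) (X : normedModType R) (ip : {dot X for @idfun R})
    (ip_norm : forall u : X, ip u u = `|u| ^+ 2) (phi z : X) :
  boundary (half_space ip phi) z -> ip phi z = 0.
Proof.
have cont : continuous (fun w : X => ip w phi : R).
  by move=> w; apply: (cvg_ip ip_norm); [exact: cvg_id|exact: cvg_cst].
move=> [zK zi]; rewrite ipC; apply/eqP; rewrite eq_le; apply/andP; split.
  rewrite leNgt; apply/negP => pos.
  have [w [/= wK wpos]] := zK _ (cvgr_gt _ (cont z) _ pos).
  by move: wK; rewrite /half_space/= leNgt wpos.
rewrite leNgt; apply/negP => neg; apply: zi.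
rewrite /interior/=; apply: filterS (cvgr_lt _ (cont z) _ neg) => w /=.
exact: ltW.
Qed.

Theorem proposition6p1 (R : realType) (X : completeNormedModType R)
    (ip : {dot X for @idfun R})
    (ip_norm : forall u : X, ip u u = `|u| ^+ 2)
    (A : operator X) (S : R -> {linear X -> X})
    (A_linear : linear_operator A)
    (A_closed : closed_operator A)
    (A_self_adjoint : self_adjoint ip A)
    (A_nonpositive : nonpositive ip A)
    (S_C0 : C0_semigroup S)
    (S_analytic : analytic_semigroup S)
    (A_generates : generates A S)
    (S_estimates : semigroup_estimates A S)
    (T eta alpha : R) (m : nat)
    (x : 'I_m -> R -> R) (sigma : 'I_m -> X -> X)
    (T_gt0 : 0 < T)
    (eta_itv : 2^-1 < eta < 1)
    (x_holder : forall i, holder_on T eta (x i))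
    (alpha_itv : 0 < alpha < 1)
    (eta_alpha : 1 < eta + alpha)
    (sigma_ok : forall i, sigma_assumptions A S alpha (sigma i))
    (standing : standing_assumptions ip A S sigma x T eta alpha)
    (eps zeta : R) (phi psi : X) (y : R -> X)
    (eps_itv : 0 <= eps < 1)
    (phi_eps : Xdom A S eps phi)
    (zeta_itv : alpha <= zeta < 1)
    (psi_zeta : Xdom A S zeta psi)
    (y_sol : solution A S sigma x T alpha psi y)
    (K_invariant : invariant_set A S sigma x T alpha (half_space ip phi)) :
  (boundary (half_space ip phi) psi ->
   eta <= zeta + eps <= 1 ->
   (forall beta : R, eta <= beta < zeta + eps ->
      (limf_esup (fun t : R =>
         (t `^ (- beta) *
          \sum_(i < m) (ip phi (sigma i psi) * (x i t - x i 0)))%:E)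
         0^'+ <= 0)%E) /\
   (forall beta : R, zeta + eps <= beta <= 1 ->
      (ereal_sup [set limf_esup (fun t : R =>
         (t `^ (- beta) *
          (- (\int[@lebesgue_measure R]_(s in `[0, t])
                (Num.max (lambda + ip phi (y s)) 0 / lambda *
                 ip (npow A S eps phi) (npow A S (1 - eps) (y s)))) +
           \sum_(i < m) (ip phi (sigma i psi) * (x i t - x i 0))))%:E)
         0^'+ | lambda in [set lambda : R | (0 < lambda)%R]] <= 0)%E))
  /\
  (half_space ip phi psi ->
   forall t0 : R, 0 <= t0 < T ->
   boundary (half_space ip phi) (y t0) ->
   1 < zeta + eps ->
   (forall beta : R, eta <= beta < 1 ->
      (limf_esup (fun t : R =>
         (`|t - t0| `^ (- beta) *
          \sum_(i < m) (ip phi (sigma i (y t0)) * (x i t - x i t0)))%:E)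
         t0^'+ <= 0)%E) /\
   (limf_esup (fun t : R =>
      (`|t - t0| `^ (-1) *
       \sum_(i < m) (ip phi (sigma i (y t0)) * (x i t - x i t0)))%:E)
      t0^'+
    - (ip (npow A S eps phi) (npow A S (1 - eps) (y t0)))%:E <= 0)%E).
Proof.
have alpha_le1 : alpha <= 1 by case/andP: alpha_itv => _ /ltW.
have [alpha_gt0 alpha_lt1] : 0 < alpha /\ alpha < 1 by case/andP: alpha_itv.
have [zeta_ge zeta_lt1] : alpha <= zeta /\ zeta < 1 by case/andP: zeta_itv.
have [eps_ge0 eps_lt1] : 0 <= eps /\ eps < 1 by case/andP: eps_itv.
have eta_gt0 : 0 < eta by case/andP: eta_itv => h _; exact: lt_trans h.
have zeta_ge0 : 0 <= zeta by rewrite (le_trans _ zeta_ge)// ltW.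
have alpha_zeta : 0 <= alpha <= zeta by rewrite (ltW alpha_gt0).
have psi_alpha := Xdom_le A_linear S_C0 S_estimates alpha_zeta (ltW zeta_lt1) psi_zeta.
have [_ /(_ psi y psi_alpha y_sol)[reg _ chain]] := standing.
have inv : half_space ip phi psi -> forall t, 0 <= t <= T -> ip phi (y t) <= 0.
  by move=> Kpsi t tT; rewrite ipC; exact: K_invariant psi_alpha Kpsi y_sol t tT.
split=> [bpsi /andP[eta_le le1]|Kpsi t0 t0T bt0 ze].
  have z := boundary_half_space ip_norm bpsi.
  have hK : forall t, 0 <= t <= T -> ip phi (y t) <= 0.
    by apply: inv; rewrite /half_space/= ipC z.
  split=> beta /andP[beta_ge beta_le].
    have ze : 0 < zeta + eps <= 1 by rewrite le1 andbT (lt_le_trans eta_gt0).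
    exact: (boundary_inequality_below ip_norm A_linear A_self_adjoint A_nonpositive
      S_C0 A_generates S_estimates T_gt0 eta_itv x_holder alpha_itv eta_alpha
      sigma_ok y_sol eps_itv zeta_ge0 ze phi_eps psi_zeta z hK beta_le).
  apply: ge_ereal_sup => _ [lambda lambda_gt0 <-].
  exact: (boundary_inequality_drift ip_norm A_linear A_self_adjoint A_nonpositive
      S_C0 A_generates S_estimates T_gt0 eta_itv x_holder alpha_itv eta_alpha
      sigma_ok y_sol reg chain eps_itv phi_eps lambda_gt0 z hK beta_le).
have eps01 : 0 < eps < 1.
  by rewrite eps_lt1 andbT -(ltrD2l zeta) addr0 (lt_trans zeta_lt1).
have z := boundary_half_space ip_norm bt0.
have hK := inv Kpsi.
have hy := solution_Xdom A_linear S_C0 S_estimates T_gt0 eta_itv alpha_itv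
  eta_alpha y_sol reg eps_itv zeta_lt1 ze psi_zeta t0T.
split=> [beta /andP[_ beta_lt1]|].
  exact: (boundary_inequality_right ip_norm A_linear A_self_adjoint A_nonpositive
      S_C0 A_generates S_estimates T_gt0 eta_itv x_holder alpha_itv eta_alpha
      sigma_ok y_sol eps01 t0T phi_eps hy z hK beta_lt1).
rewrite lee_subel_addr ?add0e//.
exact: (boundary_slope_right ip_norm A_linear A_self_adjoint A_nonpositive
      S_C0 A_generates S_estimates T_gt0 eta_itv x_holder alpha_itv eta_alpha
      sigma_ok y_sol eps01 t0T phi_eps hy z hK).
Qed.
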